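(* Let $h\colon S\to R$ be a flat homomorphism of local, noetherian rings, let $k=S/\mathfrak m_S$ denote the residue field and $A=R\otimes_Sk$ the central fibre. Given an $S$-algebra map $R\to S$, let $I$ denote its kernel and $I^*=\operatorname{Hom}_R(I,R)$. Assume $A$ is Gorenstein of dimension $1$. (i) The $R$-module $I$ is stably reflexive with respect to $h$. (ii) The $R$-module $I^*/R$ is isomorphic to $S$. (iii) The $R$-submodule $J$ of the total quotient ring $K(R)$ consisting of the elements that multiply $I$ into $R$ is isomorphic to $I^*$. (iv) The image of the pairing $\mathfrak m_A\otimes_A\mathfrak m_A^*\to A$, $u\otimes\rho\mapsto\rho(u)$, equals $A$ if $A$ is a regular ring and $\mathfrak m_A$ if not. In particular $\mathfrak m_A^*\otimes_Ak$ is a $k$-vector space of dimension $1$ in the regular case and of dimension $2$ otherwise.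
   Context: Rings are commutative and unital; $\mathfrak m_A$ is the maximal ideal of a local ring $A$, and $M^*=\operatorname{Hom}_A(M,A)$ for an $A$-module $M$. In (ii), $R\to I^*$ is the dual of the inclusion $I\subseteq R$ (i.e. $r\mapsto$ multiplication by $r$) and $S$ is an $R$-module via the given map $R\to S$. An $A$-module $M$ is stably reflexive if the evaluation map $M\to M^{**}$ is an isomorphism and $\operatorname{Ext}^i_A(M,A)=0=\operatorname{Ext}^i_A(M^*,A)$ for all $i>0$. For a flat ring homomorphism $h\colon S\to R$, an $R$-module $M$ is stably reflexive with respect to $h$ if $M$ is $S$-flat and $M\otimes_Sk(s)$ is a stably reflexive $R\otimes_Sk(s)$-module for all $s\in\operatorname{Spec}S$ which are images of closed points of $\operatorname{Spec}R$. *)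

(* Defs.v *)
From HB Require Import structures.
From mathcomp Require Import all_boot all_algebra.
From mathcomp Require Import boolp ring.

Set Implicit Arguments.
Unset Strict Implicit.
Unset Printing Implicit Defensive.

Import GRing.Theory.
Local Open Scope ring_scope.
Local Open Scope quotient_scope.

(* Rings are [comPzRingType]s, so that a quotient ring or a tensor product of
   algebras is a ring even when it is zero.  An ideal is a submodule of R^o. *)
Notation ideal R := (submodClosed (GRing.regular R)).

Section PropQuotient.
Variables (T : choiceType) (E : T -> T -> Prop).
Hypothesis (Erefl : forall x, E x x) (Esym : forall x y, E x y -> E y x).
Hypothesis (Etrans : forall x y z, E x y -> E y z -> E x z).

Lemma asbool_equiv : equiv_class_of (fun x y => `[< E x y >]).
Proof.
split=> [x|x y|y x z]; first exact/asboolP.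
  by apply/asboolP/asboolP => /Esym.
by move=> /asboolP xy /asboolP yz; apply/asboolP; apply: Etrans yz.
Qed.

End PropQuotient.

Section Submodule.
Variables (R : pzRingType) (M : lmodType R) (N : submodClosed M).

Record submod : Type := Submod { submod_val : M; _ : submod_val \in N }.

HB.instance Definition _ := [isSub for submod_val].
HB.instance Definition _ := [Choice of submod by <:].
HB.instance Definition _ := [SubChoice_isSubLmodule of submod by <:].

End Submodule.

Section SpanAndImage.
Variables (R : comPzRingType) (M : lmodType R).

Definition span (X : {pred M}) : {pred M} := fun x =>
  `[< exists2 s : seq (R * M), all (fun c => c.2 \in X) s
      & x = \sum_(c <- s) c.1 *: c.2 >].

Lemma span_submod X : submod_closed (span X).
Proof.
split; first by apply/asboolP; exists [::]; rewrite ?big_nil.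
move=> a x y /asboolP[s sX ->] /asboolP[t tX ->]; apply/asboolP.
exists ([seq (a * c.1, c.2) | c <- s] ++ t).
  by rewrite all_cat tX andbT all_map.
rewrite big_cat big_map scaler_sumr; congr (_ + _).
by apply: eq_bigr => c _; rewrite scalerA.
Qed.

HB.instance Definition _ X :=
  GRing.isSubmodClosed.Build R M (span X) (span_submod X).

Definition limage (U : lmodType R) (f : {linear U -> M}) : {pred M} :=
  fun y => `[< exists x, f x = y >].

Lemma limage_submod U f : submod_closed (@limage U f).
Proof.
split; first by apply/asboolP; exists 0; rewrite linear0.
move=> a x y /asboolP[u <-] /asboolP[v <-]; apply/asboolP.
by exists (a *: u + v); rewrite linearP.
Qed.

HB.instance Definition _ U f :=
  GRing.isSubmodClosed.Build R M (@limage U f) (limage_submod f).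

End SpanAndImage.

Section QuotientModule.
Variables (R : pzRingType) (M : lmodType R) (N : submodClosed M).

Definition qmod_rel (x y : M) : bool := x - y \in N.

Lemma submod_oppr x : x \in N -> - x \in N.
Proof. by move=> xN; rewrite -scaleN1r rpredZ. Qed.

Lemma qmod_equiv : equiv_class_of qmod_rel.
Proof.
have symN x y : x - y \in N -> y - x \in N.
  by move=> /submod_oppr; rewrite opprB.
split=> [x|x y|y x z]; rewrite /qmod_rel ?subrr ?rpred0 //.
  by apply/idP/idP; apply: symN.
by move=> xy yz; rewrite -[x](subrK y) -addrA rpredD.
Qed.

Canonical qmod_equiv_rel := EquivRelPack qmod_equiv.
Canonical qmod_encModRel := defaultEncModRel qmod_rel.

Definition qmod : Type := {eq_quot qmod_rel}.
HB.instance Definition _ : EqQuotient M qmod_rel qmod := EqQuotient.on qmod.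
HB.instance Definition _ := Choice.on qmod.

Definition qmod_pi (x : M) : qmod := \pi_qmod x.

Lemma qmod_piP x y : reflect (qmod_pi x = qmod_pi y) (x - y \in N).
Proof. exact: (eqquotP qmod x y). Qed.

Lemma qmod_ind (P : qmod -> Prop) : (forall x, P (qmod_pi x)) -> forall q, P q.
Proof. by move=> h q; rewrite -[q]reprK; apply: h. Qed.

Lemma qmod_reprP x : repr (qmod_pi x) - x \in N.
Proof. by apply/qmod_piP; rewrite /qmod_pi reprK. Qed.

Definition qmod_add (p q : qmod) := qmod_pi (repr p + repr q).
Definition qmod_opp (p : qmod) := qmod_pi (- repr p).
Definition qmod_scale a (p : qmod) := qmod_pi (a *: repr p).

Lemma qmod_addE x y : qmod_add (qmod_pi x) (qmod_pi y) = qmod_pi (x + y).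
Proof.
by apply/qmod_piP; rewrite opprD addrACA rpredD // qmod_reprP.
Qed.

Lemma qmod_oppE x : qmod_opp (qmod_pi x) = qmod_pi (- x).
Proof. by apply/qmod_piP; rewrite -opprD submod_oppr // qmod_reprP. Qed.

Lemma qmod_scaleE a x : qmod_scale a (qmod_pi x) = qmod_pi (a *: x).
Proof. by apply/qmod_piP; rewrite -scalerBr rpredZ // qmod_reprP. Qed.

Lemma qmod_addA : associative qmod_add.
Proof.
by elim/qmod_ind=> x; elim/qmod_ind=> y; elim/qmod_ind=> z;
  rewrite !qmod_addE addrA.
Qed.
Lemma qmod_addC : commutative qmod_add.
Proof. by elim/qmod_ind=> x; elim/qmod_ind=> y; rewrite !qmod_addE addrC. Qed.
Lemma qmod_add0 : left_id (qmod_pi 0) qmod_add.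
Proof. by elim/qmod_ind=> x; rewrite qmod_addE add0r. Qed.
Lemma qmod_addN : left_inverse (qmod_pi 0) qmod_opp qmod_add.
Proof. by elim/qmod_ind=> x; rewrite qmod_oppE qmod_addE addNr. Qed.

HB.instance Definition _ :=
  GRing.isZmodule.Build qmod qmod_addA qmod_addC qmod_add0 qmod_addN.

Lemma qmod_scaleA a b q : qmod_scale a (qmod_scale b q) = qmod_scale (a * b) q.
Proof. by elim/qmod_ind: q => x; rewrite !qmod_scaleE scalerA. Qed.
Lemma qmod_scale1 : left_id 1 qmod_scale.
Proof. by elim/qmod_ind=> x; rewrite qmod_scaleE scale1r. Qed.
Lemma qmod_scaleDr : right_distributive qmod_scale +%R.
Proof.
move=> a; elim/qmod_ind=> x; elim/qmod_ind=> y.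
by rewrite [qmod_pi x + _]qmod_addE !qmod_scaleE [RHS]qmod_addE scalerDr.
Qed.
Lemma qmod_scaleDl q : {morph qmod_scale^~ q : a b / a + b}.
Proof.
by move=> a b; elim/qmod_ind: q => x; rewrite !qmod_scaleE [RHS]qmod_addE scalerDl.
Qed.

HB.instance Definition _ := GRing.Zmodule_isLmodule.Build R qmod
  qmod_scaleA qmod_scale1 qmod_scaleDr qmod_scaleDl.

Lemma qmod_pi_linear : linear qmod_pi.
Proof. by move=> a x y; rewrite [a *: qmod_pi x]qmod_scaleE [RHS]qmod_addE. Qed.
HB.instance Definition _ := GRing.isLinear.Build R M qmod _ qmod_pi qmod_pi_linear.

End QuotientModule.

Section QuotientRing.
Variables (R : comPzRingType) (I : ideal R).

Definition qring : Type := qmod I.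
HB.instance Definition _ := GRing.Zmodule.on qring.

Definition qring_pi (x : R) : qring := qmod_pi I x.
Definition qring_mul (p q : qring) : qring :=
  qring_pi ((repr (p : qmod I) : R) * (repr (q : qmod I) : R)).

Lemma qring_mulE x y : qring_mul (qring_pi x) (qring_pi y) = qring_pi (x * y).
Proof.
apply/(qmod_piP I); set x' := repr _; set y' := repr _.
rewrite -[X in X - _](subrK (x * y')) -addrA -mulrBl -mulrBr.
rewrite rpredD //; last exact: (rpredZ x (qmod_reprP I y)).
by rewrite mulrC; apply: (rpredZ y' (qmod_reprP I x)).
Qed.

Lemma qring_mulA : associative qring_mul.
Proof.
by elim/qmod_ind=> x; elim/qmod_ind=> y; elim/qmod_ind=> z;
  rewrite -!/(qring_pi _) !qring_mulE mulrA.
Qed.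
Lemma qring_mulC : commutative qring_mul.
Proof.
by elim/qmod_ind=> x; elim/qmod_ind=> y; rewrite -!/(qring_pi _) !qring_mulE mulrC.
Qed.
Lemma qring_mul1 : left_id (qring_pi 1) qring_mul.
Proof. by elim/qmod_ind=> x; rewrite -!/(qring_pi _) qring_mulE mul1r. Qed.
Lemma qring_piD : {morph qring_pi : x y / x + y}.
Proof. by move=> x y; rewrite [RHS](qmod_addE I). Qed.
Lemma qring_mulDl : left_distributive qring_mul +%R.
Proof.
elim/qmod_ind=> x; elim/qmod_ind=> y; elim/qmod_ind=> z.
by rewrite -!/(qring_pi _) -qring_piD !qring_mulE mulrDl qring_piD.
Qed.

HB.instance Definition _ := GRing.Zmodule_isComPzRing.Build qring
  qring_mulA qring_mulC qring_mul1 qring_mulDl.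

Lemma qring_pi_zmod : zmod_morphism qring_pi.
Proof. by move=> x y; apply: (raddfB (qmod_pi I)). Qed.
Lemma qring_pi_monoid : monoid_morphism qring_pi.
Proof. by split=> // x y; rewrite -qring_mulE. Qed.
HB.instance Definition _ := GRing.isZmodMorphism.Build R qring qring_pi qring_pi_zmod.
HB.instance Definition _ :=
  GRing.isMonoidMorphism.Build R qring qring_pi qring_pi_monoid.

End QuotientRing.

Definition restr (S R : comPzRingType) (f : {rmorphism S -> R})
  (M : lmodType R) : Type := M.

Section Restriction.
Variables (S R : comPzRingType) (f : {rmorphism S -> R}) (M : lmodType R).
Local Notation restr := (restr f M).
HB.instance Definition _ := GRing.Zmodule.on restr.

Definition restr_scale (a : S) (x : restr) : restr := f a *: (x : M).
Lemma restr_scaleA a b x :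
  restr_scale a (restr_scale b x) = restr_scale (a * b) x.
Proof. by rewrite /restr_scale rmorphM scalerA. Qed.
Lemma restr_scale1 : left_id 1 restr_scale.
Proof. by move=> x; rewrite /restr_scale rmorph1 scale1r. Qed.
Lemma restr_scaleDr : right_distributive restr_scale +%R.
Proof. by move=> a x y; apply: scalerDr. Qed.
Lemma restr_scaleDl x : {morph restr_scale^~ x : a b / a + b}.
Proof. by move=> a b; rewrite /restr_scale rmorphD; apply: scalerDl. Qed.
HB.instance Definition _ := GRing.Zmodule_isLmodule.Build S restr
  restr_scaleA restr_scale1 restr_scaleDr restr_scaleDl.

Lemma restr_scaleE a (x : restr) : a *: x = f a *: (x : M).
Proof. by []. Qed.

End Restriction.

Section Hom.
Variables (R : comPzRingType) (M N : lmodType R).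

Definition Hom : Type := {linear M -> N}.
HB.instance Definition _ := gen_eqMixin Hom.
HB.instance Definition _ := gen_choiceMixin Hom.

Lemma Hom_ext (f g : Hom) : f =1 g -> f = g.
Proof.
case: f g => f [[fA] [fS]] [g [[gA] [gS]]] /= /funext fg; subst g.
by rewrite (Prop_irrelevance fA gA) (Prop_irrelevance fS gS).
Qed.

Definition Hom0 : Hom := \0%R.
Definition Hom_opp (f : Hom) : Hom := \- f.
Definition Hom_add (f g : Hom) : Hom := f \+ g.
Lemma Hom_addA : associative Hom_add.
Proof. by move=> f g k; apply: Hom_ext => x /=; rewrite addrA. Qed.
Lemma Hom_addC : commutative Hom_add.
Proof. by move=> f g; apply: Hom_ext => x /=; rewrite addrC. Qed.
Lemma Hom_add0 : left_id Hom0 Hom_add.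
Proof. by move=> f; apply: Hom_ext => x /=; rewrite add0r. Qed.
Lemma Hom_addN : left_inverse Hom0 Hom_opp Hom_add.
Proof. by move=> f; apply: Hom_ext => x /=; rewrite addNr. Qed.
HB.instance Definition _ :=
  GRing.isZmodule.Build Hom Hom_addA Hom_addC Hom_add0 Hom_addN.

Definition Hom_scale_fun a (f : Hom) (x : M) : N := a *: f x.
Lemma Hom_scale_linear a f : linear (Hom_scale_fun a f).
Proof.
by move=> b x y; rewrite /Hom_scale_fun linearP scalerDr !scalerA mulrC.
Qed.
HB.instance Definition _ a f :=
  GRing.isLinear.Build R M N _ (Hom_scale_fun a f) (Hom_scale_linear a f).
Definition Hom_scale a (f : Hom) : Hom := Hom_scale_fun a f.
Lemma Hom_scaleA a b f : Hom_scale a (Hom_scale b f) = Hom_scale (a * b) f.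
Proof. by apply: Hom_ext => x; apply: scalerA. Qed.
Lemma Hom_scale1 : left_id 1 Hom_scale.
Proof. by move=> f; apply: Hom_ext => x; apply: scale1r. Qed.
Lemma Hom_scaleDr : right_distributive Hom_scale +%R.
Proof. by move=> a f g; apply: Hom_ext => x; apply: scalerDr. Qed.
Lemma Hom_scaleDl f : {morph Hom_scale^~ f : a b / a + b}.
Proof. by move=> a b; apply: Hom_ext => x; apply: scalerDl. Qed.
HB.instance Definition _ := GRing.Zmodule_isLmodule.Build R Hom
  Hom_scaleA Hom_scale1 Hom_scaleDr Hom_scaleDl.

End Hom.

Notation dual M := (Hom M (GRing.regular _)).

Section Bidual.
Variables (R : comPzRingType) (M : lmodType R).

Definition eval_at (x : M) (phi : dual M) : R^o := (phi : {linear M -> R^o}) x.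
Lemma eval_at_linear x : linear (eval_at x).
Proof. by []. Qed.
HB.instance Definition _ x :=
  GRing.isLinear.Build R (dual M) R^o _ (eval_at x) (eval_at_linear x).
Definition bidual_eval (x : M) : dual (dual M) := eval_at x.

End Bidual.

Definition lmod_iso (R : comPzRingType) (M N : lmodType R) : Prop :=
  exists f : {linear M -> N}, bijective f.

Definition exact_at (A : Type) (B C : nmodType) (f : A -> B) (g : B -> C) : Prop :=
  forall y, g y = 0 <-> exists x, f x = y.

Definition projective (R : comPzRingType) (P : lmodType R) : Prop :=
  forall (M N : lmodType R) (p : {linear M -> N}) (f : {linear P -> N}),
    (forall y, exists x, p x = y) ->
    exists g : {linear P -> M}, forall x, p (g x) = f x.

Definition injective_module (R : comPzRingType) (E : lmodType R) : Prop :=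
  forall (M N : lmodType R) (u : {linear M -> N}) (f : {linear M -> E}),
    injective u -> exists g : {linear N -> E}, forall x, g (u x) = f x.

Definition projective_resolution (R : comPzRingType) (M : lmodType R)
    (P : nat -> lmodType R) (d : forall n, {linear P n.+1 -> P n})
    (e : {linear P 0%N -> M}) : Prop :=
  [/\ forall n, projective (P n), forall y, exists x, e x = y,
      exact_at (d 0%N) e & forall n, exact_at (d n.+1) (d n)].

(* Ext^(n+1)_R(M, N) = 0, the cohomology of Hom_R(P, N) in degree n + 1 for a
   projective resolution P of M. *)
Definition Ext_succ_eq0 (R : comPzRingType) (n : nat) (M N : lmodType R) : Prop :=
  exists (P : nat -> lmodType R) (d : forall n, {linear P n.+1 -> P n})
         (e : {linear P 0%N -> M}),
    projective_resolution d e /\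
    forall f : {linear P n.+1 -> N}, (forall x, f (d n.+1 x) = 0) ->
      exists g : {linear P n -> N}, forall x, f x = g (d n x).

Definition stably_reflexive (R : comPzRingType) (M : lmodType R) : Prop :=
  bijective (@bidual_eval R M) /\
  forall n, Ext_succ_eq0 n M R^o /\ Ext_succ_eq0 n (dual M) R^o.

Section Tensor.
Variables (S : comPzRingType) (M N : lmodType S).

(* Formal sums of pure tensors, modulo the congruence for concatenation
   generated by commutativity and bilinearity. *)
Inductive tensor_eq : seq (M * N) -> seq (M * N) -> Prop :=
| tensor_eq_refl s : tensor_eq s s
| tensor_eq_sym s t : tensor_eq s t -> tensor_eq t s
| tensor_eq_trans s t u : tensor_eq s t -> tensor_eq t u -> tensor_eq s u
| tensor_eq_cat s s' t t' :
    tensor_eq s s' -> tensor_eq t t' -> tensor_eq (s ++ t) (s' ++ t')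
| tensor_eq_comm s t : tensor_eq (s ++ t) (t ++ s)
| tensor_eq_0l y : tensor_eq [:: (0, y)] [::]
| tensor_eq_Dl x x' y : tensor_eq [:: (x + x', y)] [:: (x, y); (x', y)]
| tensor_eq_Dr x y y' : tensor_eq [:: (x, y + y')] [:: (x, y); (x, y')]
| tensor_eq_Z a x y : tensor_eq [:: (a *: x, y)] [:: (x, a *: y)].

Definition tensor_rel (s t : seq (M * N)) : bool := `[< tensor_eq s t >].

Canonical tensor_equiv_rel := EquivRelPack
  (asbool_equiv tensor_eq_refl tensor_eq_sym tensor_eq_trans : equiv_class_of tensor_rel).
Canonical tensor_encModRel := defaultEncModRel tensor_rel.

Definition tensor : Type := {eq_quot tensor_rel}.
HB.instance Definition _ : EqQuotient _ tensor_rel tensor := EqQuotient.on tensor.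
HB.instance Definition _ := Choice.on tensor.

Definition tclass (s : seq (M * N)) : tensor := \pi_tensor s.
Definition tens (x : M) (y : N) : tensor := tclass [:: (x, y)].

Lemma tclassP s t : tclass s = tclass t <-> tensor_eq s t.
Proof.
by split=> [/(eqquotP tensor)/asboolP|st]; last exact/(eqquotP tensor)/asboolP.
Qed.

Lemma tclass_ind (P : tensor -> Prop) :
  (forall s, P (tclass s)) -> forall t, P t.
Proof. by move=> h t; rewrite -[t]reprK; apply: h. Qed.

Lemma tclass_repr s : tensor_eq (repr (tclass s)) s.
Proof. by apply/tclassP; rewrite /tclass reprK. Qed.

Definition tensor_add (t u : tensor) := tclass (repr t ++ repr u).
Definition tensor_opp (t : tensor) := tclass [seq (- c.1, c.2) | c <- repr t].

Lemma tensor_addE s t : tensor_add (tclass s) (tclass t) = tclass (s ++ t).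
Proof. by apply/tclassP; apply: tensor_eq_cat; apply: tclass_repr. Qed.

Lemma tensor_eq_opp s t : tensor_eq s t ->
  tensor_eq [seq (- c.1, c.2) | c <- s] [seq (- c.1, c.2) | c <- t].
Proof.
elim=> /= {s t} [s|s t _ st|s t u _ st _ tu|s s' t t' _ h _ h'|s t|y|x x' y|x y y'|a x y].
- exact: tensor_eq_refl.
- exact: tensor_eq_sym.
- exact: tensor_eq_trans tu.
- by rewrite !map_cat; apply: tensor_eq_cat.
- by rewrite !map_cat; apply: tensor_eq_comm.
- by rewrite oppr0; apply: tensor_eq_0l.
- by rewrite opprD; apply: tensor_eq_Dl.
- exact: tensor_eq_Dr.
- by rewrite -scalerN; apply: tensor_eq_Z.
Qed.

Lemma tensor_oppE s :
  tensor_opp (tclass s) = tclass [seq (- c.1, c.2) | c <- s].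
Proof. by apply/tclassP; apply: tensor_eq_opp; apply: tclass_repr. Qed.

Lemma tensor_addA : associative tensor_add.
Proof.
by elim/tclass_ind=> s; elim/tclass_ind=> t; elim/tclass_ind=> u;
  rewrite !tensor_addE catA.
Qed.
Lemma tensor_addC : commutative tensor_add.
Proof.
elim/tclass_ind=> s; elim/tclass_ind=> t; rewrite !tensor_addE.
by apply/tclassP; apply: tensor_eq_comm.
Qed.
Lemma tensor_add0 : left_id (tclass [::]) tensor_add.
Proof. by elim/tclass_ind=> s; rewrite tensor_addE. Qed.
Lemma tensor_addN : left_inverse (tclass [::]) tensor_opp tensor_add.
Proof.
elim/tclass_ind=> s; rewrite tensor_oppE tensor_addE; apply/tclassP.
elim: s => [|[x y] s IHs] /=; first exact: tensor_eq_refl.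
rewrite -cat1s -[(x, y) :: s]cat1s.
apply: tensor_eq_trans (_ : tensor_eq ([:: (- x, y)] ++ [:: (x, y)]) _); last first.
  apply: tensor_eq_trans (tensor_eq_0l y); rewrite -[0](addNr x).
  exact/tensor_eq_sym/tensor_eq_Dl.
rewrite -[X in tensor_eq _ X]cats0 -catA; set s' := map _ _ in IHs *.
apply: tensor_eq_cat; first exact: tensor_eq_refl.
apply: tensor_eq_trans (tensor_eq_comm _ _) _; rewrite -catA.
rewrite -[X in tensor_eq _ X]/([::(x, y)] ++ [::]).
apply: tensor_eq_cat; first exact: tensor_eq_refl.
exact: tensor_eq_trans (tensor_eq_comm _ _) IHs.
Qed.

HB.instance Definition _ := GRing.isZmodule.Build tensor
  tensor_addA tensor_addC tensor_add0 tensor_addN.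

(* The map that a balanced f induces on the tensor product; f is a plain function
   here and the balancedness is supplied in the lemmas. *)
Definition tlift (P : zmodType) (f : M -> N -> P) (t : tensor) : P :=
  \sum_(c <- repr t) f c.1 c.2.

Definition balanced (P : zmodType) (f : M -> N -> P) : Prop :=
  [/\ forall x x' y, f (x + x') y = f x y + f x' y,
      forall x y y', f x (y + y') = f x y + f x y'
    & forall a x y, f (a *: x) y = f x (a *: y)].

Lemma tlift_class (P : zmodType) (f : M -> N -> P) s : balanced f ->
  tlift f (tclass s) = \sum_(c <- s) f c.1 c.2.
Proof.
move=> [fDl fDr fZ]; rewrite /tlift; move: (repr _) (tclass_repr s) => t.
elim=> {s t} [//|s t _ ->//|s t u _ -> _ ->//|s s' t t' _ h _ h'|s t|y|x x' y|x y y'|a x y].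
- by rewrite !big_cat h h'.
- by rewrite !big_cat /= addrC.
- rewrite big_cons !big_nil addr0 /=; apply: (addIr (f 0 y)).
  by rewrite -fDl addr0 add0r.
- by rewrite !big_cons !big_nil fDl !addr0.
- by rewrite !big_cons !big_nil fDr !addr0.
- by rewrite !big_cons !big_nil fZ.
Qed.

Lemma tlift_tens (P : zmodType) (f : M -> N -> P) x y : balanced f ->
  tlift f (tens x y) = f x y.
Proof. by move=> fB; rewrite tlift_class // big_cons big_nil addr0. Qed.

Lemma tliftD (P : zmodType) (f : M -> N -> P) t u : balanced f ->
  tlift f (t + u) = tlift f t + tlift f u.
Proof.
move=> fB; elim/tclass_ind: t => s; elim/tclass_ind: u => t.
by rewrite [_ + _]tensor_addE !tlift_class // big_cat.
Qed.

Lemma tlift0 (P : zmodType) (f : M -> N -> P) : balanced f -> tlift f 0 = 0.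
Proof. by move=> fB; rewrite -[0]/(tclass [::]) tlift_class // big_nil. Qed.

Lemma tensor_ind (P : tensor -> Prop) : P 0 ->
  (forall x y t, P t -> P (tens x y + t)) -> forall t, P t.
Proof.
move=> P0 PS; elim/tclass_ind; elim=> [|[x y] s IHs]; first exact: P0.
by rewrite -cat1s -tensor_addE; apply: PS.
Qed.

Lemma tens_balanced : balanced tens.
Proof.
split=> [x x' y|x y y'|a x y].
- by rewrite [RHS]tensor_addE; apply/tclassP; apply: tensor_eq_Dl.
- by rewrite [RHS]tensor_addE; apply/tclassP; apply: tensor_eq_Dr.
- by apply/tclassP; apply: tensor_eq_Z.
Qed.

Lemma tensDl x x' y : tens (x + x') y = tens x y + tens x' y.
Proof. by case: tens_balanced. Qed.
Lemma tensDr x y y' : tens x (y + y') = tens x y + tens x y'.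
Proof. by case: tens_balanced. Qed.
Lemma tensZ a x y : tens (a *: x) y = tens x (a *: y).
Proof. by case: tens_balanced. Qed.

Lemma tlift_ext (P : zmodType) (F G : tensor -> P) :
  (forall t u, F (t + u) = F t + F u) -> (forall t u, G (t + u) = G t + G u) ->
  (forall x y, F (tens x y) = G (tens x y)) -> F =1 G.
Proof.
move=> FD GD FG; elim/tensor_ind=> [|x y t IH]; last by rewrite FD GD FG IH.
have F0 : F 0 = 0 by apply: (addIr (F 0)); rewrite -FD !add0r.
by rewrite F0; apply: (addIr (G 0)); rewrite -GD !add0r.
Qed.

Definition tensor_scale (a : S) : tensor -> tensor :=
  tlift (fun x y => tens (a *: x) y).

Lemma tensor_scale_balanced a : balanced (fun x y => tens (a *: x) y).
Proof.
split=> [x x' y|x y y'|b x y]; rewrite ?scalerDr ?tensDl ?tensDr //.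
by rewrite -tensZ !scalerA mulrC.
Qed.
Let tsb := tensor_scale_balanced.

Lemma tensor_scale_tens a x y : tensor_scale a (tens x y) = tens (a *: x) y.
Proof. exact: tlift_tens. Qed.
Lemma tensor_scaleDr : right_distributive tensor_scale +%R.
Proof. by move=> a t u; apply: tliftD. Qed.
Lemma tensor_scaleA a b t :
  tensor_scale a (tensor_scale b t) = tensor_scale (a * b) t.
Proof.
move: t; apply: tlift_ext => [t u|t u|x y]; rewrite ?tensor_scaleDr //.
by rewrite !tensor_scale_tens scalerA.
Qed.
Lemma tensor_scale1 : left_id 1 tensor_scale.
Proof.
apply: tlift_ext => [t u|t u|x y]; rewrite ?tensor_scaleDr //.
by rewrite !tensor_scale_tens scale1r.
Qed.
Lemma tensor_scaleDl t : {morph tensor_scale^~ t : a b / a + b}.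
Proof.
move=> a b /=; move: t; apply: tlift_ext => [t u|t u|x y].
- exact: tensor_scaleDr.
- by rewrite !tensor_scaleDr addrACA.
- by rewrite !tensor_scale_tens scalerDl tensDl.
Qed.

HB.instance Definition _ := GRing.Zmodule_isLmodule.Build S tensor
  tensor_scaleA tensor_scale1 tensor_scaleDr tensor_scaleDl.

End Tensor.

Definition tmap (S : comPzRingType) (M M' N N' : lmodType S)
    (u : {linear M -> M'}) (v : {linear N -> N'}) : tensor M N -> tensor M' N' :=
  tlift (fun x y => tens (u x) (v y)).

Definition flat (S : comPzRingType) (M : lmodType S) : Prop :=
  forall (N1 N2 N3 : lmodType S) (f : {linear N1 -> N2}) (g : {linear N2 -> N3}),
    exact_at f g ->
    exact_at (tmap f (idfun : {linear M -> M})) (tmap g (idfun : {linear M -> M})).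

Definition flat_hom (S R : comPzRingType) (h : {rmorphism S -> R}) : Prop :=
  flat (restr h R^o).

(* The action of R (x)_S K on M (x)_S N, for an R-module M and a K-module N;
   it is the multiplication of R (x)_S K when M = R and N = K. *)
Section TensorAlgebra.
Variables (S R K : comPzRingType) (f : {rmorphism S -> R}) (g : {rmorphism S -> K}).

Section Action.
Variables (M : lmodType R) (N : lmodType K).
Local Notation MN := (tensor (restr f M) (restr g N)).
Local Notation RK := (tensor (restr f R^o) (restr g K^o)).

Definition tact_pure (r : R) (c : K) : MN -> MN :=
  tlift (fun (x : restr f M) (y : restr g N) =>
    tens (r *: (x : M) : restr f M) (c *: (y : N) : restr g N)).

Definition tact (t : RK) (u : MN) : MN :=
  tlift (fun (r : restr f R^o) (c : restr g K^o) => tact_pure r c u) t.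

Lemma tact_pure_balanced r c :
  balanced (fun (x : restr f M) (y : restr g N) =>
    tens (r *: (x : M) : restr f M) (c *: (y : N) : restr g N)).
Proof.
split=> [x x' y|x y y'|a x y].
- by rewrite -tensDl; congr tens; exact: (scalerDr r (x : M) (x' : M)).
- by rewrite -tensDr; congr tens; exact: (scalerDr c (y : N) (y' : N)).
have -> : r *: ((a *: x : restr f M) : M) = (a *: (r *: (x : M) : restr f M)).
  by rewrite restr_scaleE scalerA mulrC -scalerA.
rewrite tensZ restr_scaleE; congr tens.
by rewrite restr_scaleE !scalerA mulrC.
Qed.

Lemma tact_pureD r c u v : tact_pure r c (u + v) = tact_pure r c u + tact_pure r c v.
Proof. exact/tliftD/tact_pure_balanced. Qed.

Lemma tact_pure_tens r c (x : M) (y : N) :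
  tact_pure r c (tens (x : restr f M) (y : restr g N)) =
  tens (r *: x : restr f M) (c *: y : restr g N).
Proof. exact: (tlift_tens _ _ (tact_pure_balanced r c)). Qed.

Lemma tact_balanced u :
  balanced (fun (r : restr f R^o) (c : restr g K^o) => tact_pure r c u).
Proof.
split=> [r r' c|r c c'|a r c]; move: u; apply: tlift_ext => [t u|t u|x y].
- exact: tact_pureD.
- by rewrite !tact_pureD addrACA.
- rewrite !tact_pure_tens -tensDl; congr tens.
  exact: (scalerDl (x : M) (r : R) (r' : R)).
- exact: tact_pureD.
- by rewrite !tact_pureD addrACA.
- rewrite !tact_pure_tens -tensDr; congr tens.
  exact: (scalerDl (y : N) (c : K) (c' : K)).
- exact: tact_pureD.
- exact: tact_pureD.
- rewrite !tact_pure_tens.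
  have -> : (a *: r : restr f R^o) *: (x : M) = (a *: (r *: (x : M) : restr f M)).
    by rewrite !restr_scaleE scalerA.
  by rewrite tensZ; congr tens; rewrite !restr_scaleE scalerA.
Qed.

Lemma tactDl t t' u : tact (t + t') u = tact t u + tact t' u.
Proof. exact/tliftD/tact_balanced. Qed.

Lemma tact_tensl (r : R) (c : K) u :
  tact (tens (r : restr f R^o) (c : restr g K^o)) u = tact_pure r c u.
Proof. exact: (tlift_tens _ _ (tact_balanced u)). Qed.

Lemma tactDr t u u' : tact t (u + u') = tact t u + tact t u'.
Proof.
move: t; apply: tlift_ext => [t t'|t t'|r c].
- exact: tactDl.
- by rewrite !tactDl addrACA.
- by rewrite !tact_tensl tact_pureD.
Qed.

Lemma tact_tens (r : R) (c : K) (x : M) (y : N) :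
  tact (tens (r : restr f R^o) (c : restr g K^o))
       (tens (x : restr f M) (y : restr g N)) =
  tens (r *: x : restr f M) (c *: y : restr g N).
Proof. by rewrite tact_tensl tact_pure_tens. Qed.

Lemma tact1 u : tact (tens (1 : restr f R^o) (1 : restr g K^o)) u = u.
Proof.
move: u; apply: tlift_ext => [t t'|t t'|r c]; rewrite ?tactDr //.
by rewrite tact_tens !scale1r.
Qed.

End Action.

Lemma tactA (M : lmodType R) (N : lmodType K) t t' (u : tensor (restr f M) (restr g N)) :
  tact t (tact t' u) = tact (tact (M := R^o) (N := K^o) t t') u.
Proof.
move: t; apply: tlift_ext => [t1 t2|t1 t2|r c]; rewrite ?tactDl //.
move: t'; apply: tlift_ext => [t1 t2|t1 t2|r' c']; rewrite ?(tactDl, tactDr) //.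
move: u; apply: tlift_ext => [t1 t2|t1 t2|x y]; rewrite ?tactDr //.
by rewrite !tact_tens !scalerA.
Qed.

Definition talg : Type := tensor (restr f R^o) (restr g K^o).
HB.instance Definition _ := GRing.Zmodule.on talg.

Definition talg_mul : talg -> talg -> talg := tact (M := R^o) (N := K^o).
Definition talg1 : talg := tens (1 : restr f R^o) (1 : restr g K^o).

Lemma talg_mulA : associative talg_mul.
Proof. by move=> t u v; rewrite /talg_mul tactA. Qed.
Lemma talg_mulC : commutative talg_mul.
Proof.
move=> t u; rewrite /talg_mul; move: t.
apply: tlift_ext => [t1 t2|t1 t2|r c]; rewrite ?(tactDl, tactDr) //.
move: u; apply: tlift_ext => [t1 t2|t1 t2|r' c']; rewrite ?(tactDl, tactDr) //.
by rewrite !tact_tens; congr tens; apply: mulrC.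
Qed.
Lemma talg_mul1 : left_id talg1 talg_mul.
Proof. exact: tact1. Qed.
Lemma talg_mulDl : left_distributive talg_mul +%R.
Proof. by move=> t u v; apply: tactDl. Qed.

HB.instance Definition _ := GRing.Zmodule_isComPzRing.Build talg
  talg_mulA talg_mulC talg_mul1 talg_mulDl.

Definition tmod (M : lmodType R) (N : lmodType K) : Type :=
  tensor (restr f M) (restr g N).
HB.instance Definition _ M N := GRing.Zmodule.on (tmod M N).
HB.instance Definition _ M N := GRing.Zmodule_isLmodule.Build talg (tmod M N)
  (@tactA M N) (@tact1 M N) (@tactDr M N) (fun u t t' => @tactDl M N t t' u).

Variables (B : comPzRingType) (u : {rmorphism R -> B}) (v : {rmorphism K -> B}).
Hypothesis uv : forall s, u (f s) = v (g s).

Definition talg_lift_fun (r : restr f R^o) (c : restr g K^o) : B := u r * v c.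
Definition talg_lift & (forall s, u (f s) = v (g s)) : talg -> B :=
  tlift talg_lift_fun.

Lemma talg_lift_balanced : balanced talg_lift_fun.
Proof.
rewrite /talg_lift_fun; split=> [r r' c|r c c'|a r c].
- by rewrite -mulrDl -rmorphD.
- by rewrite -mulrDr -rmorphD.
have -> : u (a *: r) = u (f a) * u r by exact: (rmorphM u (f a) r).
have -> : v (a *: c) = v (g a) * v c by exact: (rmorphM v (g a) c).
by rewrite uv mulrCA mulrA.
Qed.

Lemma talg_liftE (r : R) (c : K) :
  talg_lift uv (tens (r : restr f R^o) (c : restr g K^o)) = u r * v c.
Proof. exact: (tlift_tens _ _ talg_lift_balanced). Qed.

Lemma talg_liftD (t t' : talg) : talg_lift uv (t + t') = talg_lift uv t + talg_lift uv t'.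
Proof. exact/tliftD/talg_lift_balanced. Qed.

Lemma talg_lift_zmod : zmod_morphism (talg_lift uv).
Proof.
move=> t t'; apply: (addIr (talg_lift uv t')).
by rewrite -talg_liftD !subrK.
Qed.
Lemma talg_lift_monoid : monoid_morphism (talg_lift uv).
Proof.
split=> [|t t']; first by rewrite talg_liftE !rmorph1 mulr1.
move: t; apply: tlift_ext => [t1 t2|t1 t2|r c].
- by rewrite mulrDl talg_liftD.
- by rewrite talg_liftD mulrDl.
move: t'; apply: tlift_ext => [t1 t2|t1 t2|r' c'].
- by rewrite mulrDr talg_liftD.
- by rewrite talg_liftD mulrDr.
rewrite [X in talg_lift uv X]tact_tens !talg_liftE.
have -> : u (r *: r') = u r * u r' by exact: (rmorphM u r r').
have -> : v (c *: c') = v c * v c' by exact: (rmorphM v c c').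
by rewrite mulrACA.
Qed.
HB.instance Definition _ :=
  GRing.isZmodMorphism.Build talg B (talg_lift uv) talg_lift_zmod.
HB.instance Definition _ :=
  GRing.isMonoidMorphism.Build talg B (talg_lift uv) talg_lift_monoid.

End TensorAlgebra.

Section BaseChange.
Variables (A K : comPzRingType) (g : {rmorphism A -> K}) (M : lmodType A).

Definition base_change : Type := tensor M (restr g K^o).
HB.instance Definition _ := GRing.Zmodule.on base_change.

Definition bc_fun (a : K) (x : M) (c : restr g K^o) : base_change :=
  tens x (a * c : restr g K^o).
Definition bc_scale (a : K) : base_change -> base_change := tlift (bc_fun a).

Lemma bc_balanced a : balanced (bc_fun a).
Proof.
rewrite /bc_fun; split=> [x x' c|x c c'|b x c].
- by rewrite -tensDl.
- by rewrite -tensDr -[in RHS]mulrDr.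
by rewrite tensZ; congr tens; apply: mulrCA.
Qed.

Lemma bc_scale_tens a x (c : K) :
  bc_scale a (tens x (c : restr g K^o)) = tens x (a * c : restr g K^o).
Proof. exact: (tlift_tens _ _ (bc_balanced a)). Qed.
Lemma bc_scaleDr : right_distributive bc_scale +%R.
Proof. by move=> a t u; apply/tliftD/bc_balanced. Qed.
Lemma bc_scaleA a b t : bc_scale a (bc_scale b t) = bc_scale (a * b) t.
Proof.
move: t; apply: tlift_ext => [t u|t u|x y]; rewrite ?bc_scaleDr //.
by rewrite !bc_scale_tens mulrA.
Qed.
Lemma bc_scale1 : left_id 1 bc_scale.
Proof.
apply: tlift_ext => [t u|t u|x y]; rewrite ?bc_scaleDr //.
by rewrite !bc_scale_tens mul1r.
Qed.
Lemma bc_scaleDl t : {morph bc_scale^~ t : a b / a + b}.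
Proof.
move=> a b /=; move: t; apply: tlift_ext => [t u|t u|x y].
- exact: bc_scaleDr.
- by rewrite !bc_scaleDr addrACA.
- by rewrite !bc_scale_tens mulrDl -tensDr.
Qed.
HB.instance Definition _ := GRing.Zmodule_isLmodule.Build K base_change
  bc_scaleA bc_scale1 bc_scaleDr bc_scaleDl.

End BaseChange.

Definition tpairing (A : comPzRingType) (M : lmodType A) :
    tensor M (dual M) -> A :=
  tlift (fun (u : M) (rho : dual M) => (rho : {linear M -> A^o}) u).

Section Localization.
Variables (R : comPzRingType) (W : mulrClosed R).

Definition denom : Type := {s : R | s \in W}.
HB.instance Definition _ := Choice.on denom.

Definition denom1 : denom := exist _ 1 (rpred1 W).
Definition denomM (s t : denom) : denom :=
  exist _ (sval s * sval t) (rpredM (svalP s) (svalP t)).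

Definition loc_eq (p q : R * denom) : Prop :=
  exists2 w, w \in W & w * (p.1 * sval q.2) = w * (q.1 * sval p.2).

Lemma loc_eq_refl p : loc_eq p p.
Proof. by exists 1; rewrite ?rpred1. Qed.
Lemma loc_eq_sym p q : loc_eq p q -> loc_eq q p.
Proof. by case=> w wW h; exists w. Qed.
Lemma loc_eq_trans p q r : loc_eq p q -> loc_eq q r -> loc_eq p r.
Proof.
case: p q r => [a [s sW]] [b [t tW]] [c [v vW]] [w wW /= h] [w' w'W /= h'].
exists (w * w' * t); first by rewrite !rpredM.
rewrite /=.
have -> : w * w' * t * (a * v) = (w * (a * t)) * (w' * v) by ring.
rewrite h; have -> : w * (b * s) * (w' * v) = (w' * (b * v)) * (w * s) by ring.
by rewrite h'; ring.
Qed.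

Definition loc_rel (p q : R * denom) : bool := `[< loc_eq p q >].
Canonical loc_equiv_rel := EquivRelPack
  (asbool_equiv loc_eq_refl loc_eq_sym loc_eq_trans : equiv_class_of loc_rel).
Canonical loc_encModRel := defaultEncModRel loc_rel.

Definition loc : Type := {eq_quot loc_rel}.
HB.instance Definition _ : EqQuotient _ loc_rel loc := EqQuotient.on loc.
HB.instance Definition _ := Choice.on loc.

Definition frac (a : R) (s : denom) : loc := \pi_loc (a, s).

Lemma fracP a s b t : frac a s = frac b t <-> loc_eq (a, s) (b, t).
Proof.
by split=> [/(eqquotP loc)/asboolP|e]; last exact/(eqquotP loc)/asboolP.
Qed.

Lemma frac_ind (P : loc -> Prop) : (forall a s, P (frac a s)) -> forall x, P x.
Proof. by move=> h x; rewrite -[x]reprK; case: (repr x). Qed.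

Lemma frac_repr a s : loc_eq (repr (frac a s)) (a, s).
Proof.
by case: (repr _) (reprK (frac a s)) => b t e; apply/fracP; rewrite -e.
Qed.

Definition loc_add (x y : loc) : loc := let p := repr x in let q := repr y in
  frac (p.1 * sval q.2 + q.1 * sval p.2) (denomM p.2 q.2).
Definition loc_opp (x : loc) : loc := frac (- (repr x).1) (repr x).2.
Definition loc_mul (x y : loc) : loc := let p := repr x in let q := repr y in
  frac (p.1 * q.1) (denomM p.2 q.2).

Lemma loc_addE a s b t :
  loc_add (frac a s) (frac b t) = frac (a * sval t + b * sval s) (denomM s t).
Proof.
rewrite /loc_add; case: (repr _) (frac_repr a s) => a' s' [w wW /= h].
case: (repr _) (frac_repr b t) => b' t' [w' w'W /= h'].
apply/fracP; exists (w * w'); rewrite ?rpredM //=.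
have -> : w * w' * ((a' * sval t' + b' * sval s') * (sval s * sval t)) =
  (w * (a' * sval s)) * (w' * sval t * sval t') +
  (w' * (b' * sval t)) * (w * sval s * sval s') by ring.
by rewrite h h'; ring.
Qed.

Lemma loc_mulE a s b t :
  loc_mul (frac a s) (frac b t) = frac (a * b) (denomM s t).
Proof.
rewrite /loc_mul; case: (repr _) (frac_repr a s) => a' s' [w wW /= h].
case: (repr _) (frac_repr b t) => b' t' [w' w'W /= h'].
apply/fracP; exists (w * w'); rewrite ?rpredM //=.
have -> : w * w' * (a' * b' * (sval s * sval t)) =
  (w * (a' * sval s)) * (w' * (b' * sval t)) by ring.
by rewrite h h'; ring.
Qed.

Lemma loc_oppE a s : loc_opp (frac a s) = frac (- a) s.
Proof.
rewrite /loc_opp; case: (repr _) (frac_repr a s) => a' s' [w wW /= h].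
apply/fracP; exists w => //=.
have -> : w * (- a' * sval s) = - (w * (a' * sval s)) by ring.
by rewrite h; ring.
Qed.

Lemma frac_eq a s b t : a * sval t = b * sval s -> frac a s = frac b t.
Proof. by move=> e; apply/fracP; exists 1; rewrite ?rpred1 //= e. Qed.

Lemma loc_addA : associative loc_add.
Proof.
elim/frac_ind=> a s; elim/frac_ind=> b t; elim/frac_ind=> c v.
by rewrite !loc_addE; apply: frac_eq => /=; ring.
Qed.
Lemma loc_addC : commutative loc_add.
Proof.
elim/frac_ind=> a s; elim/frac_ind=> b t.
by rewrite !loc_addE; apply: frac_eq => /=; ring.
Qed.
Lemma loc_add0 : left_id (frac 0 denom1) loc_add.
Proof.
by elim/frac_ind=> a s; rewrite loc_addE; apply: frac_eq => /=; ring.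
Qed.
Lemma loc_addN : left_inverse (frac 0 denom1) loc_opp loc_add.
Proof.
by elim/frac_ind=> a s; rewrite loc_oppE loc_addE; apply: frac_eq => /=; ring.
Qed.
HB.instance Definition _ := GRing.isZmodule.Build loc
  loc_addA loc_addC loc_add0 loc_addN.

Lemma loc_mulA : associative loc_mul.
Proof.
elim/frac_ind=> a s; elim/frac_ind=> b t; elim/frac_ind=> c v.
by rewrite !loc_mulE; apply: frac_eq => /=; ring.
Qed.
Lemma loc_mulC : commutative loc_mul.
Proof.
elim/frac_ind=> a s; elim/frac_ind=> b t.
by rewrite !loc_mulE; apply: frac_eq => /=; ring.
Qed.
Lemma loc_mul1 : left_id (frac 1 denom1) loc_mul.
Proof.
by elim/frac_ind=> a s; rewrite loc_mulE; apply: frac_eq => /=; ring.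
Qed.
Lemma loc_mulDl : left_distributive loc_mul +%R.
Proof.
elim/frac_ind=> a s; elim/frac_ind=> b t; elim/frac_ind=> c v.
rewrite [frac a s + _]loc_addE !loc_mulE [RHS]loc_addE.
by apply: frac_eq => /=; ring.
Qed.
HB.instance Definition _ := GRing.Zmodule_isComPzRing.Build loc
  loc_mulA loc_mulC loc_mul1 loc_mulDl.

Definition loc_map (a : R) : loc := frac a denom1.

Lemma loc_map_zmod : zmod_morphism loc_map.
Proof.
move=> a b; rewrite [RHS](_ : _ = loc_add (frac a denom1) (loc_opp (frac b denom1))) //.
by rewrite loc_oppE loc_addE; apply: frac_eq => /=; ring.
Qed.
Lemma loc_map_monoid : monoid_morphism loc_map.
Proof.
split=> // a b; rewrite [RHS]loc_mulE.
by apply: frac_eq => /=; ring.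
Qed.
HB.instance Definition _ := GRing.isZmodMorphism.Build R loc loc_map loc_map_zmod.
HB.instance Definition _ := GRing.isMonoidMorphism.Build R loc loc_map loc_map_monoid.

End Localization.

Section TotalQuotientRing.
Variable R : comPzRingType.

Definition nonzerodiv : {pred R} := fun x => `[< forall y, x * y = 0 -> y = 0 >].

Lemma nonzerodiv_mulr_closed : mulr_closed nonzerodiv.
Proof.
split; first by apply/asboolP => y; rewrite mul1r.
move=> x y /asboolP xr /asboolP yr; apply/asboolP => z.
by rewrite -mulrA => /xr /yr.
Qed.
HB.instance Definition _ :=
  GRing.isMulClosed.Build R nonzerodiv nonzerodiv_mulr_closed.

Definition total_quotient : comPzRingType := loc nonzerodiv.
Definition to_total_quotient : {rmorphism R -> total_quotient} := loc_map nonzerodiv.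

Definition multipliers (I : ideal R) : {pred restr to_total_quotient total_quotient^o} :=
  fun x => `[< forall i, i \in I ->
    exists r, (x : total_quotient) * to_total_quotient i = to_total_quotient r >].

Lemma multipliers_submod I : submod_closed (multipliers I).
Proof.
split.
  by apply/asboolP => i _; exists 0; rewrite rmorph0; apply: mul0r.
move=> a x y /asboolP xI /asboolP yI; apply/asboolP => i iI.
have [[r xr] [r' yr]] := (xI i iI, yI i iI); exists (a * r + r').
rewrite rmorphD rmorphM -xr -yr mulrA.
exact: (mulrDl (to_total_quotient a * (x : total_quotient)) y (to_total_quotient i)).
Qed.
HB.instance Definition _ I :=
  GRing.isSubmodClosed.Build R _ (multipliers I) (multipliers_submod I).

End TotalQuotientRing.

Definition prime_ideal (R : comPzRingType) (p : ideal R) : Prop :=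
  1 \notin p /\ forall x y : R, x * y \in p -> x \in p \/ y \in p.

Definition maximal_ideal (R : comPzRingType) (m : ideal R) : Prop :=
  1 \notin m /\
  forall J : ideal R, 1 \notin J -> {subset m <= J} -> {subset J <= m}.

Section ResidueField.
Variables (R : comPzRingType) (p : ideal R).

Definition prime_compl & prime_ideal p : {pred R} := fun x => x \notin p.

Variable pP : prime_ideal p.

Lemma prime_compl_mulr_closed : mulr_closed (prime_compl pP).
Proof.
split; first by case: pP.
move=> x y xp yp; apply/negP => /(proj2 pP)[]; exact/negP.
Qed.
HB.instance Definition _ :=
  GRing.isMulClosed.Build R (prime_compl pP) prime_compl_mulr_closed.

Definition loc_at : comPzRingType := loc (prime_compl pP).

(* k(p) = R_p / p R_p *)
Definition loc_at_max : {pred loc_at^o} :=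
  span (fun y : loc_at^o => `[< exists2 x, x \in p & loc_map (prime_compl pP) x = y >]).
Definition residue_field : comPzRingType := qring loc_at_max.
Definition to_residue_field : {rmorphism R -> residue_field} :=
  qring_pi loc_at_max \o loc_map (prime_compl pP).

End ResidueField.

Definition local_ring (R : comPzRingType) (m : ideal R) : Prop :=
  maximal_ideal m /\ forall m' : ideal R, maximal_ideal m' -> m' =i m.

Definition noetherian (R : comPzRingType) : Prop :=
  forall I : ideal R, exists s : seq R^o, I =i span (mem s).

Definition prime_chain (R : comPzRingType) (n : nat) (p : nat -> ideal R) : Prop :=
  (forall i, (i <= n)%N -> prime_ideal (p i)) /\
  forall i, (i < n)%N -> {subset p i <= p i.+1} /\ ~ {subset p i.+1 <= p i}.

Definition krull_dim (R : comPzRingType) (n : nat) : Prop :=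
  (exists p : nat -> ideal R, prime_chain n p) /\
  forall m (p : nat -> ideal R), prime_chain m p -> (m <= n)%N.

Definition finite_injective_dim (R : comPzRingType) (M : lmodType R) : Prop :=
  exists (E : nat -> lmodType R) (e : {linear M -> E 0%N})
         (d : forall n, {linear E n -> E n.+1}),
    [/\ forall n, injective_module (E n), injective e, exact_at e (d 0%N),
        forall n, exact_at (d n) (d n.+1)
      & exists N, forall n, (N < n)%N -> forall x : E n, x = 0].

Definition gorenstein_local (R : comPzRingType) (m : ideal R) : Prop :=
  [/\ local_ring m, noetherian R & finite_injective_dim R^o].

Definition regular_local (R : comPzRingType) (m : ideal R) : Prop :=
  [/\ local_ring m, noetherian R
    & exists d (b : d.-tuple R^o), krull_dim R d /\ m =i span (mem b)].

(* The points of Spec S that are images of closed points of Spec R are the primes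
   h^-1(m) for m a maximal ideal of R. *)
Definition stably_reflexive_wrt (S R : comPzRingType) (h : {rmorphism S -> R})
    (M : lmodType R) : Prop :=
  flat (restr h M) /\
  forall (p : ideal S) (pP : prime_ideal p),
    (exists2 m : ideal R, maximal_ideal m & forall x : S, (x \in p) = (h x \in m)) ->
    @stably_reflexive (talg h (to_residue_field pP))
      (tmod h (to_residue_field pP) M (residue_field pP)^o).

Section Kernel.
Variables (R S : comPzRingType) (f : {rmorphism R -> S}).

Definition kernel : {pred R^o} := fun x => f x == 0.

Lemma kernel_submod : submod_closed kernel.
Proof.
split; first exact/eqP/(rmorph0 f).
move=> a x y /eqP fx /eqP fy; apply/eqP.
have -> : f (a *: x + y) = f (a * x) + f y by exact: (rmorphD f).
by rewrite rmorphM fx fy mulr0 addr0.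
Qed.
HB.instance Definition _ := GRing.isSubmodClosed.Build R R^o kernel kernel_submod.

End Kernel.

Section InclusionDual.
Variables (R : comPzRingType) (I : ideal R).

Definition mul_on_fun (r : R^o) (x : submod I) : R^o := r * submod_val x.
Lemma mul_on_fun_linear r : linear (mul_on_fun r).
Proof.
move=> a x y; rewrite /mul_on_fun.
have -> : submod_val (a *: x + y) = a * submod_val x + submod_val y by [].
by rewrite mulrDr mulrCA.
Qed.
HB.instance Definition _ r :=
  GRing.isLinear.Build R (submod I) R^o _ (mul_on_fun r) (mul_on_fun_linear r).

Definition mul_on (r : R^o) : dual (submod I) := mul_on_fun r.
Lemma mul_on_linear : linear mul_on.
Proof.
move=> a r r'; apply: Hom_ext => x /=.
rewrite [LHS]mulrDl; congr (_ + _); exact: (esym (mulrA a r (submod_val x))).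
Qed.
HB.instance Definition _ :=
  GRing.isLinear.Build R R^o (dual (submod I)) _ mul_on mul_on_linear.

End InclusionDual.

Section CentralFibre.
Variables (S R : comPzRingType) (h : {rmorphism S -> R}) (mS : ideal S).

Definition central_fibre : comPzRingType := talg h (qring_pi mS).

Variable (pi : {rmorphism R -> S}) (hK : cancel h pi).

Lemma augmentation_compat s : (qring_pi mS \o pi) (h s) = idfun (qring_pi mS s).
Proof. by rewrite /= hK. Qed.

(* A -> k, r (x) c |-> (class of pi r) * c *)
Definition augmentation : {rmorphism central_fibre -> qring mS} :=
  talg_lift augmentation_compat.

End CentralFibre.

(* Main.v *)
(* On the central fibre A, a finite injective resolution and descending induction show
   that Ext^n(V, A) = 0 for n > 1 and V finitely generated: the induction step reduces
   by devissage to V = k, which embeds in A/xA for an A-regular element x of m_A, since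
   dim A = 1. Hence Ext^n(V, A) = 0 for n > 0 whenever V is finitely generated and
   x-torsionfree, as are m_A and its dual. It also follows that A/xA is self-injective, so
   that (xA : m_A) = zA + xA for a single z not in xA. As m_A^* = (xA : m_A)/x, it is
   generated by the inclusion and by multiplication by z/x, from which (iv) and the
   reflexivity of m_A follow.

   For (ii) and (iii), lift x to an element of I. Devissage over S shows that x is regular
   on R (x) N for all finitely generated S-modules N, so that N |-> (R/x) (x) N is exact,
   then that z lifts to an element of R/x killed by I, and finally that
   n |-> z (x) n maps N onto the annihilator of I in (R/x) (x) N. For N = S this
   annihilator is (xR : I)/xR = I^*/R, and flatness makes the map from S injective. For
   (i), I is a direct summand of R over S, and I (x) k(s) is the maximal ideal of a ring
   isomorphic to A. *)

From HB Require Import structures.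
From mathcomp Require Import all_boot all_algebra.
From mathcomp Require Import boolp ring.
Require Import Defs.

Set Implicit Arguments.
Unset Strict Implicit.
Unset Printing Implicit Defensive.

Import GRing.Theory.
Local Open Scope ring_scope.

(** * Linear maps and finitely generated modules *)

(** The only input on A is a finite injective resolution, so even the regular element x has to be
    extracted from it: if mA had a nonzero annihilator, k would embed in A and every positive Ext
    into A would vanish, which a strict inclusion of primes excludes. Long exact sequences only
    propagate vanishing; passing from Ext^(n+1)(V/xV, A) = 0 to Ext^n(V, A) = 0 is Nakayama's lemma,
    and this forces the finite generation of Ext.

    Over S an assertion about N = S alone does not support induction, as S need not contain a
    regular element. Each assertion is therefore made for all finitely generated N, so that one may
    divide by any y that is injective on N. The modules (R/x) (x) N are finitely generated over R
    rather than over S, hence Nakayama's lemma is applied to them with h(y).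

    Choosing x inside I has two effects: an element of I^* is determined by its value at x, and
    I^*/R becomes the annihilator of I in R/xR, on which R acts through R -> S. *)

Definition surj (A B : Type) (f : A -> B) : Prop := forall y, exists x, f x = y.

Definition ses (A B C : nmodType) (f : A -> B) (g : B -> C) : Prop :=
  [/\ injective f, exact_at f g & surj g].

Lemma inj_surj_bij (A B : Type) (f : A -> B) : injective f -> surj f -> bijective f.
Proof.
move=> fI fS; have [g gP] := choice fS.
by exists g => // x; apply: fI; rewrite gP.
Qed.

Section LinearMaps.
Variables (A : comPzRingType).
Implicit Types (U V W : lmodType A).

Definition Lin U V (f : U -> V) (fl : linear f) : {linear U -> V} :=
  HB.pack f (GRing.isLinear.Build A U V _ f fl).

Lemma lin_inj U V (f : {linear U -> V}) :
  (forall x, f x = 0 -> x = 0) -> injective f.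
Proof.
move=> h x y e; apply/eqP; rewrite -subr_eq0; apply/eqP/h.
by rewrite linearB e subrr.
Qed.

Lemma linZ U V (f : {linear U -> V}) a x : f (a *: x) = a *: f x.
Proof. exact: linearZ. Qed.

Lemma linD U V (f : {linear U -> V}) x y : f (x + y) = f x + f y.
Proof. exact: linearD. Qed.

Lemma linB U V (f : {linear U -> V}) x y : f (x - y) = f x - f y.
Proof. exact: linearB. Qed.

Lemma inj0 U V (f : {linear U -> V}) x : injective f -> f x = 0 -> x = 0.
Proof. by move=> fI e; apply: fI; rewrite e linear0. Qed.

Lemma exact0 (X : Type) V W (f : X -> V) (g : {linear V -> W}) x :
  exact_at f g -> g (f x) = 0.
Proof. by move=> fg; apply/fg; exists x. Qed.

(** Maps without a formula are built as total linear relations; since differences of related pairs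
    are related, single-valuedness need only be checked at 0. *)
Lemma lin_rel U V (Q : U -> V -> Prop) :
  (forall x, exists y, Q x y) ->
  (forall a x x' y y', Q x y -> Q x' y' -> Q (a *: x + x') (a *: y + y')) ->
  (forall y, Q 0 y -> y = 0) ->
  exists f : {linear U -> V}, forall x, Q x (f x).
Proof.
move=> Qe Ql Q0; have [f fP] := choice Qe.
have Qu x y y' : Q x y -> Q x y' -> y = y'.
  move=> q q'; apply/eqP; rewrite eq_sym -subr_eq0; apply/eqP/Q0.
  have := Ql (-1) _ _ _ _ q q'.
  by rewrite !scaleN1r addNr addrC.
have fl : linear f by move=> a x y; apply: Qu (fP _) (Ql _ _ _ _ _ (fP _) (fP _)).
by exists (Lin fl).
Qed.

Lemma lin_factor_surj U V W (p : {linear U -> V}) (f : {linear U -> W}) :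
  surj p -> (forall x, p x = 0 -> f x = 0) ->
  exists g : {linear V -> W}, forall x, g (p x) = f x.
Proof.
move=> pS pf.
have [|a x x' y y' [u <- <-] [u' <- <-]|y [u pu <-]|g gP] :=
    @lin_rel V W (fun v w => exists2 u, p u = v & f u = w).
- by move=> v; have [u <-] := pS v; exists (f u), u.
- by exists (a *: u + u'); rewrite linearP.
- exact: pf.
exists g => x; have [u /eqP] := gP (p x).
rewrite -subr_eq0 -linearB => /eqP /pf; rewrite linearB => /eqP.
by rewrite subr_eq0 => /eqP ->.
Qed.

Lemma lin_factor_inj U V W (i : {linear V -> W}) (f : {linear U -> W}) :
  injective i -> (forall x, exists y, i y = f x) ->
  exists g : {linear U -> V}, forall x, i (g x) = f x.
Proof.
move=> iI iS.
have [//|a x x' y y' e e'|y|g gP] := @lin_rel U V (fun u v => i v = f u).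
- by rewrite !linearP e e'.
- by rewrite linear0 -[RHS](linear0 i) => /iI.
by exists g.
Qed.

Definition lker U V (f : {linear U -> V}) : {pred U} := fun x => f x == 0.

Lemma lker_submod U V (f : {linear U -> V}) : submod_closed (lker f).
Proof.
split; first by apply/eqP; rewrite linear0.
by move=> a x y /eqP fx /eqP fy; apply/eqP; rewrite linearP fx fy scaler0 addr0.
Qed.
HB.instance Definition _ U V (f : {linear U -> V}) :=
  GRing.isSubmodClosed.Build A U (lker f) (lker_submod f).

Lemma lkerP U V (f : {linear U -> V}) x : reflect (f x = 0) (x \in lker f).
Proof. exact: eqP. Qed.

Lemma limageP U V (f : {linear U -> V}) y :
  reflect (exists x, f x = y) (y \in limage f).
Proof. exact: asboolP. Qed.

Lemma submod_val_linear V (N : submodClosed V) : linear (@submod_val A V N).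
Proof. by []. Qed.
Definition sincl V (N : submodClosed V) : {linear submod N -> V} :=
  Lin (@submod_val_linear V N).

Arguments sincl : simpl never.

Lemma sincl_inj V (N : submodClosed V) : injective (sincl N).
Proof. exact: val_inj. Qed.

Lemma sincl_in V (N : submodClosed V) (x : submod N) : sincl N x \in N.
Proof. by case: x. Qed.

Lemma sinclP V (N : submodClosed V) x : (exists y, sincl N y = x) <-> x \in N.
Proof.
split=> [[y <-]|xN]; first exact: sincl_in.
by exists (Submod xN).
Qed.

Lemma qmod_pi0 V (N : submodClosed V) x : (qmod_pi N x = 0) <-> (x \in N).
Proof.
split=> [e|xN]; last first.
  by rewrite -[0](linear0 (qmod_pi N)); apply/qmod_piP; rewrite subr0.
by rewrite -[x]subr0; apply/qmod_piP; rewrite e linear0.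
Qed.

Lemma qmod_pi_surj V (N : submodClosed V) : surj (qmod_pi N).
Proof. by elim/qmod_ind=> x; exists x. Qed.

Lemma ses_qmod V (N : submodClosed V) : ses (sincl N) (qmod_pi N).
Proof.
split; [exact: sincl_inj| |exact: qmod_pi_surj].
by move=> x; split=> [/qmod_pi0 /sinclP|/sinclP /qmod_pi0].
Qed.

Lemma ses_limage U V (f : {linear U -> V}) : injective f -> ses f (qmod_pi (limage f)).
Proof.
move=> fI; split=> //; last exact: qmod_pi_surj.
by move=> x; split=> [/qmod_pi0 /limageP|/limageP /qmod_pi0].
Qed.

Lemma qmod_lift V W (N : submodClosed V) (f : {linear V -> W}) :
  (forall x, x \in N -> f x = 0) ->
  exists g : {linear qmod N -> W}, forall x, g (qmod_pi N x) = f x.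
Proof.
move=> h; apply: (@lin_factor_surj _ _ _ (qmod_pi N)); first exact: qmod_pi_surj.
by move=> x /qmod_pi0; apply: h.
Qed.

Lemma scaleC V (a b : A) (v : V) : a *: (b *: v) = b *: (a *: v).
Proof. by rewrite !scalerA mulrC. Qed.

Lemma scalel_linear V (a : A) : linear (fun x : V => a *: x).
Proof. by move=> b x y; rewrite scalerDr !scalerA mulrC. Qed.
Definition scalel V (a : A) : {linear V -> V} := Lin (@scalel_linear V a).

Lemma mulvec_linear V (v : V) : linear (fun a : A^o => a *: v).
Proof. by move=> b x y; rewrite scalerDl scalerA. Qed.
Definition mulvec V (v : V) : {linear A^o -> V} := Lin (mulvec_linear v).

Lemma rvmap_linear n V (v : 'I_n -> V) :
  linear (fun u : 'rV[A]_n => \sum_i u 0 i *: v i).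
Proof.
move=> a x y; rewrite scaler_sumr -big_split; apply: eq_bigr => i _ /=.
by rewrite !mxE scalerDl scalerA.
Qed.
Definition rvmap n V (v : 'I_n -> V) : {linear 'rV[A]_n -> V} := Lin (rvmap_linear v).

Lemma rvmap_delta n V (v : 'I_n -> V) i : rvmap v (delta_mx 0 i) = v i.
Proof.
rewrite /= (bigD1 i) //= mxE !eqxx scale1r big1 ?addr0 // => j ji.
by rewrite mxE (negPf ji) andbF scale0r.
Qed.

Lemma rvmap_ext n V (f g : {linear 'rV[A]_n -> V}) :
  (forall i, f (delta_mx 0 i) = g (delta_mx 0 i)) -> f =1 g.
Proof.
move=> fg u; rewrite [u]row_sum_delta !linear_sum; apply: eq_bigr => i _.
by rewrite !linearZ /= fg.
Qed.

Lemma rv_lift n V W (p : {linear V -> W}) (f : {linear 'rV[A]_n -> W}) :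
  surj p -> exists g : {linear 'rV[A]_n -> V}, forall x, p (g x) = f x.
Proof.
move=> pS; have [v vP] := choice (fun i => pS (f (delta_mx 0 i))).
exists (rvmap v); apply: (@rvmap_ext _ _ (p \o rvmap v) f) => i.
by rewrite [LHS](congr1 p (rvmap_delta v i)) vP.
Qed.

Lemma projective_rv n : projective 'rV[A]_n.
Proof. by move=> M N p f pS; apply: rv_lift. Qed.

Definition fg V := exists n (p : {linear 'rV[A]_n -> V}), surj p.

Lemma fg_surj V W (f : {linear V -> W}) : surj f -> fg V -> fg W.
Proof.
move=> fS [n [p pS]]; exists n, (f \o p) => y.
by have [x <-] := fS y; have [u <-] := pS x; exists u.
Qed.

Lemma fg_regular : fg A^o.
Proof.
exists 1%N, (rvmap (fun _ => 1 : A^o)) => y; exists (\row_i y) => /=.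
by rewrite big_ord1 mxE; apply: mulr1.
Qed.

Lemma fg_qmod V (N : submodClosed V) : fg V -> fg (qmod N).
Proof. by apply: (@fg_surj _ _ (qmod_pi N)); apply: qmod_pi_surj. Qed.

Lemma fg_ext U V W (f : {linear U -> V}) (g : {linear V -> W}) :
  exact_at f g -> surj g -> fg U -> fg W -> fg V.
Proof.
move=> fgE gS [n [p pS]] [k [q qS]].
have [r rP] := rv_lift q gS.
pose F (u : 'rV[A]_(n + k)) := f (p (lsubmx u)) + r (rsubmx u).
have Fl : linear F.
  by move=> a x y; rewrite /F !linearP /= scalerDr addrACA.
exists (n + k)%N, (Lin Fl) => v.
have [w wP] := qS (g v).
have /fgE [u uP] : g (v - r w) = 0 by rewrite linearB /= rP wP subrr.
have [u' u'P] := pS u.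
exists (row_mx u' w); rewrite /= /F row_mxKl row_mxKr u'P uP.
by rewrite subrK.
Qed.

Lemma fg_rv n : fg 'rV[A]_n.
Proof. by exists n, idfun => y; exists y. Qed.

End LinearMaps.

(** * Finite generation over noetherian rings *)

Section Noetherian.
Variable A : comPzRingType.

Lemma spanP (V : lmodType A) (X : {pred V}) x :
  reflect (exists2 s : seq (A * V), all (fun c => c.2 \in X) s
             & x = \sum_(c <- s) c.1 *: c.2) (x \in span X).
Proof. exact: asboolP. Qed.

Lemma sub_span (V : lmodType A) (X : {pred V}) : {subset X <= span X}.
Proof.
by move=> x xX; apply/spanP; exists [:: (1, x)]; rewrite /= ?xX // big_seq1 scale1r.
Qed.

Lemma span_min (V : lmodType A) (X : {pred V}) (N : submodClosed V) :
  {subset X <= N} -> {subset span X <= N}.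
Proof.
move=> XN x /spanP[s /allP sX ->].
by rewrite big_seq; apply: rpred_sum => c /sX /XN; apply: rpredZ.
Qed.

Lemma idealD (I : ideal A) (x y : A) : x \in I -> y \in I -> x + y \in I.
Proof. exact: rpredD. Qed.

Lemma idealMl (I : ideal A) (a x : A) : x \in I -> a * x \in I.
Proof. exact: (rpredZ a). Qed.

Lemma idealMr (I : ideal A) (a x : A) : x \in I -> x * a \in I.
Proof. by rewrite mulrC; apply: idealMl. Qed.

Lemma fg_span (V : lmodType A) (s : seq V) : fg (submod (span (mem s))).
Proof.
pose v (i : 'I_(size s)) : submod (span (mem s)) :=
  Submod (sub_span (mem_nth 0 (ltn_ord i))).
exists (size s), (rvmap v) => y.
have : exists x, sincl _ (rvmap v x) = sincl _ y.
  apply/(limageP (sincl _ \o rvmap v)).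
  apply: (span_min _ (sincl_in y)) => x xs; apply/limageP.
  have xi : (index x s < size s)%N by rewrite index_mem.
  exists (delta_mx 0 (Ordinal xi)).
  by rewrite [LHS](congr1 (sincl _) (rvmap_delta v _)) /= nth_index.
by case=> x /sincl_inj; exists x.
Qed.

Lemma fg_eqi (V : lmodType A) (N N' : submodClosed V) :
  N =i N' -> fg (submod N) -> fg (submod N').
Proof.
move=> NN'; have [|f fP] := @lin_factor_inj _ _ _ _ (sincl N') (sincl N) (@sincl_inj _ _ _).
  by move=> x; apply/sinclP; rewrite -NN' sincl_in.
apply: (fg_surj (f := f)) => y.
have /sinclP [x xP] : sincl N' y \in N by rewrite NN' sincl_in.
by exists x; apply: (@sincl_inj _ _ N'); rewrite fP.
Qed.

Hypothesis nA : noetherian A.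

Lemma fg_ideal (I : ideal A) : fg (submod I).
Proof.
have [s sP] := nA I; apply: fg_eqi (fg_span s) => x; exact/esym/sP.
Qed.

Definition noeth_mod (V : lmodType A) := forall N : submodClosed V, fg (submod N).

Lemma noeth_ext (U V W : lmodType A) (f : {linear U -> V}) (g : {linear V -> W}) :
  exact_at f g -> noeth_mod U -> noeth_mod W -> noeth_mod V.
Proof.
move=> fgE nU nW N.
pose N1 := lker (qmod_pi N \o f).
have [|f1 f1P] := @lin_factor_inj _ _ _ _ (sincl N) (f \o sincl N1) (@sincl_inj _ _ _).
  by move=> x; apply/sinclP; move: (sincl_in x) => /lkerP /qmod_pi0.
pose N2 := limage (g \o sincl N).
have [|g1 g1P] := @lin_factor_inj _ _ _ _ (sincl N2) (g \o sincl N) (@sincl_inj _ _ _).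
  by move=> x; apply/sinclP/limageP; exists x.
apply: (fg_ext (f := f1) (g := g1)) (nU N1) (nW N2); last first.
  move=> y; have /limageP[x xP] := sincl_in y.
  by exists x; apply: (@sincl_inj _ _ N2); rewrite g1P.
move=> x; split=> [gx0|[y <-]].
  have /fgE [u uP] : g (sincl N x) = 0 by rewrite -[LHS]g1P gx0 linear0.
  have /sinclP[y yP] : u \in N1.
    by apply/lkerP/qmod_pi0; rewrite /= uP; apply: (sincl_in x).
  by exists y; apply: (@sincl_inj _ _ N); rewrite f1P -[RHS]uP; apply: congr1 yP.
by apply: (@sincl_inj _ _ N2); rewrite g1P linear0 [LHS](congr1 g (f1P y)) [LHS](exact0 _ fgE).
Qed.

Lemma noeth_surj (V W : lmodType A) (f : {linear V -> W}) :
  surj f -> noeth_mod V -> noeth_mod W.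
Proof.
move=> fS nV N; pose N1 := lker (qmod_pi N \o f).
have [|f1 f1P] := @lin_factor_inj _ _ _ _ (sincl N) (f \o sincl N1) (@sincl_inj _ _ _).
  by move=> x; apply/sinclP; move: (sincl_in x) => /lkerP /qmod_pi0.
apply: (fg_surj (f := f1)) (nV N1) => y.
have [x xP] := fS (sincl N y).
have /sinclP[z zP] : x \in N1 by apply/lkerP/qmod_pi0; rewrite /= xP sincl_in.
by exists z; apply: (@sincl_inj _ _ N); rewrite f1P -[RHS]xP; apply: congr1 zP.
Qed.

Lemma noeth_rv n : noeth_mod 'rV[A]_n.
Proof.
elim: n => [|n IHn].
  move=> N; exists 0%N, \0%R => y; exists 0.
  by apply: (@sincl_inj _ _ N); apply/rowP => -[].
rewrite -add1n.
have n1 : noeth_mod 'rV[A]_1.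
  apply: (noeth_surj (f := mulvec (const_mx 1))) fg_ideal => y.
  by exists (y 0 0); apply/rowP => i; rewrite !mxE mulr1 (ord1 i).
have al : linear (fun x : 'rV[A]_n => row_mx (0 : 'rV[A]_1) x).
  by move=> a x y; rewrite scale_row_mx add_row_mx scaler0 addr0.
apply: (noeth_ext (f := Lin al) (g := lsubmx)) => // x.
split=> [x0|[y <-] /=]; last by rewrite row_mxKl.
by exists (rsubmx x) => /=; rewrite -x0 hsubmxK.
Qed.

Lemma noeth_fg (V : lmodType A) : fg V -> noeth_mod V.
Proof. by case=> n [p pS]; apply: noeth_surj pS (@noeth_rv n). Qed.

Lemma fg_submod (V : lmodType A) (N : submodClosed V) : fg V -> fg (submod N).
Proof. by move/noeth_fg. Qed.

Lemma fg_inj (V W : lmodType A) (f : {linear V -> W}) : injective f -> fg W -> fg V.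
Proof.
move=> fI fW.
have [|g gP] := @lin_factor_inj _ _ _ _ f (sincl (limage f)) fI.
  by move=> x; apply/limageP/sincl_in.
apply: (fg_surj (f := g)) (fg_submod (limage f) fW) => y.
have /sinclP[x xP] : f y \in limage f by apply/limageP; exists y.
by exists x; apply: fI; rewrite gP.
Qed.

(** From a counterexample, choice builds a strictly increasing chain of ideals; its union is
    finitely generated, hence equal to a member of the chain. *)
Lemma noeth_ind (P : ideal A -> Prop) :
  (forall I : ideal A, (forall J : ideal A, {subset I <= J} ->
      (exists2 x, x \in J & x \notin I) -> P J) -> P I) ->
  forall I, P I.
Proof.
move=> Pind I; apply: contrapT => nPI.
have step (K : {K : ideal A | ~ P K}) : exists K' : {K : ideal A | ~ P K},
    {subset sval K <= sval K'} /\ exists2 x, x \in sval K' & x \notin sval K.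
  case: K => K nPK; apply: contrapT => h; apply: (nPK); apply: Pind => J KJ xJ.
  by apply: contrapT => nPJ; apply: h; exists (exist _ J nPJ).
have [F FP] := choice step.
pose K n := sval (iter n F (exist _ I nPI)).
have Kle i j : (i <= j)%N -> {subset K i <= K j}.
  move=> /subnK <-; elim: (j - i)%N => // k IH x /IH.
  exact: (FP _).1.
pose U : {pred A^o} := fun x => `[< exists n, x \in K n >].
have Ucl : submod_closed U.
  split; first by apply/asboolP; exists 0%N; apply: rpred0.
  move=> a x y /asboolP[i xi] /asboolP[j yj]; apply/asboolP; exists (maxn i j).
  by apply: rpredD; rewrite ?rpredZ //; [apply: (Kle i)|apply: (Kle j)];
    rewrite ?leq_maxl ?leq_maxr.
pose Ui : ideal A := HB.pack U (GRing.isSubmodClosed.Build A A^o U Ucl).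
have [s sP] := nA Ui.
have [n nP] : exists n, {subset s <= K n}.
  have : {subset s <= Ui} by move=> x xs; rewrite sP; apply: sub_span.
  elim: s {sP} => [|x s IH] sU; first by exists 0%N.
  have [i iP] := IH (fun y ys => sU y (@mem_behead _ (x :: s) y ys)).
  have /asboolP[j jP] := sU x (mem_head _ _).
  exists (maxn i j) => y; rewrite inE => /orP[/eqP ->|ys].
    by apply: (Kle j); rewrite ?leq_maxr.
  by apply: (Kle i); rewrite ?leq_maxl ?iP.
have [_ [x xK /negP []]] := FP (iter n F (exist _ I nPI)).
apply: (span_min nP); rewrite -sP; apply/asboolP; exists n.+1; exact: xK.
Qed.

End Noetherian.

(** * Local noetherian rings *)

Section Annihilators.
Variable A : comPzRingType.

Definition ann (V : lmodType A) (v : V) : ideal A := lker (mulvec v).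

Lemma annP (V : lmodType A) (v : V) a : reflect (a *: v = 0) (a \in ann v).
Proof. exact: eqP. Qed.

Lemma prime1 (q : ideal A) : prime_ideal q -> 1 \notin q.
Proof. by case. Qed.

Lemma notin_primeM (q : ideal A) a b :
  prime_ideal q -> a \notin q -> b \notin q -> a * b \notin q.
Proof. by move=> qP aq bq; apply/negP => /(proj2 qP)[]; apply/negP. Qed.

Hypothesis nA : noetherian A.

(** Each of finitely many generators of the span involves finitely many elements of X. This reduces
    the avoidance argument of [ex_regular] to a finite list. *)
Lemma span_finite (X : {pred A^o}) :
  exists2 s : seq A^o, {subset s <= X} & {subset X <= span (mem s)}.
Proof.
have [t tP] := nA (span X).
have [s sX ts] : exists2 s : seq A^o, {subset s <= X} & {subset t <= span (mem s)}.
  have : {subset t <= span X} by move=> x xt; rewrite tP; apply: sub_span.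
  elim: t {tP} => [|x t IH] tX; first by exists [::].
  have [s sX ts] := IH (fun y yt => tX y (@mem_behead _ (x :: t) y yt)).
  have /spanP[c /allP cX xc] := tX x (mem_head _ _).
  exists ([seq p.2 | p <- c] ++ s) => y.
    by rewrite mem_cat => /orP[/mapP[p /cX pX ->]|/sX].
  rewrite inE => /orP[/eqP ->|/ts]; last first.
    apply: span_min => w ws; apply: sub_span.
    by rewrite -[_ \in mem _]/(w \in _ ++ _) mem_cat ws orbT.
  rewrite xc big_seq; apply: rpred_sum => p pc; apply: rpredZ; apply: sub_span.
  by rewrite -[_ \in mem _]/(_ \in _ ++ _) mem_cat map_f.
exists s => // x xX; apply: (span_min ts); rewrite -tP; exact: sub_span.
Qed.

(** Maximality is relative to q: with q = m this is an ordinary associated prime, and a smaller q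
    yields an associated prime below q, which stands in for localising at q. *)
Definition max_ann (V : lmodType A) (q : ideal A) (z : V) :=
  [/\ prime_ideal (ann z), {subset ann z <= q}
    & forall w : V, {subset ann z <= ann w} -> {subset ann w <= q} ->
        {subset ann w <= ann z}].

Lemma ex_max_ann (V : lmodType A) (q : ideal A) (w : V) :
  prime_ideal q -> {subset ann w <= q} ->
  exists2 z : V, {subset ann w <= ann z} & max_ann q z.
Proof.
move=> qP; move: {2}(ann w) (erefl (ann w)) => J; move: J w.
apply: (noeth_ind nA) => J IH w wJ wq.
have [[w' ww' [w'q [a aw' aw]]]|wmax] := pselect (exists2 w' : V,
    {subset ann w <= ann w'} & {subset ann w' <= q} /\ exists2 a, a \in ann w' & a \notin ann w).
  have [||z w'z zP] := IH (ann w') _ _ w' (erefl _) w'q; rewrite -?wJ //; first by exists a.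
  by exists z => // x /ww' /w'z.
exists w => //; split=> // [|w' ww' w'q a aw']; last first.
  apply: contrapT => /negP aw; apply: wmax; exists w' => //; split=> //; by exists a.
split; first by apply/negP => /wq; apply/negP/prime1.
move=> a b abw; have [aw|/negP aw] := pselect (a \in ann w); [by left|right].
apply: contrapT => /negP bw; apply: wmax.
have sub c : {subset ann w <= ann (c *: w)}.
  by move=> x /annP xw; apply/annP; rewrite scalerA mulrC -scalerA xw scaler0.
have abw0 : (a * b) *: w = 0 by apply/annP.
(* Either b w has a larger annihilator inside q, or some s outside q kills b w; then s w does, as
   its annihilator contains b and stays in q because q is prime. *)
have [bwq|] := pselect ({subset ann (b *: w) <= q}).
  exists (b *: w) => //; split=> //; exists a => //.
  by apply/annP; rewrite scalerA.
move=> /existsNP[s /not_implyP[/annP sb /negP sq]].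
exists (s *: w) => //; split; last first.
  by exists b => //; apply/annP; rewrite scalerA mulrC -scalerA.
move=> t /annP; rewrite scalerA => /annP /wq /(proj2 qP)[//|sq']; by rewrite sq' in sq.
Qed.

Variable m : ideal A.
Hypothesis lm : local_ring m.

(** Noetherian induction: a proper ideal that is not maximal lies in a larger proper one, and m is
    the only maximal ideal. *)
Lemma sub_max (J : ideal A) : 1 \notin J -> {subset J <= m}.
Proof.
apply: (noeth_ind nA (P := fun J : ideal A => 1 \notin J -> {subset J <= m})) => {}J IH J1.
have [[K [JK K1 [x xK xJ]]]|h] := pselect (exists K : ideal A,
    [/\ {subset J <= K}, 1 \notin K & exists2 x, x \in K & x \notin J]).
  by move=> y /JK; apply: IH => //; exists x.
have Jmax : maximal_ideal J.
  split=> // K K1 JK x xK; apply: contrapT => /negP xJ; apply: h.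
  by exists K; split=> //; exists x.
by move=> x; rewrite (proj2 lm J Jmax).
Qed.

Lemma max1 : 1 \notin m. Proof. by case: lm => -[]. Qed.

Lemma local_unit x : x \notin m -> exists y, y * x = 1.
Proof.
move=> xm; apply: contrapT => h; move/negP: xm; apply.
have : x \in limage (mulvec (x : A^o)) by apply/limageP; exists 1; apply: mul1r.
apply: sub_max; apply/negP => /limageP[y yx]; apply: h; by exists y.
Qed.

Lemma local_unit1 x : x \in m -> exists y, y * (1 - x) = 1.
Proof.
move=> xm; apply: local_unit; apply/negP => h; move/negP: max1; apply.
by rewrite -[1](subrK x); apply: rpredD.
Qed.

Lemma max_prime : prime_ideal m.
Proof.
split=> [|x y xy]; first exact: max1.
have [|/negP /local_unit [z zx]] := pselect (x \in m); [by left|right].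
by rewrite -[y]mul1r -zx -mulrA; apply: (rpredZ z).
Qed.

Lemma ann_sub_max (V : lmodType A) (v : V) : v <> 0 -> {subset ann v <= m}.
Proof.
by move=> v0; apply: sub_max; apply/negP => /annP; rewrite scale1r.
Qed.

(** The first vector has coefficient 1 - c 0, a unit, in its own equation and is eliminated from the
    others. A family replaces generators of V because [Ext0_regular_quo] works in Hom(V, X n.+1),
    where finite generation is known only for cocycles modulo coboundaries. *)
Lemma nakayama_fam (V : lmodType A) (N : submodClosed V) n (v : 'I_n -> V) :
  (forall j, exists2 w, w \in N & exists2 c : 'I_n -> A,
     forall i, c i \in m & v j = w + \sum_i c i *: v i) ->
  forall j, v j \in N.
Proof.
elim: n v => [|n IH] v h; first by case.
have [w wN [c cm e]] := h ord0.
have [y y1] := local_unit1 (cm ord0).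
pose v' i := v (lift ord0 i).
have e0 : v ord0 = y *: w + \sum_i (y * c (lift ord0 i)) *: v' i.
  rewrite -[LHS]scale1r -y1 -scalerA scalerBl scale1r {1}e big_ord_recl.
  rewrite addrCA addrAC subrr add0r scalerDr; congr (_ + _).
  by rewrite scaler_sumr; apply: eq_bigr => i _; rewrite scalerA.
have v'N : forall j, v' j \in N.
  apply: IH => j; have [w' w'N [c' c'm e']] := h (lift ord0 j).
  exists (w' + c' ord0 *: (y *: w)); first by rewrite rpredD ?rpredZ.
  exists (fun i => c' ord0 * (y * c (lift ord0 i)) + c' (lift ord0 i)).
    by move=> i; apply: idealD => //; apply/idealMl/idealMl.
  rewrite /v' e' big_ord_recl e0 scalerDr -!addrA; congr (_ + (_ + _)).
  rewrite scaler_sumr -big_split; apply: eq_bigr => i _ /=.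
  by rewrite scalerA -scalerDl.
move=> j; have [i ->|->] := unliftP ord0 j; first exact: v'N.
rewrite e0 rpredD ?rpredZ //; apply: rpred_sum => i _; exact/rpredZ/v'N.
Qed.

Lemma nakayama (V : lmodType A) (N : submodClosed V) y :
  fg V -> y \in m -> (forall v, exists2 w, w \in N & exists v', v = w + y *: v') ->
  forall v, v \in N.
Proof.
move=> [n [p pS]] ym h v.
have pN : forall j, p (delta_mx 0 j) \in N.
  apply: nakayama_fam => j; have [w wN [v' e]] := h (p (delta_mx 0 j)).
  have [u uP] := pS v'; exists w => //; exists (fun i => y * u 0 i).
    by move=> i; apply: idealMr.
  rewrite e -uP {1}[u]row_sum_delta linear_sum scaler_sumr; congr (_ + _).
  by apply: eq_bigr => i _; rewrite linearZ scalerA.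
have [u <-] := pS v; rewrite [u]row_sum_delta linear_sum; apply: rpred_sum => i _.
by rewrite linearZ rpredZ.
Qed.

Lemma nakayama0 (V : lmodType A) y :
  fg V -> y \in m -> (forall v : V, exists v', v = y *: v') -> forall v : V, v = 0.
Proof.
move=> fV ym h v.
(* The kernel of the identity serves as the zero submodule. *)
have /qmod_pi0 : v \in lker (@idfun V).
  apply: (nakayama (y := y)) => // {}v; have [v' e] := h v.
  by exists 0; rewrite ?rpred0 //; exists v'; rewrite add0r.
move=> /qmod_pi0 /lkerP; exact.
Qed.

(* Noetherian induction on the annihilator of a cyclic module reduces to [A/p]; the last
   hypothesis, used with y in m but not in p, is what Nakayama's lemma provides. *)
Lemma devissage (Q : lmodType A -> Prop) :
  (forall V : lmodType A, (forall v : V, v = 0) -> Q V) ->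
  (forall (U V W : lmodType A) (f : {linear U -> V}) (g : {linear V -> W}),
     ses f g -> fg U -> fg V -> fg W -> Q U -> Q W -> Q V) ->
  (forall (V : lmodType A) (v : V), surj (mulvec v) -> ann v =i m -> Q V) ->
  (forall (V : lmodType A) y, fg V -> y \in m -> injective (scalel V y) ->
     Q (qmod (limage (scalel V y))) -> Q V) ->
  forall V : lmodType A, fg V -> Q V.
Proof.
move=> Q0 Qses Qk Qreg.
have fgc (V : lmodType A) (v : V) : surj (mulvec v) -> fg V.
  by move/fg_surj; apply; apply: fg_regular.
have Qcyc (V : lmodType A) (v : V) : surj (mulvec v) -> Q V.
  move: {2}(ann v) (erefl (ann v)) => J; move: J V v.
  apply: (noeth_ind nA) => J IH V v vJ vS.
  have vSq (N : submodClosed V) : surj (mulvec (qmod_pi N v)).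
    elim/qmod_ind => x; have [a <-] := vS x; exists a.
    by rewrite [RHS]linearZ.
  have subq (N : submodClosed V) : {subset J <= ann (qmod_pi N v)}.
    by move=> a; rewrite -vJ => /annP av; apply/annP; rewrite -linearZ av linear0.
  have qa a (av : a *: v \in limage (scalel V a)) : a \in ann (qmod_pi (limage (scalel V a)) v).
    by apply/annP; rewrite -linearZ; apply/qmod_pi0.
  have av a : a *: v \in limage (scalel V a) by apply/limageP; exists v.
  have [J1|/negP J1] := pselect (1 \in J).
    apply: Q0 => x; have [a <-] := vS x; move: J1; rewrite -vJ => /annP.
    by rewrite scale1r => v0; rewrite /= v0 scaler0.
  have Jm := sub_max J1.
  have [mJ|] := pselect ({subset m <= J}).
    by apply: (Qk _ v) => // a; rewrite vJ; apply/idP/idP => [/Jm|/mJ].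
  move=> /existsNP[y /not_implyP[ym /negP yJ]].
  (* If J is prime, y acts injectively on V, which is A/J, and V/yV has a larger annihilator.
     Otherwise ab lies in J with a, b outside it, and V is an extension of V/aV by aV, both cyclic
     with larger annihilators. *)
  have [Jp|Jnp] := pselect (forall a b : A, a * b \in J -> a \in J \/ b \in J).
    have yI : injective (scalel V y).
      apply: lin_inj => x; have [a <-] := vS x => /= e.
      apply/annP; rewrite vJ; have /Jp[yJ'|//] : y * a \in J.
        by rewrite -vJ; apply/annP; rewrite -scalerA.
      by rewrite yJ' in yJ.
    apply: (Qreg _ y) => //; first exact: fgc vS.
    apply: (IH _ _ _ _ (qmod_pi _ v) (erefl _) (vSq _)) => //.
    by exists y => //; apply: qa.
  move: Jnp => /existsNP[a /existsNP[b /not_implyP[abJ /not_orP[/negP aJ /negP bJ]]]].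
  pose v1 : submod (limage (scalel V a)) := Submod (av a).
  have v1S : surj (mulvec v1).
    move=> x; have /limageP[z zP] := sincl_in x; have [c cP] := vS z.
    exists c; apply: (@sincl_inj _ _ (limage (scalel V a))).
    by rewrite -[RHS]zP -cP; apply: scaleC.
  have v1J c : c * a \in J -> c \in ann v1.
    rewrite -vJ => /annP ca; apply/annP; apply: (@sincl_inj _ _ (limage (scalel V a))).
    by rewrite linearZ linear0 [LHS]/= scalerA.
  apply: (Qses _ _ _ _ _ (ses_qmod (limage (scalel V a)))).
  - exact: fgc v1S.
  - exact: fgc vS.
  - exact: fgc (vSq _).
  - apply: (IH _ _ _ _ v1 (erefl _) v1S).
      by move=> c cJ; apply: v1J; rewrite mulrC; apply: (rpredZ a).
    by exists b => //; apply: v1J; rewrite mulrC.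
  - apply: (IH _ _ _ _ (qmod_pi _ v) (erefl _) (vSq _)) => //.
    by exists a => //; apply: qa.
move=> V [n [p pS]].
have {p pS} : exists v : 'I_n -> V, surj (rvmap v).
  exists (fun i => p (delta_mx 0 i)) => y; have [u <-] := pS y; exists u.
  by apply: rvmap_ext => i; rewrite rvmap_delta.
elim: n V => [|n IH] V [v vS].
  apply: Q0 => x; have [u <-] := vS x; exact: big_ord0.
(* The first generator spans a cyclic submodule; the remaining n generate the quotient. *)
have h1 : surj (mulvec (Submod (introT (limageP (mulvec (v ord0)) _) (ex_intro _ 1 (scale1r (v ord0)))) : submod (limage (mulvec (v ord0))))).
  move=> x; have /limageP[a ae] := sincl_in x; exists a.
  by apply: (@sincl_inj _ _ (limage (mulvec (v ord0)))); rewrite linearZ -[RHS]ae.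
have h2 : surj (rvmap (fun i => qmod_pi (limage (mulvec (v ord0))) (v (lift ord0 i)))).
  elim/qmod_ind => x; have [u <-] := vS x.
  exists (\row_i u 0 (lift ord0 i)).
  rewrite [LHS]/= [rvmap v u]big_ord_recl linearD [X in X + _](qmod_pi0 _ _).2 ?add0r.
    by rewrite linear_sum; apply: eq_bigr => i _; rewrite mxE linearZ.
  by apply/limageP; exists (u 0 ord0).
apply: (Qses _ _ _ _ _ (ses_qmod (limage (mulvec (v ord0))))).
- exact: fgc h1.
- by exists n.+1, (rvmap v).
- by exists n, (rvmap (fun i => qmod_pi (limage (mulvec (v ord0))) (v (lift ord0 i)))).
- exact: Qcyc h1.
- by apply: IH; exists (fun i => qmod_pi (limage (mulvec (v ord0))) (v (lift ord0 i))).
Qed.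

End Annihilators.

(** * Vanishing of Ext over a Gorenstein local ring of dimension one *)

Section RegularElement.
Variables (A : comPzRingType) (nA : noetherian A) (m : ideal A) (lm : local_ring m).

Definition regular_elt (x : A) := forall y : A, x * y = 0 -> y = 0.

Lemma regularI (x : A) : regular_elt x -> injective ( *%R x).
Proof.
move=> xreg a b e; apply/eqP; rewrite -subr_eq0; apply/eqP/xreg.
by rewrite mulrBr e subrr.
Qed.

(* A maximal annihilator is prime, and by noetherianity x can be chosen in I so
   that the span of the z with maximal annihilator and x z <> 0 is maximal; such an
   x avoids all the associated primes, hence is regular. *)
Lemma ex_regular (I : ideal A) :
  (forall z : A, (forall i, i \in I -> i * z = 0) -> z = 0) ->
  exists2 x, x \in I & regular_elt x.
Proof.
move=> annI.
pose Z (x : A) : {pred A^o} := fun z => `[< max_ann m (z : A^o) /\ x * z <> 0 >].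
suff H : forall (K : ideal A) x, x \in I -> span (Z x) = K ->
    exists2 x, x \in I & regular_elt x by exact: H (rpred0 I) (erefl _).
apply: (noeth_ind nA) => K IH x xI xK.
have [[z0 z0m xz0]|h] := pselect (exists2 z0 : A^o, max_ann m z0 & x * z0 = 0); last first.
  exists x => // w xw; apply: contrapT => w0.
  have [z wz zm] := ex_max_ann nA (max_prime nA lm) (ann_sub_max nA lm (v := w : A^o) w0).
  by apply: h; exists z => //; apply/annP/wz/annP.
have [s sZ Zs] := span_finite nA (Z x).
have [z0p z0q z0max] := z0m.
(* For each z in s, some b kills z but not z0: otherwise maximality of ann z would put x, which
   kills z0, into ann z. As ann z0 is prime, the product of these b is the required a. *)
have [a aP az0] : exists2 a : A, forall z, z \in s -> a * z = 0 & a \notin ann (z0 : A^o).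
  have : forall z, z \in s -> max_ann m (z : A^o) /\ x * z <> 0 by move=> z /sZ /asboolP.
  elim: s {sZ Zs} => [_|z s IHs zs]; first by exists 1 => //; apply: prime1.
  have [a aP az0] := IHs (fun w ws => zs w (@mem_behead _ (z :: s) w ws)).
  have [[_ zq zmax] xz] := zs z (mem_head _ _).
  have [b bz bz0] : exists2 b, b * z = 0 & b \notin ann (z0 : A^o).
    apply: contrapT => hb.
    have zz0 : {subset ann (z : A^o) <= ann (z0 : A^o)}.
      move=> b /annP bz; apply: contrapT => /negP bz0; apply: hb; by exists b.
    by apply: xz; apply/annP; apply: (zmax z0 zz0 z0q); apply/annP.
  exists (b * a); last exact: notin_primeM.
  move=> w; rewrite inE => /orP[/eqP ->|/aP aw]; first by rewrite mulrAC bz mul0r.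
  by rewrite -mulrA aw mulr0.
have [y yI yz0] : exists2 y, y \in I & y \notin ann (z0 : A^o).
  apply: contrapT => hy; move/negP: (prime1 z0p); apply.
  apply/annP; rewrite [LHS]mul1r; apply: annI => i iI; apply/annP.
  apply: contrapT => /negP; move=> iz0; apply: hy; by exists i.
(* The new element acts on s as x does and does not kill z0. The span gains z0, which was not in it
   since a kills the old span. *)
have x'I : x + y * a \in I by apply: idealD => //; apply: idealMr.
have x'z0 : (x + y * a) * z0 <> 0.
  rewrite mulrDl xz0 add0r => /annP; apply/negP; exact: notin_primeM.
have kS : {subset K <= span (Z (x + y * a))}.
  rewrite -xK; apply: span_min => z /Zs; apply: span_min => {}z zs.
  have /asboolP[zm xz] := sZ z zs; apply/sub_span/asboolP; split=> //.
  by rewrite mulrDl -mulrA aP // mulr0 addr0.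
apply: (IH _ kS _ (x + y * a)) => //; exists z0.
  by apply/sub_span/asboolP.
rewrite -xK; apply/negP => z0K.
have : z0 \in lker (scalel A^o a).
  move: z0K; apply: span_min => z /Zs; apply: span_min => {}z zs.
  by apply/lkerP; apply: aP.
by move=> /lkerP az; move/negP: az0; apply; apply/annP.
Qed.

End RegularElement.

(** * Vanishing of Ext computed from an injective resolution *)

Section Coresolution.
Variables (A : comPzRingType) (X : nat -> lmodType A)
  (d : forall n, {linear X n -> X n.+1}).
Hypothesis Xinj : forall n, injective_module (X n).
Hypothesis d_d : forall n x, d n.+1 (d n x) = 0.

Definition cocycle n (V : lmodType A) (f : {linear V -> X n.+1}) :=
  forall v, d n.+1 (f v) = 0.

(* X stands for the complex 0 -> E^0 -> E^1 -> ... with X 0 = 0 and X n.+1 = E^n an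
   injective resolution of A, so that [Ext0 n V] means Ext^n(V, A) = 0, and in
   particular [Ext0 0 V] means Hom(V, A) = 0. *)
Definition Ext0 n (V : lmodType A) := forall f : {linear V -> X n.+1},
  cocycle f -> exists g : {linear V -> X n}, forall v, f v = d n (g v).

Section LongExact.
Variables (n : nat) (U V W : lmodType A) (f : {linear U -> V}) (g : {linear V -> W}).
Hypothesis fg_ses : ses f g.

(** Extend the cocycle to V by injectivity; its coboundary kills U and so becomes a cocycle on W,
    whose primitive corrects the extension. The next two lemmas are the analogous chases at V and
    W. *)
Lemma Ext0_sub : Ext0 n V -> Ext0 n.+1 W -> Ext0 n U.
Proof.
case: fg_ses => fI fgE gS hV hW u uc.
have [v vP] := Xinj u fI.
have [w wP] : exists w : {linear W -> X n.+2}, forall x, w (g x) = d n.+1 (v x).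
  apply: (@lin_factor_surj _ _ _ _ g (d n.+1 \o v)) => // x /fgE[y <-] /=.
  by rewrite vP uc.
have [|w' w'P] := hW w.
  by move=> y; have [x <-] := gS y; rewrite wP d_d.
have [|v' v'P] := hV (v \- (w' \o g)).
  by move=> x; rewrite /= linearB /= -wP w'P subrr.
exists (v' \o f) => y /=; rewrite -v'P /= vP.
by rewrite (exact0 _ fgE) linear0 subr0.
Qed.

Lemma Ext0_ext : Ext0 n U -> Ext0 n W -> Ext0 n V.
Proof.
case: fg_ses => fI fgE gS hU hW v vc.
have [|u uP] := hU (v \o f); first by move=> y; apply: vc.
have [v' v'P] := Xinj u fI.
have [w wP] : exists w : {linear W -> X n.+1}, forall x, w (g x) = (v \- (d n \o v')) x.
  apply: (@lin_factor_surj _ _ _ _ g (v \- (d n \o v'))) => // x /fgE[y <-] /=.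
  by rewrite v'P -uP subrr.
have [|w' w'P] := hW w.
  by move=> y; have [x <-] := gS y; rewrite wP linearB /= vc d_d subrr.
exists (v' \+ (w' \o g)) => x /=.
by rewrite linearD /= -w'P wP /= addrC subrK.
Qed.

Lemma Ext0_quo : Ext0 n U -> Ext0 n.+1 V -> Ext0 n.+1 W.
Proof.
case: fg_ses => fI fgE gS hU hV w wc.
have [|v vP] := hV (w \o g); first by move=> y; apply: wc.
have [|u uP] := hU (v \o f).
  by move=> y; rewrite -vP /= (exact0 _ fgE) linear0.
have [v' v'P] := Xinj u fI.
have [w' w'P] : exists w : {linear W -> X n.+1}, forall x, w (g x) = (v \- (d n \o v')) x.
  apply: (@lin_factor_surj _ _ _ _ g (v \- (d n \o v'))) => // x /fgE[y <-] /=.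
  by rewrite v'P -uP subrr.
exists w' => y; have [x <-] := gS y.
by rewrite w'P linearB d_d subr0 -vP.
Qed.

End LongExact.

Lemma Ext0_zero n (V : lmodType A) : (forall v : V, v = 0) -> Ext0 n V.
Proof. by move=> V0 f _; exists \0%R => v; rewrite (V0 v) !linear0. Qed.

Lemma Ext0_top n (V : lmodType A) : (forall x : X n.+1, x = 0) -> Ext0 n V.
Proof. by move=> X0 f _; exists \0%R => v; rewrite linear0; apply: X0. Qed.

Lemma Ext0_rv n k : exact_at (d n) (d n.+1) -> Ext0 n 'rV[A]_k.
Proof.
move=> dE f fc; have [v vP] := choice (fun i => (dE _).1 (fc (delta_mx 0 i))).
exists (rvmap v); apply: (@rvmap_ext _ _ _ f (d n \o rvmap v)) => i.
by rewrite [RHS](congr1 (d n) (rvmap_delta v i)) vP.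
Qed.

Lemma Ext0_surj n (V W : lmodType A) (f : {linear V -> W}) :
  bijective f -> Ext0 n V -> Ext0 n W.
Proof.
move=> [g fK gK] hV w wc.
have gl : linear g by move=> a x y; apply: (can_inj fK); rewrite linearP !gK.
have [|v vP] := hV (w \o f); first by move=> y; apply: wc.
by exists (v \o Lin gl) => y; rewrite /= -vP /= gK.
Qed.

Lemma Ext0_regular n : exact_at (d n) (d n.+1) -> Ext0 n A^o.
Proof.
move=> /(@Ext0_rv _ 1); apply: (@Ext0_surj _ _ _ (rvmap (fun _ => 1 : A^o))).
exists (fun y => \row_i y) => [u|y] /=; last by rewrite big_ord1 mxE; apply: mulr1.
by apply/rowP => i; rewrite big_ord1 !mxE (ord1 i); apply: mulr1.
Qed.

(** Finite generation of Ext^n(V, A), in terms of representing cocycles so that no quotient module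
    is formed. *)
Definition Ext_fg n (V : lmodType A) :=
  exists k (v : 'I_k -> Hom V (X n.+1)), (forall i, cocycle (v i : {linear V -> X n.+1}))
    /\ forall f : {linear V -> X n.+1}, cocycle f ->
         exists (a : 'I_k -> A) (g : {linear V -> X n}),
           forall x, f x = \sum_i a i *: (v i : {linear V -> X n.+1}) x + d n (g x).

(** Dimension shifting: Ext^(n+1)(V, A) is a quotient of Ext^n(U, A), because the free middle term
    has no Ext^(n+1). *)
Lemma Ext_fg_succ n (U V : lmodType A) k (f : {linear U -> 'rV[A]_k}) (g : {linear 'rV[A]_k -> V}) :
  ses f g -> exact_at (d n.+1) (d n.+2) -> Ext_fg n U -> Ext_fg n.+1 V.
Proof.
move=> [fI fgE gS] dE [l [u [uc uP]]].
have [v vP] := choice (fun i => Xinj (u i : {linear U -> X n.+1}) fI).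
have /choice[w wP] : forall i, exists w : {linear V -> X n.+2}, forall x, w (g x) = d n.+1 (v i x).
  move=> i; apply: (@lin_factor_surj _ _ _ _ g (d n.+1 \o v i)) => // x /fgE[y <-] /=.
  by rewrite vP uc.
exists l, w; split=> [i y|h hc].
  by have [x <-] := gS y; rewrite wP d_d.
have [|h1 h1P] := Ext0_rv dE (f := h \o g); first by move=> x; apply: hc.
have [|a [b bP]] := uP (h1 \o f).
  by move=> x; rewrite -h1P /= (exact0 _ fgE) linear0.
have [b' b'P] := Xinj b fI.
have vl : linear (fun x => \sum_i a i *: v i x).
  move=> c x y; rewrite scaler_sumr -big_split; apply: eq_bigr => i _ /=.
  by rewrite linearP scalerDr scaleC.
have [h2 h2P] : exists h2 : {linear V -> X n.+1}, forall x,
    h2 (g x) = (h1 \- (Lin vl \+ (d n \o b'))) x.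
  apply: (@lin_factor_surj _ _ _ _ g (h1 \- (Lin vl \+ (d n \o b')))) => // x /fgE[y <-] /=.
  rewrite [h1 _]bP b'P; apply/eqP; rewrite subr_eq0; apply/eqP; congr (_ + _).
  by apply: eq_bigr => i _; rewrite vP.
exists a, h2 => y; have [x <-] := gS y.
have -> : \sum_i a i *: w i (g x) = d n.+1 (\sum_i a i *: v i x).
  by rewrite linear_sum; apply: eq_bigr => i _; rewrite wP linearZ.
by rewrite h2P /= linearB linearD /= d_d addr0 -h1P addrC subrK.
Qed.

End Coresolution.

(** * Free resolutions by iterated syzygies *)

Section Resolution.
Variables (A : comPzRingType) (nA : noetherian A).

(** Finite generation is bundled with the module so that [syzygy] is an endomap and can be
    iterated. *)
Record fgmod := FgMod { fgmod_sort : lmodType A; fgmod_fg : fg fgmod_sort }.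

Definition rank (V : fgmod) : nat := projT1 (cid (fgmod_fg V)).
Definition cover (V : fgmod) : {linear 'rV[A]_(rank V) -> fgmod_sort V} :=
  projT1 (cid (projT2 (cid (fgmod_fg V)))).
Lemma cover_surj V : surj (cover V).
Proof. exact: (projT2 (cid (projT2 (cid (fgmod_fg V))))). Qed.

Definition syzygy (V : fgmod) : fgmod :=
  FgMod (fg_submod nA (lker (cover V)) (fg_rv A (rank V))).

Lemma ses_syzygy V : ses (sincl (lker (cover V))) (cover V).
Proof.
split; [exact: sincl_inj| |exact: cover_surj].
by move=> x; rewrite sinclP; split=> /lkerP.
Qed.

Variable V : lmodType A.
Hypothesis fV : fg V.

Definition nth_syzygy n : fgmod := iter n syzygy (FgMod fV).
Definition free_res n : lmodType A := 'rV[A]_(rank (nth_syzygy n)).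
Definition free_res_d n : {linear free_res n.+1 -> free_res n} :=
  sincl (lker (cover (nth_syzygy n))) \o cover (nth_syzygy n.+1).

Lemma free_res_projective : projective_resolution free_res_d (cover (nth_syzygy 0)).
Proof.
have ex n : exact_at (free_res_d n) (cover (nth_syzygy n)).
  have [_ cE _] := ses_syzygy (nth_syzygy n); move=> y; rewrite cE.
  split=> [[u <-]|[u <-]]; last by exists (cover (nth_syzygy n.+1) u).
  by have [w <-] := cover_surj (V := nth_syzygy n.+1) u; exists w.
split=> [n|||n]; [exact: projective_rv|exact: cover_surj|exact: ex|].
move=> y; rewrite -ex; split=> e; last by rewrite -[LHS]/(sincl _ (cover (nth_syzygy n.+1) y)) e linear0.
exact: (inj0 (@sincl_inj _ _ _) e).
Qed.

End Resolution.

(** * Descending induction from a finite injective resolution *)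

Section FiniteInjectiveDimension.
Variables (A : comPzRingType) (nA : noetherian A) (m : ideal A) (lm : local_ring m).

Lemma fg_hom (V W : lmodType A) : fg V -> fg W -> fg (Hom V W).
Proof.
move=> [k [p pS]] [l [q qS]].
have el : linear (fun f : Hom V W => ((f : {linear V -> W}) \o p : Hom 'rV[A]_k W)).
  by move=> a f g; apply: Hom_ext => u.
have eI : injective (Lin el).
  apply: lin_inj => f /(congr1 (fun g : Hom 'rV[A]_k W => (g : {linear _ -> _}) : _ -> _)) /= e.
  by apply: Hom_ext => v; have [u <-] := pS v; move/(congr1 (fun g => g u)): e.
have ml : linear (fun w : 'rV[A]_(k * l) => q \o mulmxr (vec_mx w) : Hom 'rV[A]_k W).
  by move=> a w w'; apply: Hom_ext => u; rewrite /= linearP mulmxDr -scalemxAr linearP.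
apply: (fg_inj nA eI); exists (k * l)%N, (Lin ml) => f.
have [g gP] := rv_lift (f : {linear 'rV[A]_k -> W}) qS.
by exists (mxvec (lin1_mx g)); apply: Hom_ext => u; rewrite /= mxvecK mul_rV_lin1 gP.
Qed.

Lemma fg_dual (V : lmodType A) : fg V -> fg (dual V).
Proof. by move=> fV; apply: fg_hom => //; apply: fg_regular. Qed.

Variables (X : nat -> lmodType A) (d : forall n, {linear X n -> X n.+1}).
Variable (e : {linear A^o -> X 1%N}).
Hypothesis Xinj : forall n, injective_module (X n).
Hypothesis X0 : forall x : X 0%N, x = 0.
Hypothesis eI : injective e.
Hypothesis eE : exact_at e (d 1%N).
Hypothesis dE : forall n, exact_at (d n.+1) (d n.+2).

Lemma d_d n x : d n.+1 (d n x) = 0.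
Proof.
case: n x => [|n] x; first by rewrite (X0 x) !linear0.
by apply/dE; exists x.
Qed.

Lemma ses_presentation (V : lmodType A) : fg V ->
  exists k (p : {linear 'rV[A]_k -> V}), ses (sincl (lker p)) p.
Proof.
move=> [k [p pS]]; exists k, p; split=> //; first exact: sincl_inj.
by move=> x; rewrite sinclP; split=> /lkerP.
Qed.

(** In degree 0 the cocycles factor through e, so generators of the dual of V suffice; higher
    degrees follow by dimension shifting. *)
Lemma Ext_fg_all n (V : lmodType A) : fg V -> Ext_fg d n V.
Proof.
elim: n V => [|n IH] V fV; last first.
  have [k [p pK]] := ses_presentation fV.
  apply: (Ext_fg_succ Xinj _ pK) => //; first exact: d_d.
  by apply: IH; apply: (fg_submod nA); apply: fg_rv.
have [k [p pS]] := fg_dual fV.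
exists k, (fun i => e \o (p (delta_mx 0 i) : {linear V -> A^o})).
split=> [i v|f fc]; first exact: (exact0 _ eE).
have [|g gP] := lin_factor_inj (f := f) eI; first by move=> v; apply/eE/fc.
have [u uP] := pS g.
exists (fun i => u 0 i), \0%R => v; rewrite linear0 addr0 -gP.
have -> : (g : {linear V -> A^o}) = p u :> (V -> A^o) by rewrite uP.
rewrite {1}[u]row_sum_delta linear_sum.
have evl : linear (fun f : dual V => e ((f : {linear V -> A^o}) v)).
  by move=> a f1 f2; rewrite -linearP.
rewrite [LHS](linear_sum (Lin evl)); apply: eq_bigr => i _.
by rewrite /= [p _]linearZ; apply: linearZ.
Qed.

(* The hypothesis on V/xV makes x onto on the finitely generated module Ext^n(V, A). *)
Lemma Ext0_regular_quo n (V : lmodType A) (x : A) : fg V -> x \in m ->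
  injective (scalel V x) -> Ext0 d n.+1 (qmod (limage (scalel V x))) -> Ext0 d n V.
Proof.
move=> fV xm xI h.
have step (f : {linear V -> X n.+1}) : cocycle d f -> exists2 f' : {linear V -> X n.+1},
    cocycle d f' & exists g : {linear V -> X n}, forall v, f v = x *: f' v + d n (g v).
  (* F satisfies F(xv) = f(v). Its coboundary lives on V/xV, where it has a primitive H by
     hypothesis; F - H is a cocycle with x(F - H) = f. *)
  move=> fc; have [F FP] := Xinj f xI.
  have [G GP] : exists G : {linear qmod (limage (scalel V x)) -> X n.+2},
      forall v, G (qmod_pi _ v) = d n.+1 (F v).
    apply: (qmod_lift (N := limage (scalel V x)) (f := d n.+1 \o F)).
    by move=> v /limageP[u <-] /=; rewrite FP fc.
  have [|H HP] := h G.
    by elim/qmod_ind => v; rewrite GP d_d.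
  pose F' := F \- (H \o qmod_pi (limage (scalel V x))).
  exists F'; first by move=> v; rewrite linearB /= -HP GP subrr.
  exists \0%R => v; rewrite linear0 addr0.
  have -> : f v = x *: F v by rewrite -FP -linearZ.
  have xv0 : qmod_pi (limage (scalel V x)) (x *: v) = 0.
    by apply/qmod_pi0/limageP; exists v.
  have Hx0 : x *: H (qmod_pi _ v) = 0. by rewrite -(linZ H) -(linZ (qmod_pi _)) /= xv0 linear0.
  by rewrite scalerBr [X in _ - X]Hx0 subr0.
have [k [v [vc vP]]] := Ext_fg_all n fV.
pose post (g : Hom V (X n)) : Hom V (X n.+1) := d n \o (g : {linear V -> X n}).
have postl : linear post by move=> a g g'; apply: Hom_ext => y /=; rewrite linearP.
(* Nakayama's lemma relative to the coboundaries: each generating cocycle is x times a combination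
   of the generators, up to a coboundary. *)
have vN : forall i, v i \in limage (Lin postl).
  apply: (nakayama_fam nA lm) => j; have [f' /vP[a [g' g'P]] [g gP]] := step (v j) (vc j).
  exists (post ((x *: (g' : Hom V (X n)) : Hom V (X n)) + (g : Hom V (X n)))).
    by apply/limageP; exists ((x *: (g' : Hom V (X n)) : Hom V (X n)) + (g : Hom V (X n))).
  exists (fun i => x * a i); first by move=> i; apply: idealMr.
  apply: Hom_ext => y; rewrite gP g'P scalerDr [RHS]/= linearP -addrA addrC; congr (_ + _).
  have evl : linear (fun f : Hom V (X n.+1) => (f : {linear V -> X n.+1}) y) by [].
  rewrite [RHS](linear_sum (Lin evl)) scaler_sumr; apply: eq_bigr => i _.
  by rewrite scalerA.
move=> f /vP[a [g gP]].
have /choice[w wP] : forall i, exists w : Hom V (X n), post w = v i.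
  by move=> i; have /limageP[w wP] := vN i; exists w.
have wl : linear (fun y => \sum_i a i *: (w i : {linear V -> X n}) y).
  move=> c y y'; rewrite scaler_sumr -big_split; apply: eq_bigr => i _ /=.
  by rewrite linearP scalerDr scaleC.
exists (Lin wl \+ g) => y; rewrite gP /= linearD linear_sum; congr (_ + _).
by apply: eq_bigr => i _; rewrite -wP linearZ.
Qed.

(** Extend e u to a map V -> X 1 and correct it by a map from W until it becomes a cocycle; by [eE]
    it then takes values in e(A). *)
Lemma Ext1_extend (U V W : lmodType A) (f : {linear U -> V}) (g : {linear V -> W})
    (u : {linear U -> A^o}) :
  ses f g -> Ext0 d 1 W -> exists v : {linear V -> A^o}, forall x, v (f x) = u x.
Proof.
case=> fI fgE gS hW.
have [v vP] := Xinj (e \o u) fI.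
have [w wP] : exists w : {linear W -> X 2%N}, forall x, w (g x) = d 1%N (v x).
  apply: (@lin_factor_surj _ _ _ _ g (d 1%N \o v)) => // x /fgE[y <-] /=.
  by rewrite vP; apply/eE; exists (u y).
have [|w' w'P] := hW w; first by move=> y; have [x <-] := gS y; rewrite wP d_d.
have [|v' v'P] := lin_factor_inj (f := v \- (w' \o g)) eI.
  by move=> x; apply/eE; rewrite linearB /= -w'P wP subrr.
exists v' => y; apply: eI; rewrite v'P /= vP.
by rewrite (exact0 _ fgE) linear0 subr0.
Qed.

Lemma Ext0_hom0 (V : lmodType A) (f : {linear V -> A^o}) v : Ext0 d 0 V -> f v = 0.
Proof.
case/(_ (e \o f)) => [y|g gP]; first by apply/eE; exists (f y).
apply: (inj0 eI); rewrite -[e _]/((e \o f) v) gP.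
by rewrite (X0 (g v)) linear0.
Qed.

Lemma Ext0_step n :
  (forall (V : lmodType A) (v : V), surj (mulvec v) -> ann v =i m -> Ext0 d n V) ->
  (forall V : lmodType A, fg V -> Ext0 d n.+1 V) ->
  forall V : lmodType A, fg V -> Ext0 d n V.
Proof.
move=> hk h; apply: (devissage nA lm) => //.
- by move=> V; apply: Ext0_zero.
- by move=> U V W f g fgE _ _ _; apply: (Ext0_ext Xinj d_d fgE).
- move=> V y fV ym yI _; apply: (Ext0_regular_quo fV ym yI).
  exact/h/fg_qmod.
Qed.

(** This serves both descents, with M = A in [socle0] and M = A/xA in [Ext0_ge2]; the vanishing in
    degree n.+1 is spent on the cokernel of V -> M. *)
Lemma Ext0_simple n (V M : lmodType A) (v : V) (z : M) :
  surj (mulvec v) -> ann v =i m -> ann z =i m -> fg M -> Ext0 d n M ->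
  (forall V : lmodType A, fg V -> Ext0 d n.+1 V) -> Ext0 d n V.
Proof.
move=> vS vm zm fM hM h.
have [|f fP] := lin_factor_surj (f := mulvec z) vS.
  by move=> a /annP; rewrite vm -zm => /annP.
have fI : injective f.
  apply: lin_inj => y; have [a <-] := vS y; rewrite fP => /annP.
  by rewrite zm -vm => /annP.
apply: (Ext0_sub Xinj d_d (ses_limage fI) hM); exact/h/fg_qmod.
Qed.

Hypothesis Xtop : exists N, forall n, (N < n)%N -> forall x : X n, x = 0.

Lemma Ext0_descend k :
  (forall n, (k <= n)%N -> (forall V : lmodType A, fg V -> Ext0 d n.+1 V) ->
     forall V : lmodType A, fg V -> Ext0 d n V) ->
  forall n, (k <= n)%N -> forall V : lmodType A, fg V -> Ext0 d n V.
Proof.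
move=> step n kn; have [N NP] := Xtop.
have [l] := ubnP (N - n)%N; elim: l n kn => // l IH n kn lN.
have [Nn|nN] := leqP N n; first by move=> V _; apply: Ext0_top; apply: NP.
apply: step => //; apply: IH; first exact: leqW.
by rewrite -ltnS (leq_trans _ lN) // ltnS subnS prednK // subn_gt0.
Qed.

Hypothesis dimA : krull_dim A 1.

(* Otherwise A/m embeds in A, and descending induction on n gives Ext^n(-, A) = 0 for
   n > 0. For a prime p strictly inside m this forces Hom(A/p, A) = 0, so that the map
   A -> A^n given by generators of p is injective; it then splits, and 1 is in p. *)
Lemma socle0 (z : A) : (forall i, i \in m -> i * z = 0) -> z = 0.
Proof.
move=> mz; apply: contrapT => z0.
have zm : ann (z : A^o) =i m.
  by move=> a; apply/idP/idP => [|/mz/annP//]; apply: (ann_sub_max nA lm).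
have T n : (0 < n)%N -> forall V : lmodType A, fg V -> Ext0 d n V.
  apply: Ext0_descend => {}n n0 h; apply: Ext0_step => // V v vS vm.
  apply: (Ext0_simple vS vm zm (fg_regular A)) => //.
  by case: n n0 {h} => // n _; apply: Ext0_regular.
have [[p [pP pS]] _] := dimA.
have p0 := pP 0%N isT; have [p01 p10] := pS 0%N isT.
have [y yp1 yp0] : exists2 y, y \in p 1%N & y \notin p 0%N.
  by move: p10 => /existsNP[y /not_implyP[yp /negP]]; exists y.
have ym : y \in m by apply: (sub_max nA lm (prime1 (pP 1%N isT))).
(* An element y of the larger prime is regular on A/p, and Ext^1 vanishes on the quotient by y, so
   Nakayama's lemma kills Hom(A/p, A). *)
have T0 : Ext0 d 0 (qmod (p 0%N)).
  apply: (@Ext0_regular_quo _ _ y) => //.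
  - exact/fg_qmod/fg_regular.
  - apply: lin_inj; elim/qmod_ind => a; rewrite -[scalel _ _ _]linZ.
    move=> /(qmod_pi0 (p 0%N)) /(proj2 p0)[ya|ap]; first by rewrite ya in yp0.
    exact/qmod_pi0.
  - exact/T/fg_qmod/fg_qmod/fg_regular.
have annp (w : A) : (forall a, a \in p 0%N -> a * w = 0) -> w = 0.
  move=> pw; have [g gP] := qmod_lift (f := mulvec (w : A^o)) pw.
  by rewrite -[w]mul1r -[LHS]gP; apply: Ext0_hom0.
have [n [q qS]] := fg_ideal nA (p 0%N).
pose r : 'rV[A]_n := \row_i submod_val (q (delta_mx 0 i)).
have rI : injective (mulvec r).
  apply: lin_inj => a ra; apply: annp => b bp.
  have [u uP] := qS (Submod bp).
  rewrite -[b]/(submod_val (Submod bp)) -uP {1}[u]row_sum_delta linear_sum.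
  rewrite -[submod_val _]/(sincl _ _) linear_sum mulr_suml big1 // => i _.
  rewrite !linZ -[_ *: _]/(_ * _) -mulrA [_ * a]mulrC.
  by move/rowP: ra => /(_ i); rewrite !mxE => ->; rewrite mulr0.
have [|g gP] := Ext1_extend idfun (ses_limage rI).
  exact/T/fg_qmod/fg_rv.
move/negP: (prime1 p0); apply.
rewrite -[1]/(@idfun A^o 1) -gP /= scale1r [r]row_sum_delta linear_sum.
apply: rpred_sum => i _; rewrite linZ mxE; apply: idealMr.
exact: (sincl_in (q (delta_mx 0 i))).
Qed.

Lemma ex_regular_max : exists2 x : A, x \in m & regular_elt x.
Proof. by apply: (ex_regular nA lm) => z; apply: socle0. Qed.

Variable x : A.
Hypotheses (xm : x \in m) (xreg : regular_elt x).

Notation xA := (limage (scalel A^o x)).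

Lemma scalel_inj : injective (scalel A^o x).
Proof. exact/lin_inj/xreg. Qed.

(* Otherwise a maximal annihilator inside q, which cannot contain the regular element x,
   gives a chain of primes of length 2. *)
Lemma prime_regular (q : ideal A) : prime_ideal q -> x \in q -> {subset m <= q}.
Proof.
move=> qP xq; apply: contrapT => mq.
have ann1q : {subset ann (1 : A^o) <= q}.
  by move=> a /annP; rewrite [LHS]mulr1 => ->; apply: rpred0.
have [z _ [zP zq _]] := ex_max_ann nA qP ann1q.
have xz : x \notin ann z.
  apply/negP => /annP /xreg z0; move/negP: (prime1 zP); apply.
  by apply/annP; rewrite z0 scaler0.
pose p i : ideal A := if i is i'.+1 then if i' is 0%N then q else m else ann z.
suff: (2 <= 1)%N by []; apply: (proj2 dimA 2%N p); split.
  by case=> [|[|[|//]]] _ //; apply: (max_prime nA lm).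
case=> [|[|//]] _; split=> //; last exact: (sub_max nA lm (prime1 qP)).
by move=> qz; move/negP: xz; apply; apply: qz.
Qed.

(** An associated prime of A/xA contains x, hence is m by [prime_regular]; z lifts an element with
    this annihilator. *)
Lemma ex_socle : exists2 z : A, z \notin xA & forall a, a \in m -> a * z \in xA.
Proof.
have xAm : {subset ann (qmod_pi xA 1) <= m}.
  move=> a /annP; rewrite -[_ *: qmod_pi _ _]linZ => /qmod_pi0.
  by rewrite [_ *: _]mulr1 => /limageP[b <-]; apply: idealMr.
have [z' zx [zP zm _]] := ex_max_ann nA (max_prime nA lm) xAm.
elim/qmod_ind: z' => z in zx zP zm *.
have xz : x \in ann (qmod_pi xA z).
  apply: zx; apply/annP; rewrite -[_ *: qmod_pi _ _]linZ; apply/qmod_pi0/limageP.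
  by exists 1.
exists z => [|a /(prime_regular zP xz) /annP].
  apply/negP => /qmod_pi0 z0; move/negP: (prime1 zP); apply.
  by apply/annP; rewrite scale1r.
by rewrite -[_ *: qmod_pi _ _]linZ => /qmod_pi0.
Qed.

(* Descending induction again: now A/m embeds in A/xA, and Ext^n(A/xA, A) = 0 for n > 1. *)
Lemma Ext0_ge2 n (V : lmodType A) : (2 <= n)%N -> fg V -> Ext0 d n V.
Proof.
have [z zx zm] := ex_socle.
have annz : ann (qmod_pi xA z) =i m.
  move=> a; apply/idP/idP => [|/zm az].
    by apply: (ann_sub_max nA lm) => /qmod_pi0; apply/negP.
  by apply/annP; rewrite -[_ *: qmod_pi _ _]linZ; apply/qmod_pi0.
move=> n2 fV; move: n n2 V fV; apply: Ext0_descend => n n2 h; apply: Ext0_step => // V v vS vm.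
apply: (Ext0_simple vS vm annz) => //; first exact/fg_qmod/fg_regular.
(* Ext^n(A/xA, A) lies between Ext^(n-1)(A, A) and Ext^n(A, A). Both vanish once n - 1 > 0, whence
   the bound 2. *)
case: n n2 {h} => [//|[//|n]] _.
by apply: (Ext0_quo Xinj d_d (ses_limage scalel_inj)); apply: Ext0_regular.
Qed.

Lemma Ext0_torsionfree n (V : lmodType A) : (0 < n)%N -> fg V ->
  injective (scalel V x) -> Ext0 d n V.
Proof.
case: n => [//|[|n]] _ fV xV; last exact: Ext0_ge2.
by apply: (Ext0_regular_quo fV xm xV); apply/Ext0_ge2/fg_qmod.
Qed.

(** The passage from injective to projective resolutions: the vanishing is inherited by all
    syzygies, and Ext^1 = 0 of the n-th syzygy extends a map from the next one to the free module
    containing it. *)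
Lemma Ext0_Ext_succ_eq0 (V : lmodType A) : fg V ->
  (forall n, (0 < n)%N -> Ext0 d n V) -> forall n, Ext_succ_eq0 n V A^o.
Proof.
move=> fV hV n; exists (free_res nA fV), (free_res_d nA fV), (cover (nth_syzygy nA fV 0)).
split; first exact: free_res_projective.
have hS k : forall j, (0 < j)%N -> Ext0 d j (fgmod_sort (nth_syzygy nA fV k)).
  elim: k => // k IH j j0.
  have /(_ j) hs := Ext0_sub Xinj d_d (ses_syzygy (nth_syzygy nA fV k)).
  apply: hs; last exact: IH.
    by case: j j0 => // j _; apply: Ext0_rv.
move=> f f0.
have [u uP] : exists u : {linear fgmod_sort (nth_syzygy nA fV n.+1) -> A^o}, forall x, u (cover _ x) = f x.
  apply: lin_factor_surj; first exact: cover_surj.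
  move=> y y0; have [_ cE _] := ses_syzygy (nth_syzygy nA fV n.+1).
  have [w wy] := (cE y).1 y0; have [t tw] := cover_surj (V := nth_syzygy nA fV n.+2) w.
  by rewrite -wy -tw; apply: f0.
have [v vP] := Ext1_extend u (ses_syzygy (nth_syzygy nA fV n)) (hS n 1%N isT).
by exists v => y; rewrite -uP -vP.
Qed.

End FiniteInjectiveDimension.

Section GorensteinDim1.
Variables (A : comPzRingType) (m : ideal A).
Hypotheses (gA : gorenstein_local m) (dimA : krull_dim A 1).

(** The last two conditions say that z represents a nonzero element of the socle of A/xA. *)
Definition good_pair (x z : A) :=
  [/\ x \in m, regular_elt x, z \notin limage (scalel A^o x)
    & forall a, a \in m -> a * z \in limage (scalel A^o x)].

Definition torsionfree (x : A) (V : lmodType A) := injective (scalel V x).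

(** All that later parts draw from the injective resolution. The last clause is Ext^1(W, A) = 0 in
    the form in which it is applied. *)
Theorem gorenstein_dim1 : exists x z, [/\ good_pair x z,
  forall V : lmodType A, fg V -> torsionfree x V -> forall n, Ext_succ_eq0 n V A^o
  & forall (U V W : lmodType A) (f : {linear U -> V}) (g : {linear V -> W})
      (u : {linear U -> A^o}), ses f g -> fg W -> torsionfree x W ->
      exists v : {linear V -> A^o}, forall y, v (f y) = u y].
Proof.
case: gA => lm nA [E [e [dE [Einj eI eE dEE [N NP]]]]].
pose X n : lmodType A := if n is n'.+1 then E n' else 'rV[A]_0.
pose d n : {linear X n -> X n.+1} :=
  match n return {linear X n -> X n.+1} with 0%N => \0%R | n'.+1 => dE n' end.
have Xinj n : injective_module (X n).
  case: n => // U V u f uI; exists \0%R => y; apply/rowP => -[]; by [].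
have X0 (y : X 0%N) : y = 0 by apply/rowP => -[].
have Xtop : exists N, forall n, (N < n)%N -> forall y : X n, y = 0.
  by exists N.+1 => -[//|n] nN; apply: NP.
have dXE n : exact_at (d n.+1) (d n.+2) by exact: dEE.
have [x xm xreg] := ex_regular_max nA lm Xinj X0 eI eE dXE Xtop dimA.
have [z zx mz] := ex_socle nA lm dimA xm xreg.
have T V n := @Ext0_torsionfree _ nA _ lm X d e Xinj X0 eI eE dXE Xtop dimA x xm xreg n V.
exists x, z; split=> // [V fV xV|U V W f g u fgE fW xW].
  apply: (Ext0_Ext_succ_eq0 nA Xinj X0 eI eE dXE fV) => n n0; exact: T.
apply: (Ext1_extend Xinj X0 eI eE dXE u fgE); exact: T.
Qed.

End GorensteinDim1.

(** * The maximal ideal and its dual *)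

Section SocleAndDual.
Variables (A : comPzRingType) (m : ideal A) (x z : A).
Hypotheses (lm : local_ring m) (nA : noetherian A) (xz : good_pair m x z).
Hypothesis ext : forall (U V W : lmodType A) (f : {linear U -> V}) (g : {linear V -> W})
      (u : {linear U -> A^o}), ses f g -> fg W -> torsionfree x W ->
      exists v : {linear V -> A^o}, forall y, v (f y) = u y.

Notation xA := (limage (scalel A^o x)).

Let xm : x \in m. Proof. by case: xz. Qed.
Let xreg : regular_elt x. Proof. by case: xz. Qed.
Let zx : z \notin xA. Proof. by case: xz. Qed.
Let mz a : a \in m -> a * z \in xA. Proof. by case: xz => _ _ _; apply. Qed.

Lemma pidP (y : A) : reflect (exists a, x * a = y) (y \in xA).
Proof. exact: (limageP (scalel A^o x) y). Qed.

Let xregI (a b : A) : x * a = x * b -> a = b.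
Proof. exact: regularI. Qed.

Lemma ideal_torsionfree (J : ideal A) : torsionfree x (submod J).
Proof.
apply: lin_inj => v xv; apply: (@sincl_inj _ _ J).
rewrite linear0; apply: xreg.
by rewrite -[LHS](linZ (sincl J) x v) [x *: v]xv linear0.
Qed.

(* A/xA is self-injective; the extension of f is found by lifting f to J -> A. *)
Lemma quo_injective (J : ideal A) (xJ : x \in J) (f : {linear submod J -> qmod xA}) :
  f (Submod xJ) = 0 ->
  exists c, forall j, f j = qmod_pi xA (c * sincl J j).
Proof.
move=> fx.
(* P is the fibre product of A and J over A/xA, an extension of J by A through a |-> (xa, 0). It
   splits because J is torsionfree. *)
have kl : linear (fun p : A^o * submod J => qmod_pi xA p.1 - f p.2).
  by move=> a p q; rewrite !linearP /= addrACA scalerBr scalerN.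
pose P := lker (Lin kl).
have inP a j : qmod_pi xA a = f j -> (a, j) \in P.
  by move=> e; apply/lkerP; rewrite /= e subrr.
have il : linear (fun a : A^o => (x *: a, 0) : A^o * submod J).
  move=> a b c; rewrite scalerDr scaleC.
  by rewrite [RHS](_ : _ = (a *: (x *: b) + x *: c, a *: 0 + 0)) // scaler0 addr0.
have [|i iP] := lin_factor_inj (i := sincl P) (f := Lin il) (@sincl_inj _ _ _).
  move=> a; apply/sinclP/inP; rewrite linear0; apply/qmod_pi0/pidP; by exists a.
have p2l : linear (fun p : A^o * submod J => p.2) by [].
have p1l : linear (fun p : A^o * submod J => p.1) by [].
have PE p : qmod_pi xA (sincl P p).1 = f (sincl P p).2.
  by have /lkerP /eqP := sincl_in p; rewrite /= subr_eq0 => /eqP.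
have sesP : ses i (Lin p2l \o sincl P).
  split.
  - apply: lin_inj => a ia; apply: xreg.
    by have := iP a; rewrite ia linear0 => /(congr1 fst) /esym.
  - move=> p; split=> [/= p0|[a <-]]; last by exact: (congr1 snd (iP a)).
    have := PE p; rewrite [(sincl P p).2]p0 linear0 => /qmod_pi0/pidP[a ap].
    exists a; apply: (@sincl_inj _ _ P); rewrite iP /=.
    rewrite [RHS](surjective_pairing (sincl P p)) -ap; congr pair; exact/esym/p0.
  - move=> j; have [a ap] := qmod_pi_surj (f j).
    by exists (Submod (inP a j ap)).
have [v vP] := ext idfun sesP (fg_ideal nA J) (@ideal_torsionfree J).
(* The retraction v of P onto A makes a - x v(a, j) depend on j alone, which gives the lift of f. *)
have [F FP] : exists F : {linear submod J -> A^o}, forall p,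
    F (sincl P p).2 = (sincl P p).1 - x * v p.
  apply: (@lin_factor_surj _ _ _ _ (Lin p2l \o sincl P)
     ((Lin p1l \o sincl P) \- (scalel A^o x \o v))) => [|p p0]; first by case: sesP.
  have [_ iE _] := sesP; have [a <-] := (iE p).1 p0.
  rewrite [LHS](_ : _ = (sincl P (i a)).1 - x * v (i a)) // iP vP; exact: subrr.
have Ff j : qmod_pi xA (F j) = f j.
  have [a ap] := qmod_pi_surj (f j); have := FP (Submod (inP a j ap)).
  rewrite -[sincl P _]/(a, j) /= => ->; rewrite linearB /= ap.
  rewrite [X in _ - X](qmod_pi0 xA _).2 ?subr0 //; apply/pidP; by eexists.
have /qmod_pi0/pidP[c cx] : qmod_pi xA (F (Submod xJ)) = 0 by rewrite Ff.
exists c => j; rewrite -Ff; congr qmod_pi; apply: xregI.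
(* As f(x) = 0, F(x) is divisible by x, and x F(j) = j F(x) makes F a multiplication. *)
have -> : x * F j = sincl J j * F (Submod xJ).
  rewrite -[LHS](linZ F x j) -[RHS](linZ F (sincl J j) (Submod xJ)); congr (F _).
  by apply: (@sincl_inj _ _ J); rewrite !linZ; apply: mulrC.
by rewrite -cx mulrCA; congr (_ * _); apply: mulrC.
Qed.

(* The map [z |-> u] from zA + xA to A/xA extends to A/xA by self-injectivity. *)
Lemma socle_gen (u : A) : (forall a, a \in m -> a * u \in xA) ->
  exists c b, u = c * z + x * b.
Proof.
move=> mu.
have pl : linear (fun p : A^o * A^o => p.1 *: (z : A^o) + p.2 *: (x : A^o)).
  by move=> a p q /=; rewrite !scalerDl -!scalerA scalerDr addrACA.
pose J := limage (Lin pl).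
have zJ : z \in J by apply/limageP; exists (1, 0); rewrite /= scale1r scale0r addr0.
have xJ : x \in J by apply/limageP; exists (0, 1); rewrite /= scale1r scale0r add0r.
have [|p pP] := lin_factor_inj (i := sincl J) (f := Lin pl) (@sincl_inj _ _ _).
  by move=> q; apply/sinclP/limageP; exists q.
have gl : linear (fun p : A^o * A^o => qmod_pi xA (p.1 *: (u : A^o))).
  by move=> a q r; rewrite -linearP /= scalerDl scalerA.
have [||f fP] := @lin_factor_surj _ _ _ _ p (Lin gl).
- move=> j; have /limageP[q qj] := sincl_in j; exists q.
  by apply: (@sincl_inj _ _ J); rewrite pP.
(* A relation q1 z + q2 x = 0 with q1 a unit would put z in xA, so q1 lies in m and kills u modulo
   x. *)
- move=> q q0; apply/qmod_pi0; apply: mu; apply: contrapT => /negP q1m.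
  have [y yq] := local_unit nA lm q1m.
  move/negP: zx; apply; apply/pidP; exists (- (y * q.2)).
  have /(congr1 (fun t : A => y * t)) : q.1 * z + q.2 * x = 0.
    by rewrite -[LHS]/(Lin pl q) -pP q0 linear0.
  rewrite mulr0 mulrDr mulrA yq mul1r => /eqP; rewrite addr_eq0 => /eqP ->.
  by rewrite mulrN mulrCA [x * _]mulrC.
have fx : f (Submod xJ) = 0.
  have -> : Submod xJ = p (0, 1).
    by apply: (@sincl_inj _ _ J); rewrite pP /= scale1r scale0r add0r.
  by rewrite fP /= scale0r linear0.
have [c cP] := quo_injective fx.
have := cP (Submod zJ).
have -> : Submod zJ = p (1, 0).
  by apply: (@sincl_inj _ _ J); rewrite pP /= scale1r scale0r addr0.
rewrite fP pP /= !scale1r scale0r addr0 => /qmod_piP /pidP[b be].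
by exists c, b; rewrite be addrC subrK.
Qed.

(* Both sides are r(uv). *)
Lemma dual_comm (J : ideal A) (r : {linear submod J -> A^o}) (u v : submod J) :
  sincl J u * r v = sincl J v * r u.
Proof.
rewrite -[LHS](linZ r (sincl J u) v) -[RHS](linZ r (sincl J v) u); congr (r _).
by apply: (@sincl_inj _ _ J); rewrite !linZ; apply: mulrC.
Qed.

Definition max_x : submod m := Submod xm.
Definition max_incl : dual (submod m) := sincl m.

(** This is multiplication by z/x, written without fractions. *)
Lemma ex_max_phi : exists phi : dual (submod m), forall v,
  x * (phi : {linear submod m -> A^o}) v = sincl m v * z.
Proof.
have tl : linear (fun v => sincl m v * z : A^o).
  by move=> a u v; rewrite linearP mulrDl -[a *: _]/(a * _) -mulrA.
have [||phi phiP] := lin_factor_inj (i := scalel A^o x) (f := Lin tl).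
- exact/lin_inj/xreg.
- by move=> v; apply/limageP/mz/sincl_in.
by exists phi => v; rewrite -[RHS]phiP.
Qed.

(** A functional is determined by u = r(x), since x r(v) = v u, and u lies in (xA : m), where
    [socle_gen] applies. *)
Lemma max_dual_gen (phi : dual (submod m)) (r : {linear submod m -> A^o}) :
  (forall v, x * (phi : {linear submod m -> A^o}) v = sincl m v * z) ->
  exists a b, forall v,
    r v = a * sincl m v + b * (phi : {linear submod m -> A^o}) v.
Proof.
move=> phiP.
have [a am|c [b e]] := @socle_gen (r max_x).
  apply/pidP; exists (r (Submod am)); rewrite -[x]/(sincl m max_x).
  exact: dual_comm.
exists b, c => v; apply: xregI.
rewrite [LHS](dual_comm r max_x v) e mulrDr mulrCA -phiP.
by rewrite mulrDr [LHS]addrC; congr (_ + _); ring.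
Qed.

Lemma fg_max : fg (submod m). Proof. exact: fg_ideal. Qed.

Lemma dual_torsionfree (V : lmodType A) : torsionfree x (dual V).
Proof.
apply: lin_inj => f xf; apply: Hom_ext => v; apply: xreg.
by rewrite -[RHS](_ : ((x *: f : dual V) : {linear V -> A^o}) v = 0) // [x *: f]xf.
Qed.

(** In the dual, x r = r(x) times the inclusion, so a functional xi on it is determined by its value
    a at the inclusion, and is evaluation at a if a lies in m. Were a a unit, x xi(phi) = z a would
    put z in xA. *)
Lemma max_bidual : bijective (@bidual_eval A (submod m)).
Proof.
have [phi phiP] := ex_max_phi.
apply: inj_surj_bij => [u v|xi].
  move=> /(congr1 (fun f : dual (dual (submod m)) =>
    (f : {linear dual (submod m) -> A^o}) max_incl)).
  exact: (@sincl_inj _ _ m).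
pose xi' := (xi : {linear dual (submod m) -> A^o}).
have xiE (r : dual (submod m)) : x * xi' r = (r : {linear submod m -> A^o}) max_x * xi' max_incl.
  rewrite -[LHS](linZ xi') -[RHS](linZ xi'); congr (xi' _).
  apply: Hom_ext => v; exact: etrans (dual_comm (r : {linear submod m -> A^o}) max_x v) (mulrC _ _).
have am : xi' max_incl \in m.
  apply: contrapT => /negP /(local_unit nA lm)[y ya].
  have phix : (phi : {linear submod m -> A^o}) max_x = z by apply: xregI; apply: phiP.
  move/negP: zx; apply; apply/pidP; exists (y * xi' phi).
  by rewrite mulrCA xiE phix mulrCA ya mulr1.
exists (Submod am); apply: Hom_ext => r; apply: xregI.
rewrite [RHS]xiE [RHS]mulrC.
exact: (dual_comm (r : {linear submod m -> A^o}) max_x (Submod am)).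
Qed.

Lemma max_stably_reflexive :
  (forall V : lmodType A, fg V -> torsionfree x V -> forall n, Ext_succ_eq0 n V A^o) ->
  stably_reflexive (submod m).
Proof.
move=> E; split; first exact: max_bidual.
move=> n; split; apply: E.
- exact: fg_max.
- exact: ideal_torsionfree.
- exact/fg_dual/fg_max.
- exact: dual_torsionfree.
Qed.

Lemma tpairing_balanced (V : lmodType A) :
  balanced (fun (u : V) (rho : dual V) => (rho : {linear V -> A^o}) u).
Proof.
split=> [u v r|u r r'|a u r] //; first exact: linearD.
exact: linZ.
Qed.

Lemma tpairing_tens (V : lmodType A) (u : V) (r : {linear V -> A^o}) :
  tpairing (tens u (r : dual V)) = r u.
Proof. exact: (tlift_tens _ _ (tpairing_balanced V)). Qed.

Lemma tpairingD (V : lmodType A) (t t' : tensor V (dual V)) :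
  tpairing (t + t') = tpairing t + tpairing t'.
Proof. exact: (tliftD _ _ (tpairing_balanced V)). Qed.

Lemma max_in_pairing a : a \in m -> exists t : tensor (submod m) (dual (submod m)), tpairing t = a.
Proof.
by move=> am; exists (tens (Submod am) max_incl); rewrite tpairing_tens.
Qed.

Hypothesis dimA : krull_dim A 1.

(** Comparison of dimensions leaves a single parameter. It divides x, hence is regular, and m is
    free on it with coordinate b. *)
Lemma regular_gen : regular_local m ->
  exists u, exists2 b : {linear submod m -> A^o}, b u = 1 & forall v, v = b v *: u.
Proof.
case=> _ _ [n [s [nA' ms]]].
have n1 : n = 1%N.
  have [[p pP] le1] := dimA; have [[q qP] len] := nA'.
  by apply/eqP; rewrite eqn_leq (le1 _ _ qP) (len _ _ pP).
move: s nA' ms; rewrite n1 => s _ ms; pose b0 : A := tnth s ord0.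
have msb v : v \in m <-> exists a, a * b0 = v.
  rewrite ms; split=> [|[a <-]]; last first.
    by apply: idealMl; apply: sub_span; apply: mem_tnth.
  move=> /(span_min (N := limage (mulvec (b0 : A^o)))) h.
  apply/(limageP (mulvec (b0 : A^o)))/h => w /tnthP[i ->].
  by apply/limageP; exists 1; rewrite (ord1 i); apply: mul1r.
have b0m : b0 \in m by apply/msb; exists 1; rewrite mul1r.
have b0I : injective (mulvec (b0 : A^o)).
  apply: lin_inj => y yb0; apply: xreg; have [a <-] := (msb x).1 xm.
  by rewrite -mulrA [b0 * y]mulrC [y * _]yb0 mulr0.
have [|b bP] := lin_factor_inj (f := sincl m) b0I.
  by move=> v; have [a av] := (msb _).1 (sincl_in v); exists a.
exists (Submod b0m), b => [|v]; last exact/(@sincl_inj _ _ m)/esym/bP.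
by apply: b0I; rewrite bP; apply/esym/mul1r.
Qed.

(** If r(u) were a unit, v r(u) = u r(v) would make u generate m, so that A would be regular. *)
Lemma nonregular_pairing (r : {linear submod m -> A^o}) u :
  ~ regular_local m -> r u \in m.
Proof.
move=> nreg; apply: contrapT => /negP /(local_unit nA lm)[y yr]; apply: nreg.
split=> //; exists 1%N, [tuple of [:: sincl m u : A^o]]; split=> // v.
apply/idP/idP => [vm|]; last first.
  by apply: span_min => w; rewrite inE => /eqP ->; apply: sincl_in.
have -> : v = (y * r (Submod vm)) * sincl m u.
  by rewrite -mulrA [r _ * _]mulrC dual_comm mulrCA yr mulr1.
by apply: idealMl; apply: sub_span; apply: mem_head.
Qed.

Lemma pairing_regular : regular_local m ->
  forall a, exists t : tensor (submod m) (dual (submod m)), tpairing t = a.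
Proof.
move=> /regular_gen[u [b bu _]] a.
exists (tens (a *: u) (b : dual (submod m))).
by rewrite tpairing_tens linZ bu; apply: mulr1.
Qed.

Lemma pairing_nonregular : ~ regular_local m ->
  forall a, (exists t : tensor (submod m) (dual (submod m)), tpairing t = a) <-> a \in m.
Proof.
move=> nreg a; split=> [[t <-]|/max_in_pairing//].
move: t; apply: tensor_ind => [|u r t IH].
  rewrite /tpairing tlift0; [exact: (rpred0 m)|exact: tpairing_balanced].
by rewrite tpairingD; apply: idealD => //; rewrite tpairing_tens; apply: nonregular_pairing.
Qed.

(** * Dimension of the reduced dual *)

Section ResidueBaseChange.
Variables (K : comPzRingType) (g : {rmorphism A -> K}).

(** For a minimal family of generators all relations vanish in K, so coordinates become well defined
    after g. *)
Lemma base_change_free (V : lmodType A) n (v : 'I_n -> V) : surj g ->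
  surj (rvmap v) -> (forall u, rvmap v u = 0 -> forall i, g (u 0 i) = 0) ->
  lmod_iso (base_change g V) 'rV[K]_n.
Proof.
move=> gS vS v0.
have gl : linear (fun u : 'rV[A]_n => \row_i g (u 0 i) : restr g 'rV[K]_n).
  by move=> a y y'; apply/rowP => i; rewrite !mxE rmorphD rmorphM.
have [|c cP] := @lin_factor_surj _ _ _ _ (rvmap v) (Lin gl) vS.
  by move=> u /v0 u0; apply/rowP => i; rewrite !mxE.
pose F0 (y : V) (k : restr g K^o) : 'rV[K]_n := (k : K) *: (c y : 'rV[K]_n).
have F0b : balanced F0.
  split=> [y y' k|y k k'|a y k]; rewrite /F0.
  - by rewrite linearD; apply: scalerDr.
  - exact: scalerDl.
  - by rewrite linZ restr_scaleE scalerA mulrC.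
pose F : base_change g V -> 'rV[K]_n := tlift F0.
have FD t t' : F (t + t') = F t + F t' by exact: tliftD.
have Ft y (k : K) : F (tens y (k : restr g K^o)) = k *: (c y : 'rV[K]_n) by exact: tlift_tens.
have Fl : linear F.
  move=> a t t'; rewrite FD; congr (_ + _).
  move: t; apply: tlift_ext => [t1 t2|t1 t2|y k].
  - by rewrite scalerDr FD.
  - by rewrite FD scalerDr.
  - by rewrite [a *: _](bc_scale_tens g a y k) !Ft scalerA.
pose G (w : 'rV[K]_n) : base_change g V := \sum_i tens (v i) (w 0 i : restr g K^o).
have cv i : c (v i) = \row_j (i == j)%:R :> 'rV[K]_n.
  rewrite -(rvmap_delta v) cP; apply/rowP => j; rewrite !mxE eqxx /=.
  by rewrite eq_sym; case: eqP => _; rewrite ?rmorph1 ?rmorph0.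
exists (Lin Fl), G => [|w] /=; last first.
  rewrite /G -[F _]/(Lin Fl _) linear_sum; apply/rowP => j; rewrite summxE (bigD1 j) //=.
  rewrite Ft cv !mxE eqxx mulr1 big1 ?addr0 // => i ij.
  by rewrite Ft cv !mxE (negPf ij) mulr0.
have GD w w' : G (w + w') = G w + G w'.
  by rewrite /G -big_split; apply: eq_bigr => i _; rewrite mxE; apply: tensDr.
apply: tlift_ext => [t t'|//|y k]; first by rewrite FD GD.
have [u <-] := vS y; rewrite Ft cP /G.
have tl : linear (fun y : V => tens y (k : restr g K^o)).
  by move=> a y1 y2; rewrite tensDl -tensor_scale_tens.
rewrite [RHS](linear_sum (Lin tl)); apply: eq_bigr => i _.
by rewrite -[RHS]/(tens _ _) tensZ !mxE restr_scaleE mulrC.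
Qed.

Hypotheses (gS : surj g) (gm : forall a, a \in m -> g a = 0).

Lemma dual_max_regular : regular_local m ->
  lmod_iso (base_change g (dual (submod m))) 'rV[K]_1.
Proof.
move=> /regular_gen[u [b bu bE]].
have bl (r : dual (submod m)) : r = ((r : {linear submod m -> A^o}) u : A) *: (b : dual (submod m)).
  by apply: Hom_ext => v; rewrite {1}(bE v) linZ; apply: mulrC.
apply: (@base_change_free (dual (submod m)) 1 (fun _ => b)) => // [r|w].
  exists (\row_i ((r : {linear submod m -> A^o}) u : A)).
  by rewrite [LHS]big_ord1 mxE -bl.
rewrite [rvmap _ _]big_ord1 => wb i; rewrite (ord1 i).
have -> : w 0 0 = ((w 0 0 *: (b : dual (submod m)) : dual (submod m)) : {linear submod m -> A^o}) u.
  by rewrite -[RHS]/(w 0 0 * b u) bu mulr1.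
by rewrite wb rmorph0.
Qed.

Lemma dual_max_nonregular : ~ regular_local m ->
  lmod_iso (base_change g (dual (submod m))) 'rV[K]_2.
Proof.
move=> nreg; have [phi phiP] := ex_max_phi.
pose v (i : 'I_2) : dual (submod m) := if i == 0 then max_incl else phi.
have vE (w : 'rV[A]_2) y : (rvmap v w : {linear submod m -> A^o}) y =
    w 0 0 * sincl m y + w 0 1 * (phi : {linear submod m -> A^o}) y.
  have e : rvmap v w = w 0 0 *: (max_incl : dual (submod m)) + w 0 1 *: phi.
    rewrite [LHS]big_ord_recl big_ord1; congr (_ + w 0 _ *: _); exact: val_inj.
  by rewrite e.
apply: (@base_change_free (dual (submod m)) 2 v) => // [r|w w0].
  have [a [b abP]] := max_dual_gen (r : {linear submod m -> A^o}) phiP.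
  exists (\row_i (if i == 0 then a else b)); apply: Hom_ext => y.
  by rewrite vE !mxE abP.
have phix : (phi : {linear submod m -> A^o}) max_x = z by apply: xregI; apply: phiP.
have e y : w 0 0 * sincl m y + w 0 1 * (phi : {linear submod m -> A^o}) y = 0.
  by rewrite -vE w0.
have w1m : w 0 1 \in m.
  apply: contrapT => /negP /(local_unit nA lm)[y yw].
  move/negP: zx; apply; apply/pidP; exists (- (y * w 0 0)).
  have /(congr1 (fun t : A => y * t)) := e max_x.
  rewrite mulr0 mulrDr phix !mulrA yw mul1r => /eqP.
  by rewrite addrC addr_eq0 => /eqP ->; rewrite mulrN mulrC.
have w0m : w 0 0 \in m.
  apply: contrapT => /negP w0m; move/negP: (w0m); apply.
  (* With z = phi(x), the relation at x reads x w0 = - w1 phi(x) = - x phi(w1), and x can be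
     cancelled. *)
  have -> : w 0 0 = - (phi : {linear submod m -> A^o}) (Submod w1m).
    apply: xregI; have /eqP := e max_x; rewrite addr_eq0 [w 0 0 * _]mulrC => /eqP ->.
    rewrite mulrN; congr (- _).
    exact: (dual_comm (phi : {linear submod m -> A^o}) (Submod w1m) max_x).
  by apply: submod_oppr; apply: nonregular_pairing.
move=> i; apply: gm; have [->|->] : i = 0 \/ i = 1 => //.
by case: i => -[|[|//]] h; [left|right]; apply: val_inj.
Qed.

End ResidueBaseChange.

End SocleAndDual.

(** * Flat base change *)

Section FlatBaseChange.
Variables (S R : comPzRingType) (h : {rmorphism S -> R}).
Implicit Types (N : lmodType S).

Local Notation G := (base_change h).

Definition pure N (v : N) (r : R) : G N := tens v (r : restr h R^o).

Lemma pureDl N (v v' : N) r : pure (v + v') r = pure v r + pure v' r.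
Proof. exact: tensDl. Qed.

Lemma pureDr N (v : N) r r' : pure v (r + r') = pure v r + pure v r'.
Proof. exact: tensDr. Qed.

Lemma pure_scale N (v : N) a r : a *: pure v r = pure v (a * r).
Proof. exact: (bc_scale_tens h a v r). Qed.

Lemma pureZ N s (v : N) r : pure (s *: v) r = pure v (h s * r).
Proof. exact: tensZ. Qed.

Lemma pure0l N r : pure (0 : N) r = 0.
Proof. by apply: (addIr (pure (0 : N) r)); rewrite -pureDl !add0r. Qed.

Lemma pure0r N (v : N) : pure v 0 = 0.
Proof. by apply: (addIr (pure v 0)); rewrite -pureDr !add0r. Qed.

Lemma pureB N (v : N) r r' : pure v (r - r') = pure v r - pure v r'.
Proof. by rewrite pureDr -mulN1r -pure_scale scaleN1r. Qed.

Lemma pure_suml N n (c : 'I_n -> S) (v : 'I_n -> N) r :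
  pure (\sum_i c i *: v i) r = \sum_i pure (c i *: v i) r.
Proof.
by apply: (big_morph (fun v => pure v r)) => [u u'|]; [exact: pureDl|exact: pure0l].
Qed.

Lemma pure_ind N (F : G N -> Prop) : F 0 -> (forall v r t, F t -> F (pure v r + t)) ->
  forall t, F t.
Proof. exact: (@tensor_ind S N (restr h R^o) F). Qed.

Lemma pure_linear_ext N (V : lmodType R) (f g : {linear G N -> V}) :
  (forall v r, f (pure v r) = g (pure v r)) -> f =1 g.
Proof.
by move=> fg; apply: tlift_ext => // t u; apply: linearD.
Qed.

Section Map.
Variables (N1 N2 : lmodType S) (f : {linear N1 -> N2}).

Lemma Gmap_balanced : balanced (fun (v : N1) (r : restr h R^o) => tens (f v) (idfun r)).
Proof.
split=> [v v' r|v r r'|a v r] /=.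
- by rewrite linearD tensDl.
- exact: tensDr.
- by rewrite linZ tensZ.
Qed.

Definition Gmap_fun : G N1 -> G N2 := tmap f (idfun : {linear restr h R^o -> restr h R^o}).

Lemma Gmap_fun_pure v r : Gmap_fun (pure v r) = pure (f v) r.
Proof. exact: (tlift_tens _ _ Gmap_balanced). Qed.

Lemma Gmap_funD t u : Gmap_fun (t + u) = Gmap_fun t + Gmap_fun u.
Proof. exact: (tliftD _ _ Gmap_balanced). Qed.

Lemma Gmap_linear : linear Gmap_fun.
Proof.
move=> a t u; rewrite Gmap_funD; congr (_ + _).
move: t; apply: tlift_ext => [t1 t2|t1 t2|v r].
- by rewrite scalerDr Gmap_funD.
- by rewrite Gmap_funD scalerDr.
- by rewrite -[tens v r]/(pure v r) pure_scale !Gmap_fun_pure pure_scale.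
Qed.

Definition Gmap : {linear G N1 -> G N2} := Lin Gmap_linear.

Lemma Gmap_pure v r : Gmap (pure v r) = pure (f v) r.
Proof. exact: Gmap_fun_pure. Qed.

End Map.

Lemma Gmap_comp N1 N2 N3 (f : {linear N1 -> N2}) (g : {linear N2 -> N3}) (k : {linear N1 -> N3}) t :
  (forall v, k v = g (f v)) -> Gmap k t = Gmap g (Gmap f t).
Proof.
move=> kE; apply: (pure_linear_ext (f := Gmap k) (g := Gmap g \o Gmap f)) => v r.
by rewrite -[RHS]/(Gmap g (Gmap f (pure v r))) !Gmap_pure kE.
Qed.

Lemma Gmap_scalel N s t : Gmap (scalel N s) t = h s *: t.
Proof.
apply: (pure_linear_ext (f := Gmap (scalel N s)) (g := scalel (G N) (h s))) => v r.
by rewrite Gmap_pure [RHS]/= pure_scale -pureZ.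
Qed.

Lemma G_zero N : (forall v : N, v = 0) -> forall t : G N, t = 0.
Proof.
move=> N0; apply: pure_ind => // v r t ->.
by rewrite (N0 v) pure0l addr0.
Qed.

Lemma fg_G N : fg N -> fg (G N).
Proof.
move=> [n [p pS]]; exists n, (rvmap (fun i => pure (p (delta_mx 0 i)) 1)) => t.
suff /limageP : t \in limage (rvmap (fun i => pure (p (delta_mx 0 i)) 1)) by [].
move: t; apply: pure_ind => [|v r t tL]; first exact: rpred0.
apply: rpredD => //; have [u <-] := pS v.
rewrite [u]row_sum_delta linear_sum.
under eq_bigr do rewrite linZ.
rewrite pure_suml; apply: rpred_sum => i _; rewrite pureZ -[_ * r]mulr1 -pure_scale.
apply: rpredZ; apply/limageP; exists (delta_mx 0 i); exact: rvmap_delta.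
Qed.

Lemma eps_balanced : balanced (fun (s : S^o) (r : restr h R^o) => h s * r : R).
Proof.
split=> [s s' r|s r r'|a s r].
- by rewrite rmorphD mulrDl.
- exact: mulrDr.
- by rewrite rmorphM -[RHS]/(h s * (h a * r)) mulrCA mulrA.
Qed.

Definition eps_fun : G S^o -> R^o := tlift (fun (s : S^o) (r : restr h R^o) => h s * r : R).

Lemma eps_fun_pure s r : eps_fun (pure s r) = h s * r.
Proof. exact: (tlift_tens _ _ eps_balanced). Qed.

Lemma eps_linear : linear eps_fun.
Proof.
have epsD t u : eps_fun (t + u) = eps_fun t + eps_fun u by exact: (tliftD _ _ eps_balanced).
move=> a t u; rewrite epsD; congr (_ + _).
move: t; apply: tlift_ext => [t1 t2|t1 t2|v r].
- by rewrite scalerDr epsD.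
- by rewrite epsD scalerDr.
- by rewrite -[tens v r]/(pure v r) pure_scale !eps_fun_pure mulrCA.
Qed.

Definition eps : {linear G S^o -> R^o} := Lin eps_linear.

Lemma eps_pure s r : eps (pure s r) = h s * r.
Proof. exact: eps_fun_pure. Qed.

Lemma pure1_eps t : pure (1 : S^o) (eps t) = t.
Proof.
have l : linear (fun r : R^o => pure (1 : S^o) r).
  by move=> a r r'; rewrite pureDr pure_scale.
apply: (pure_linear_ext (f := Lin l \o eps) (g := idfun)) => s r.
by rewrite -[LHS]/(pure (1 : S^o) (eps (pure s r))) eps_pure -pureZ; congr pure; apply: mulr1.
Qed.

Lemma eps_pure1 r : eps (pure (1 : S^o) r) = r.
Proof. by rewrite eps_pure rmorph1 mul1r. Qed.

Hypothesis hflat : flat_hom h.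

Lemma Gmap_exact N1 N2 N3 (f : {linear N1 -> N2}) (g : {linear N2 -> N3}) :
  exact_at f g -> exact_at (Gmap f) (Gmap g).
Proof. exact: hflat. Qed.

Lemma Gmap_ses N1 N2 N3 (f : {linear N1 -> N2}) (g : {linear N2 -> N3}) :
  ses f g -> ses (Gmap f) (Gmap g).
Proof.
case=> fI fgE gS; split.
(* Flatness speaks of exactness at a middle term only; injectivity and surjectivity are exactness
   next to the zero module of rows of length 0. *)
- have e : exact_at (\0%R : {linear 'rV[S]_0 -> N1}) f.
    move=> v; split=> [fv0|[u <-]]; last by rewrite linear0.
    by exists 0; rewrite linear0 (inj0 fI fv0).
  apply: lin_inj => t /(Gmap_exact e)[u <-].
  rewrite (@G_zero 'rV[S]_0 _ u) ?linear0 // => v; by apply/rowP => -[].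
- exact: Gmap_exact.
- have e : exact_at g (\0%R : {linear N3 -> 'rV[S]_0}).
    by move=> v; split=> // _; apply: gS.
  move=> t; apply/(Gmap_exact e); apply: G_zero => v; by apply/rowP => -[].
Qed.

End FlatBaseChange.

Arguments Gmap : simpl never.
Arguments eps : simpl never.

(** * The socle of R/xR in a flat family *)

Section Family.
Variables (S R A : comPzRingType) (h : {rmorphism S -> R}) (pi : {rmorphism R -> S}).
Variables (rho : {rmorphism R -> A}) (mS : ideal S) (mR : ideal R) (mA : ideal A).
Variables (x z0 : R).
Implicit Types (N : lmodType S).
Hypotheses (lS : local_ring mS) (lR : local_ring mR) (nS : noetherian S) (nR : noetherian R).
Hypotheses (hflat : flat_hom h) (hK : cancel h pi).
Hypothesis h_local : forall s, s \in mS -> h s \in mR.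
Hypothesis rho_surj : surj rho.
(** This identifies N (x) R with A for every N isomorphic to k, elementwise, so that the same
    hypothesis covers any model of the residue field. *)
Hypothesis rhoP : forall (N : lmodType S) (v : N), surj (mulvec v) -> ann v =i mS ->
  forall r, pure h v r = 0 <-> rho r = 0.
Hypothesis mAP : forall r, (rho r \in mA) = (pi r \in mS).

Notation I := (kernel pi : ideal R).
Notation G := (base_change h).
Notation xA := (limage (scalel A^o (rho x))).

Hypothesis xI : x \in I.
Hypothesis xz : good_pair mA (rho x) (rho z0).
Hypothesis xA_inj : forall (xm : rho x \in mA) (f : {linear submod mA -> qmod xA}),
  f (Submod xm) = 0 -> exists c, forall j, f j = qmod_pi xA (c * sincl mA j).

Hypothesis socle : forall u : A, (forall a, a \in mA -> a * u \in xA) ->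
  exists c b, u = c * rho z0 + rho x * b.

Lemma kernelP r : reflect (pi r = 0) (r \in I).
Proof. exact: eqP. Qed.

Lemma sub_pi_ker r : r - h (pi r) \in I.
Proof. by apply/kernelP; rewrite rmorphB hK subrr. Qed.

Lemma rho_h_max s : s \in mS -> rho (h s) = 0.
Proof.
move=> sm.
have vS : surj (mulvec (qmod_pi mS (1 : S^o))).
  by elim/qmod_ind => s'; exists s'; rewrite /= -linZ /=; congr qmod_pi; apply: mulr1.
have vm : ann (qmod_pi mS (1 : S^o)) =i mS.
  move=> a; rewrite -[X in qmod_pi _ X]/(1 : S).
  have e : a *: qmod_pi mS (1 : S^o) = qmod_pi mS a.
    by rewrite -linZ /=; congr qmod_pi; apply: mulr1.
  by apply/annP/idP; rewrite e => /qmod_pi0.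
apply/(rhoP vS vm); rewrite -[h s]mulr1 -pureZ.
by rewrite (annP _ _ _) ?pure0l // vm.
Qed.

Definition residue_mod : lmodType S := qmod mS.
Definition residue_gen : residue_mod := qmod_pi mS (1 : S^o).

Lemma residue_genE (s : S) : s *: residue_gen = qmod_pi mS (s : S^o).
Proof. by rewrite -linZ /=; congr qmod_pi; apply: mulr1. Qed.

Lemma residue_gen_surj : surj (mulvec residue_gen).
Proof. by elim/qmod_ind => s; exists s; rewrite -[LHS]/(s *: residue_gen) residue_genE. Qed.

Lemma residue_gen_ann : ann residue_gen =i mS.
Proof. by move=> a; apply/annP/idP; rewrite residue_genE => /qmod_pi0. Qed.

Lemma simple_pure (N : lmodType S) (v : N) : surj (mulvec v) ->
  forall u : G N, exists r, u = pure h v r.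
Proof.
move=> vS; apply: pure_ind => [|w r t [r' ->]]; first by exists 0; rewrite pure0r.
have [s <-] := vS w; exists (h s * r + r').
by rewrite pureDr -pureZ.
Qed.

(* The kernel of [rho] is [mS R], which meets I in [mS I]. *)
Lemma ker_rho_ind (i : R) (P : R -> Prop) :
  i \in I -> rho i = 0 -> P 0 -> (forall a b, P a -> P b -> P (a + b)) ->
  (forall s r, s \in mS -> r \in I -> P (h s * r)) -> P i.
Proof.
move=> iI i0 P0 PD PZ.
(* The S-linear projection r - h(pi r) onto I carries a sum of products h s * c to a sum of elements
   h s * i with i in I. *)
suff H r : rho r = 0 -> P (r - h (pi r)).
  by have := H i i0; rewrite (kernelP _ iI) rmorph0 subr0.
move=> /(rhoP residue_gen_surj residue_gen_ann) r0.
have [_ kE _] := Gmap_ses hflat (ses_qmod mS).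
have [t tr] : exists t, Gmap h (sincl mS) t = pure h (1 : S^o) r.
  by apply/kE; rewrite Gmap_pure.
have -> : r = eps h (Gmap h (sincl mS) t) by rewrite tr eps_pure1.
move: t {tr}; apply: pure_ind => [|s c t IH].
  by rewrite !linear0 !rmorph0 subr0.
rewrite !linD Gmap_pure eps_pure !rmorphD opprD addrACA.
apply: PD IH; rewrite !rmorphM hK -mulrBr.
by apply: PZ; [apply: sincl_in|apply: sub_pi_ker].
Qed.

Lemma pure_rho (N : lmodType S) (v : N) r r' : surj (mulvec v) -> ann v =i mS ->
  rho r = rho r' -> pure h v r = pure h v r'.
Proof.
move=> vS vm e; apply/eqP; rewrite -subr_eq0 -pureB; apply/eqP.
by apply/(rhoP vS vm); rewrite rmorphB e subrr.
Qed.

(** On a simple N this is regularity of x on A, and devissage propagates it: an elementary form of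
    the local criterion of flatness. *)
Lemma G_regular (N : lmodType S) : fg N -> injective (scalel (G N) x).
Proof.
move: N; apply: (devissage nS lS).
- by move=> N N0; apply: lin_inj => t _; apply: G_zero.
- move=> N1 N2 N3 f g /(Gmap_ses hflat)[fI fgE gS] _ _ _ h1 h3.
  apply: lin_inj => u xu.
  have /fgE[w wu] : Gmap h g u = 0.
    by apply: (inj0 h3); rewrite -[LHS](linZ (Gmap h g)) [x *: u]xu linear0.
  rewrite -wu (_ : w = 0) ?linear0 //; apply: (inj0 h1); apply: (inj0 fI).
  by rewrite [LHS](linZ (Gmap h f)) wu.
- move=> N v vS vm; apply: lin_inj => u; have [r ->] := simple_pure vS u.
  rewrite [_ (pure h v r)]pure_scale => /(rhoP vS vm); rewrite rmorphM => e.
  by case: xz => _ xreg _ _; apply/(rhoP vS vm)/xreg.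
- move=> N y fN ym yI h3; apply: lin_inj => u xu.
  have [GyI GyE _] := Gmap_ses hflat (ses_limage yI).
  (* K vanishes in G(N/yN), so its elements are divisible by h y, and the quotients stay in K
     because h y is injective on G N. Hence K = h(y) K. *)
  pose K := lker (scalel (G N) x).
  suff H : forall k : submod K, k = 0.
    have uK : u \in K by apply/lkerP.
    by rewrite -[u]/(sincl K (Submod uK)) (H (Submod uK)) linear0.
  apply: (nakayama0 nR lR (y := h y)); [exact/(fg_submod nR)/fg_G|exact: h_local|].
  move=> k; have /lkerP xk := sincl_in k.
  have /GyE[k' k'P] : Gmap h (qmod_pi (limage (scalel N y))) (sincl K k) = 0.
    by apply: (inj0 h3); rewrite -[LHS](linZ (Gmap h _)) [x *: _]xk linear0.
  rewrite Gmap_scalel in k'P.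
  have k'K : k' \in K.
    apply/lkerP; apply: (inj0 GyI); rewrite Gmap_scalel.
    by rewrite /= scaleC k'P.
  exists (Submod k'K); apply: (@sincl_inj _ _ K); rewrite linZ; exact/esym/k'P.
Qed.

(** This is (R/xR) (x) N, obtained as a quotient of G N so that the results on G carry over. *)
Definition GmodX (N : lmodType S) : lmodType R := qmod (limage (scalel (G N) x)).
Definition GmodX_pi (N : lmodType S) : {linear G N -> GmodX N} := qmod_pi (limage (scalel (G N) x)).
Arguments GmodX_pi : simpl never.

Lemma GmodX_piP N u : GmodX_pi N u = 0 <-> exists w, u = x *: w.
Proof.
split=> [/qmod_pi0/limageP[w <-]|[w ->]]; first by exists w.
by apply/qmod_pi0/limageP; exists w.
Qed.

Lemma GmodX_pi_surj N : surj (GmodX_pi N). Proof. exact: qmod_pi_surj. Qed.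

Lemma GmodX_killed N (u : GmodX N) : x *: u = 0.
Proof. by have [w <-] := GmodX_pi_surj u; rewrite -linZ; apply/GmodX_piP; exists w. Qed.

Lemma fg_GmodX N : fg N -> fg (GmodX N).
Proof. by move=> fN; apply/fg_qmod/fg_G. Qed.

Lemma ex_GmodX_map N1 N2 (f : {linear N1 -> N2}) :
  exists F : {linear GmodX N1 -> GmodX N2}, forall u, F (GmodX_pi N1 u) = GmodX_pi N2 (Gmap h f u).
Proof.
apply: (@lin_factor_surj _ _ _ _ (GmodX_pi N1) (GmodX_pi N2 \o Gmap h f)); first exact: GmodX_pi_surj.
move=> u /GmodX_piP[w ->]; rewrite -[LHS]/(GmodX_pi N2 (Gmap h f (x *: w))) linZ.
by apply/GmodX_piP; exists (Gmap h f w).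
Qed.

Definition GmodX_map N1 N2 (f : {linear N1 -> N2}) : {linear GmodX N1 -> GmodX N2} := projT1 (cid (ex_GmodX_map f)).

Lemma GmodX_map_pi N1 N2 (f : {linear N1 -> N2}) u : GmodX_map f (GmodX_pi N1 u) = GmodX_pi N2 (Gmap h f u).
Proof. exact: (projT2 (cid (ex_GmodX_map f))). Qed.

Lemma GmodX_map_comp N1 N2 N3 (f : {linear N1 -> N2}) (g : {linear N2 -> N3}) (k : {linear N1 -> N3}) t :
  (forall v, k v = g (f v)) -> GmodX_map k t = GmodX_map g (GmodX_map f t).
Proof. by move=> kE; have [u <-] := GmodX_pi_surj t; rewrite !GmodX_map_pi (Gmap_comp _ kE). Qed.

(** The snake lemma for multiplication by x: injectivity on the left comes from x being regular on G
    N3. *)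
Lemma GmodX_map_ses N1 N2 N3 (f : {linear N1 -> N2}) (g : {linear N2 -> N3}) :
  fg N3 -> ses f g -> ses (GmodX_map f) (GmodX_map g).
Proof.
move=> f3 /(Gmap_ses hflat)[fI fgE gS].
have xI3 := G_regular f3.
split.
- apply: lin_inj => t; have [u <-] := GmodX_pi_surj t; rewrite GmodX_map_pi => /GmodX_piP[w uw].
  have /fgE[w' w'P] : Gmap h g w = 0.
    by apply: (inj0 xI3); rewrite -[LHS](linZ (Gmap h g)) -uw (exact0 _ fgE).
  by apply/GmodX_piP; exists w'; apply: fI; rewrite uw -w'P linZ.
- move=> t; split=> [|[t' <-]]; last first.
    have [u <-] := GmodX_pi_surj t'; by rewrite !GmodX_map_pi (exact0 _ fgE) linear0.
  have [u <-] := GmodX_pi_surj t; rewrite GmodX_map_pi => /GmodX_piP[w uw].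
  have [w' w'P] := gS w.
  have /fgE[v vP] : Gmap h g (u - x *: w') = 0 by rewrite linB uw linZ w'P subrr.
  have e : GmodX_pi _ (x *: w') = 0 by apply/GmodX_piP; exists w'.
  by exists (GmodX_pi _ v); rewrite GmodX_map_pi vP linB e subr0.
- move=> t; have [u <-] := GmodX_pi_surj t; have [w <-] := gS u.
  by exists (GmodX_pi _ w); rewrite GmodX_map_pi.
Qed.

Lemma GmodX_pi_simple (N : lmodType S) (v : N) r : surj (mulvec v) -> ann v =i mS ->
  GmodX_pi N (pure h v r) = 0 <-> rho r \in xA.
Proof.
move=> vS vm; split=> [/GmodX_piP[w wP]|/pidP[a ar]].
  have [r' r'w] := simple_pure vS w.
  have e : pure h v (r - x * r') = 0.
    by rewrite pureB wP r'w pure_scale subrr.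
  apply/pidP; exists (rho r'); apply/eqP; rewrite -rmorphM eq_sym -subr_eq0 -rmorphB.
  by apply/eqP/(rhoP vS vm).
have [r' r'P] := rho_surj a.
apply/GmodX_piP; exists (pure h v r'); rewrite pure_scale; apply: pure_rho => //.
by rewrite rmorphM r'P ar.
Qed.

Definition x_in_I : submod I := Submod xI.

Lemma rho_I (i : submod I) : rho (sincl I i) \in mA.
Proof. rewrite mAP (kernelP _ (sincl_in i)); exact: (rpred0 mS). Qed.

Lemma mA_lift (a : A) : a \in mA -> exists i : submod I, rho (sincl I i) = a.
Proof.
move=> am; have [r ra] := rho_surj a.
exists (Submod (sub_pi_ker r)); rewrite -ra -[sincl _ _]/(r - h (pi r)).
by rewrite rmorphB rho_h_max ?subr0 // -mAP ra.
Qed.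

Definition multiplication N (f : {linear submod I -> GmodX N}) :=
  exists c, forall i, f i = sincl I i *: c.

(** The kernel of I -> mA is mS I, and mS kills N, hence also [GmodX N]. *)
Lemma hom_ker_rho (N : lmodType S) (v : N) (f : {linear submod I -> GmodX N}) i :
  surj (mulvec v) -> ann v =i mS -> rho (sincl I i) = 0 -> f i = 0.
Proof.
move=> vS vm.
suff H r : r \in I -> rho r = 0 -> forall i, sincl I i = r -> f i = 0.
  by move=> i0; apply: H i0 _ (erefl _); apply: sincl_in.
move=> rI r0.
pose P r := exists2 i, sincl I i = r & f i = 0.
suff [j jr fj] : P r.
  by move=> {}i ir; rewrite -fj; congr (f _); apply: (@sincl_inj _ _ I); rewrite ir.
apply: (ker_rho_ind rI r0) => [|a b [j ja fj] [k kb fk]|s c sm cI].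
- by exists 0; rewrite linear0.
- by exists (j + k); rewrite linD ?ja ?kb ?fj ?fk ?addr0.
exists (h s *: (Submod cI : submod I)); first by [].
rewrite linZ; have [u <-] := GmodX_pi_surj (f (Submod cI)).
have [d ->] := simple_pure vS u.
rewrite -linZ pure_scale -pureZ (annP _ _ _) ?vm //.
by rewrite pure0l linear0.
Qed.

(** By [hom_ker_rho], f descends to a map mA -> A/xA vanishing at x, which is a multiplication by
    [xA_inj]. The relation Q carries f from R-modules to A-modules. *)
Lemma hom_simple (N : lmodType S) (v : N) (f : {linear submod I -> GmodX N}) :
  surj (mulvec v) -> ann v =i mS -> f x_in_I = 0 -> multiplication f.
Proof.
move=> vS vm fx.
have xm : rho x \in mA by case: xz.
pose Q (a : submod mA) (b : qmod xA) := exists i r,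
  [/\ rho (sincl I i) = sincl mA a, f i = GmodX_pi N (pure h v r) & b = qmod_pi xA (rho r)].
have Ql a y y' b b' : Q y b -> Q y' b' -> Q (a *: y + y') (a *: b + b').
  move=> [i [r [iy fi ->]]] [i' [r' [iy' fi' ->]]].
  have [c <-] := rho_surj a; exists (c *: i + i'), (c * r + r'); split.
  - by rewrite !linD !linZ rmorphD rmorphM iy iy'.
  - by rewrite linD linZ fi fi' -linZ -linD pure_scale -pureDr.
  - by rewrite rmorphD rmorphM -linZ -linD.
have Q0 b : Q 0 b -> b = 0.
  move=> [i [r [i0 fi ->]]]; apply/qmod_pi0/(GmodX_pi_simple r vS vm).
  by rewrite -fi; apply: (@hom_ker_rho N v f i vS vm); rewrite i0 linear0.
have [|F FP] := @lin_rel _ _ _ Q _ Ql Q0.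
  move=> y; have [i iy] := mA_lift (sincl_in y).
  have [u uf] := GmodX_pi_surj (f i); have [r ur] := simple_pure vS u.
  by exists (qmod_pi xA (rho r)), i, r; split=> //; rewrite -ur uf.
have F0 : F (Submod xm) = 0.
  have Qx : Q (Submod xm) 0.
    exists x_in_I, 0; split=> //; first by rewrite pure0r linear0.
    by rewrite rmorph0 linear0.
  have := Ql (-1) _ _ _ _ Qx (FP (Submod xm)).
  by rewrite !scaleN1r addNr oppr0 add0r => /Q0.
have [a aP] := xA_inj F0.
have [c ca] := rho_surj a.
exists (GmodX_pi N (pure h v c)) => i.
have [j [r [ji fj Fr]]] := FP (Submod (rho_I i)).
have -> : f i = f j.
  apply/eqP; rewrite -subr_eq0 -linB; apply/eqP/(@hom_ker_rho N v f _ vS vm).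
  by rewrite linB rmorphB ji subrr.
rewrite fj -(linZ (GmodX_pi N)) pure_scale; apply/eqP; rewrite -subr_eq0 -(linB (GmodX_pi N)); apply/eqP.
rewrite -pureB; apply/(GmodX_pi_simple _ vS vm); rewrite rmorphB rmorphM ca [_ * a]mulrC.
by apply/(qmod_piP xA); rewrite -Fr aP.
Qed.

(* This is Ext^1_{R/x}(S, G(N)/xG(N)) = 0. *)
Lemma hom_multiplication (N : lmodType S) : fg N ->
  forall f : {linear submod I -> GmodX N}, f x_in_I = 0 -> multiplication f.
Proof.
move: N; apply: (devissage nS lS).
- move=> N N0 f _; exists 0 => i; have [u <-] := GmodX_pi_surj (f i).
  by rewrite (G_zero N0 u) linear0 scaler0.
- move=> N1 N2 N3 f g fgE _ _ f3 h1 h3 k kx.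
  have [fI VE gS] := GmodX_map_ses f3 fgE.
  have [|c3 c3P] := h3 (GmodX_map g \o k); first by rewrite [LHS](congr1 _ kx) linear0.
  have [c cP] := gS c3.
  pose k' := k \- (mulvec c \o sincl I).
  (* [residue_gen] is rebound here to the factorisation of k' through [GmodX N1]; it vanishes at x
     because x kills [GmodX]. *)
  have [|residue_gen k1P] := lin_factor_inj (f := k') fI.
    by move=> i; apply/VE; rewrite linB /= [GmodX_map g (k i)]c3P linZ cP subrr.
  have [|c1 c1P] := h1 residue_gen.
    apply: (inj0 fI); rewrite k1P.
    by rewrite -[LHS]/(k x_in_I - x *: c) kx sub0r GmodX_killed oppr0.
  exists (GmodX_map f c1 + c) => i; rewrite scalerDr -linZ -c1P k1P.
  by rewrite /k' /= subrK.
- by move=> N v vS vm f; apply: hom_simple.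
- move=> N y fN ym yI h3 k kx.
  have sesy := GmodX_map_ses (fg_qmod _ fN) (ses_limage yI).
  have [fI VE _] := sesy.
  have Vy u : GmodX_map (scalel N y) u = h y *: u.
    by have [w <-] := GmodX_pi_surj u; rewrite GmodX_map_pi Gmap_scalel linZ.
  have evl : linear (fun f : Hom (submod I) (GmodX N) => (f : {linear submod I -> GmodX N}) x_in_I) by [].
  (* Z consists of the maps vanishing at x and is finitely generated over R. The case of N/yN makes
     each of them a multiplication modulo h(y) Z. *)
  pose Z := lker (Lin evl).
  have ml : linear (fun c : GmodX N => (mulvec c \o sincl I : Hom (submod I) (GmodX N))).
    by move=> a c c'; apply: Hom_ext => i; rewrite /= scalerDr scaleC.
  have [|mu muP] := lin_factor_inj (i := sincl Z) (f := Lin ml) (@sincl_inj _ _ _).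
    by move=> c; apply/sinclP/lkerP; apply: GmodX_killed.
  have kZ : (k : Hom (submod I) (GmodX N)) \in Z by apply/lkerP.
  have : Submod kZ \in limage mu.
    apply: (nakayama nR lR (y := h y)); [|exact: h_local|].
      apply/(fg_submod nR)/fg_hom => //; [exact: fg_ideal|exact: fg_GmodX].
    move=> {kx kZ}k; pose k0 : {linear submod I -> GmodX N} := sincl Z k.
    have kx : k0 x_in_I = 0 by have /lkerP := sincl_in k.
    have [|c3 c3P] := h3 (GmodX_map (qmod_pi (limage (scalel N y))) \o k0).
      by rewrite [LHS](congr1 _ kx) linear0.
    have [_ _ gS] := sesy; have [c cP] := gS c3.
    have [|residue_gen k1P] := lin_factor_inj (f := k0 \- (mulvec c \o sincl I)) fI.
      by move=> i; apply/VE; rewrite linB /= [GmodX_map _ (k0 i)]c3P linZ cP subrr.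
    have k1Z : (residue_gen : Hom (submod I) (GmodX N)) \in Z.
      apply/lkerP; apply: (inj0 fI); rewrite [LHS]k1P.
      by rewrite -[LHS]/(k0 x_in_I - x *: c) kx sub0r GmodX_killed oppr0.
    exists (mu c); first by apply/limageP; exists c.
    exists (Submod k1Z); apply: (@sincl_inj _ _ Z); rewrite linD linZ muP.
    apply: Hom_ext => i; rewrite -[LHS]/(k0 i) -[RHS]/(sincl I i *: c + h y *: residue_gen i).
    by rewrite -Vy k1P /= addrC subrK.
  move=> /limageP[c cP]; exists c => i.
  by have := congr1 (sincl Z) cP; rewrite muP => /(congr1 (fun g : Hom (submod I) (GmodX N) => (g : {linear _ -> _}) i)).
Qed.

(* The socle generator z0 of A/xA lifts to the flat deformation R/xR = G(S)/xG(S): the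
   obstruction is a map from I to G(mS)/xG(mS), which is a multiplication. *)
Lemma ex_zeta : exists zeta : GmodX S^o, (forall i, i \in I -> i *: zeta = 0)
  /\ GmodX_map (qmod_pi mS) zeta = GmodX_pi residue_mod (pure h residue_gen z0).
Proof.
have fk : fg residue_mod by apply/fg_qmod/fg_regular.
have [fI VE _] := GmodX_map_ses fk (ses_qmod mS).
pose z := GmodX_pi S^o (pure h (1 : S^o) z0).
have pz : GmodX_map (qmod_pi mS) z = GmodX_pi residue_mod (pure h residue_gen z0) by rewrite GmodX_map_pi Gmap_pure.
have [|f fP] := lin_factor_inj (f := mulvec z \o sincl I) fI.
  move=> i; apply/VE; rewrite -[LHS]/(GmodX_map (qmod_pi mS) (sincl I i *: z)) linZ pz.
  rewrite -(linZ (GmodX_pi residue_mod)) pure_scale; apply/(GmodX_pi_simple _ residue_gen_surj residue_gen_ann).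
  by rewrite rmorphM; case: xz => _ _ _; apply; apply: rho_I.
have fx : f x_in_I = 0 by apply: (inj0 fI); rewrite fP; apply: GmodX_killed.
have [c cP] := hom_multiplication (fg_ideal nS mS) fx.
exists (z - GmodX_map (sincl mS) c); split=> [i iI|].
  have e : GmodX_map (sincl mS) (f (Submod iI)) = i *: z := fP _.
  by rewrite scalerBr -e cP linZ; apply: subrr.
by rewrite linB pz (exact0 _ VE) subr0.
Qed.

Variable zeta : GmodX S^o.
Hypothesis I_zeta : forall i, i \in I -> i *: zeta = 0.
Hypothesis pi_zeta : GmodX_map (qmod_pi mS) zeta = GmodX_pi residue_mod (pure h residue_gen z0).

Lemma GmodX_map_add N1 N2 (f g k : {linear N1 -> N2}) t :
  (forall v, k v = f v + g v) -> GmodX_map k t = GmodX_map f t + GmodX_map g t.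
Proof.
move=> kE; have [u <-] := GmodX_pi_surj t; rewrite !GmodX_map_pi -linD; congr (GmodX_pi _ _).
have al : linear (fun u => Gmap h f u + Gmap h g u).
  by move=> a u1 u2; rewrite !linearP addrACA scalerDr.
apply: (pure_linear_ext (f := Gmap h k) (g := Lin al)) => v r.
by rewrite -[RHS]/(Gmap h f (pure h v r) + Gmap h g (pure h v r)) !Gmap_pure -pureDl kE.
Qed.

Lemma GmodX_map_scalel N s t : GmodX_map (scalel N s) t = h s *: t.
Proof. by have [u <-] := GmodX_pi_surj t; rewrite GmodX_map_pi Gmap_scalel linZ. Qed.

Definition socle_map_fun N (n : restr pi N) : GmodX N := GmodX_map (mulvec (n : N)) zeta.

(** An element h s acts as s does on N, and r - h(pi r) lies in I, which kills zeta; so R acts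
    through pi. *)
Lemma socle_map_linear N : linear (@socle_map_fun N).
Proof.
move=> a n n'; rewrite /socle_map_fun.
rewrite (GmodX_map_add (f := mulvec (pi a *: (n : N))) (g := mulvec (n' : N))); last first.
  by move=> s; rewrite -[LHS]/(s *: (pi a *: (n : N) + n')) scalerDr.
congr (_ + _).
rewrite (GmodX_map_comp (f := scalel S^o (pi a)) (g := mulvec (n : N))); last first.
  by move=> s; rewrite /= scalerA mulrC.
rewrite GmodX_map_scalel linZ; apply/eqP; rewrite -subr_eq0 -scalerBl -opprB scaleNr oppr_eq0.
by rewrite -linZ I_zeta ?linear0 // sub_pi_ker.
Qed.

Definition socle_map N : {linear restr pi N -> GmodX N} := Lin (@socle_map_linear N).
Arguments socle_map : simpl never.

Lemma I_socle_map N n i : i \in I -> i *: socle_map N n = 0.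
Proof. by move=> iI; rewrite -[socle_map N n]/(GmodX_map _ _) -linZ I_zeta // linear0. Qed.

Lemma GmodX_map_socle_map N1 N2 (g : {linear N1 -> N2}) n : GmodX_map g (socle_map N1 n) = socle_map N2 (g n).
Proof.
apply/esym/(GmodX_map_comp (f := mulvec (n : N1)) (g := g)) => s.
by rewrite /= linZ.
Qed.

Lemma socle_map_onto N : fg N -> forall u : GmodX N, (forall i, i \in I -> i *: u = 0) ->
  exists n, socle_map N n = u.
Proof.
move: N; apply: (devissage nS lS).
- move=> N N0 u _; exists 0; have [t <-] := GmodX_pi_surj u.
  by rewrite (G_zero N0 t) !linear0.
- move=> N1 N2 N3 f g fgE _ _ f3 h1 h3 u Iu.
  have [fI VE gS] := GmodX_map_ses f3 fgE.
  have [|n3 n3P] := h3 (GmodX_map g u) _; first by move=> i iI; rewrite -linZ Iu ?linear0.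
  have [_ _ gs] := fgE; have [n nP] := gs n3.
  have /VE[u1 u1P] : GmodX_map g (u - socle_map N2 n) = 0 by rewrite linB GmodX_map_socle_map nP n3P subrr.
  have [|n1 n1P] := h1 u1.
    by move=> i iI; apply: (inj0 fI); rewrite linZ u1P scalerBr Iu // I_socle_map // subr0.
  by exists (f n1 + n); rewrite linD -GmodX_map_socle_map n1P u1P subrK.
- move=> N v vS vm u Iu.
  have [t tu] := GmodX_pi_surj u; have [r tr] := simple_pure vS t.
  have hr a : a \in mA -> a * rho r \in xA.
    move=> /mA_lift[i <-]; rewrite -rmorphM; apply/(GmodX_pi_simple _ vS vm).
    by rewrite -pure_scale linZ -tr tu Iu // sincl_in.
  have [c [b cb]] := socle hr.
  have [c0 c0P] := rho_surj c; have [b0 b0P] := rho_surj b.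
  (* Since mA kills z0 modulo x, the coefficient c of z0 matters only modulo mA and may be replaced
     by the image of h(pi c0). *)
  have [_ _ _ mz] := xz.
  have /mz/pidP[b1 b1P] : rho (c0 - h (pi c0)) \in mA.
    by have := rho_I (Submod (sub_pi_ker c0)).
  have [j jP] : exists j : {linear residue_mod -> N}, forall s, j (qmod_pi mS s) = s *: (pi c0 *: v).
    apply: (qmod_lift (N := mS) (f := mulvec (pi c0 *: v))) => s; rewrite -vm => /annP sv.
    by rewrite /= scaleC sv scaler0.
  exists (pi c0 *: v).
  rewrite -[LHS]/(GmodX_map (mulvec (pi c0 *: v)) zeta).
  rewrite (GmodX_map_comp (f := qmod_pi mS) (g := j)); last by move=> s; rewrite jP.
  rewrite pi_zeta GmodX_map_pi Gmap_pure jP scale1r pureZ -tu tr.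
  apply/eqP; rewrite eq_sym -subr_eq0 -(linB (GmodX_pi N)) -pureB; apply/eqP.
  apply/(GmodX_pi_simple _ vS vm)/pidP; exists (b + b1).
  rewrite mulrDr b1P !rmorphB cb -c0P !rmorphM; ring.
- move=> N y fN ym yI h3.
  have sesy := GmodX_map_ses (fg_qmod _ fN) (ses_limage yI).
  have [fI VE _] := sesy.
  (* The annihilator of I is finitely generated over R, and surjectivity for N/yN says that it is
     the image of mu plus h(y) times itself. *)
  pose L : {pred GmodX N} := fun u => `[< forall i, i \in I -> i *: u = 0 >].
  have Lc : submod_closed L.
    split; first by apply/asboolP => i _; rewrite scaler0.
    move=> a u u' /asboolP uL /asboolP u'L; apply/asboolP => i iI.
    by rewrite scalerDr scaleC uL // u'L // scaler0 addr0.
  pose Ls : submodClosed (GmodX N) := HB.pack L (GRing.isSubmodClosed.Build R (GmodX N) L Lc).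
  have [|mu muP] := lin_factor_inj (i := sincl Ls) (f := socle_map N) (@sincl_inj _ _ _).
    by move=> n; apply/sinclP/asboolP => i iI; apply: I_socle_map.
  move=> u Iu; have uL : u \in Ls by apply/asboolP.
  have : Submod uL \in limage mu.
    apply: (nakayama nR lR (y := h y)); [|exact: h_local|].
      exact/(fg_submod nR)/fg_GmodX.
    move=> {uL Iu}u; have /asboolP Iu := sincl_in u.
    have [|n3 n3P] := h3 (GmodX_map (qmod_pi (limage (scalel N y))) (sincl Ls u)).
      by move=> i iI; rewrite -linZ Iu ?linear0.
    have [n nP] := qmod_pi_surj n3.
    have /VE[u1 u1P] : GmodX_map (qmod_pi (limage (scalel N y))) (sincl Ls u - socle_map N n) = 0.
      by rewrite linB GmodX_map_socle_map [X in socle_map _ X]nP n3P subrr.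
    have u1L : u1 \in Ls.
      apply/asboolP => i iI; apply: (inj0 fI).
      by rewrite linZ u1P scalerBr Iu // I_socle_map // subr0.
    exists (mu n); first by apply/limageP; exists n.
    exists (Submod u1L); apply: (@sincl_inj _ _ Ls).
    rewrite linD linZ muP -[sincl Ls (Submod _)]/u1 -GmodX_map_scalel u1P.
    by rewrite addrC subrK.
  by move=> /limageP[n nP]; exists n; rewrite -muP nP.
Qed.

(* If s zeta = 0, then zeta comes from G(ann s)/xG(ann s); for s <> 0 the ideal ann s lies
   in mS, so that zeta would vanish on the central fibre. *)
Lemma socle_map_inj : injective (socle_map S^o).
Proof.
apply: lin_inj => s sz; apply: contrapT => s0.
pose K := ann (s : S^o).
have Km := ann_sub_max nS lS s0.
have [j jP] : exists j : {linear qmod K -> S^o}, forall t, j (qmod_pi K t) = t *: (s : S^o).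
  by apply: (qmod_lift (N := K) (f := mulvec (s : S^o))) => t /annP.
have jI : injective j.
  by apply: lin_inj; elim/qmod_ind => t; rewrite jP => /annP/qmod_pi0.
have fS := fg_regular S.
have [VjI _ _] := GmodX_map_ses (fg_qmod _ fS) (ses_limage jI).
have [_ VKE _] := GmodX_map_ses (fg_qmod K fS) (ses_qmod K).
have /VKE[t tz] : GmodX_map (qmod_pi K) zeta = 0.
  apply: (inj0 VjI); rewrite -[RHS]sz; apply/esym/GmodX_map_comp => t.
  by rewrite jP.
have : GmodX_pi residue_mod (pure h residue_gen z0) = 0.
  rewrite -pi_zeta -tz; have [t' <-] := GmodX_pi_surj t.
  rewrite !GmodX_map_pi -(Gmap_comp (k := \0%R)); last first.
    by move=> v; apply/esym/qmod_pi0/Km/sincl_in.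
  suff -> : forall u, Gmap h (\0%R : {linear submod K -> residue_mod}) u = 0 by rewrite linear0.
  apply: (pure_linear_ext (g := \0%R)) => v r; rewrite Gmap_pure; exact: pure0l.
by move=> /(GmodX_pi_simple _ residue_gen_surj residue_gen_ann); apply/negP; case: xz.
Qed.

Lemma GmodX_pi1P (w : R) : GmodX_pi S^o (pure h (1 : S^o) w) = 0 <-> exists r, w = x * r.
Proof.
split=> [/GmodX_piP[t tP]|[r ->]].
  by exists (eps h t); rewrite -[LHS](eps_pure1 h) tP linZ.
by rewrite -pure_scale; apply/GmodX_piP; exists (pure h (1 : S^o) r).
Qed.

Lemma x_regular : regular_elt x.
Proof.
move=> y xy; rewrite -[LHS](eps_pure1 h) -[RHS](linear0 (eps h)); congr (eps h _).
apply: (inj0 (G_regular (fg_regular S))).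
by rewrite [LHS]pure_scale xy pure0r.
Qed.

(* Evaluation at x identifies I^* with (xR : I) and its submodule R with xR. *)
Lemma dual_quotient_iso : lmod_iso (qmod (limage (mul_on I))) (restr pi S^o).
Proof.
have fS := fg_regular S.
have el : linear (fun f : dual (submod I) =>
    GmodX_pi S^o (pure h (1 : S^o) ((f : {linear submod I -> R^o}) x_in_I))).
  by move=> a f g; rewrite -(linZ (GmodX_pi S^o)) -(linD (GmodX_pi S^o)) pure_scale -pureDr.
have [|T TP] := lin_factor_inj (i := socle_map S^o) (f := Lin el) socle_map_inj.
  move=> f; apply: (socle_map_onto fS) => i iI; rewrite -(linZ (GmodX_pi S^o)) pure_scale; apply/GmodX_pi1P.
  exists ((f : {linear submod I -> R^o}) (Submod iI)).
  exact: (dual_comm (f : {linear submod I -> R^o}) (Submod iI) x_in_I).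
have T0 f : T f = 0 <-> f \in limage (mul_on I).
  split=> [Tf|/limageP[r rf]].
    have /GmodX_pi1P[r fr] : GmodX_pi S^o (pure h (1 : S^o) ((f : {linear submod I -> R^o}) x_in_I)) = 0.
      by rewrite -[LHS](TP f) Tf linear0.
    apply/limageP; exists r; apply: Hom_ext => i; apply: (regularI x_regular).
    rewrite [RHS](dual_comm (f : {linear submod I -> R^o}) x_in_I i) fr.
    by rewrite -[LHS]/(x * (r * sincl I i)) [RHS]mulrCA; congr (_ * _); apply: mulrC.
  apply: (inj0 socle_map_inj); rewrite TP; apply/GmodX_pi1P; exists r.
  by rewrite -rf; apply: mulrC.
have TS : surj T.
  move=> s; have [t tP] := GmodX_pi_surj (socle_map S^o s).
  (* w represents [socle_map] of s in R/xR. As I w lies in xR, multiplication by w/x belongs to I^*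
     and takes the value w at x. *)
  pose w := eps h t.
  have [||f fP] := lin_factor_inj (i := scalel R^o x) (f := mulvec (w : R^o) \o sincl I).
  - exact/lin_inj/x_regular.
  - move=> i; have [r rP] : exists r, sincl I i * w = x * r.
      apply/GmodX_pi1P; rewrite -pure_scale linZ pure1_eps tP.
      by apply: I_socle_map; apply: sincl_in.
    by exists r; rewrite [RHS]rP.
  exists (f : dual (submod I)); apply: socle_map_inj; rewrite TP -[LHS]/(GmodX_pi _ (pure h (1 : S^o) (f x_in_I))).
  have -> : f x_in_I = w by apply: (regularI x_regular); rewrite [LHS]fP.
  by rewrite pure1_eps tP.
have [|g gP] := qmod_lift (N := limage (mul_on I)) (f := T); first by move=> f /T0.
exists g; apply: inj_surj_bij.
  by apply: lin_inj; elim/qmod_ind => f; rewrite gP => /T0/qmod_pi0.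
by move=> s; have [f fs] := TS s; exists (qmod_pi _ f); rewrite gP.
Qed.

End Family.

(** * The multipliers of I in the total quotient ring *)

Section Multipliers.
Variables (R : comPzRingType) (I : ideal R) (x : R).
Hypotheses (xI : x \in I) (xreg : regular_elt x).

Local Notation Q := (total_quotient R).
Local Notation tau := (@to_total_quotient R).

Lemma to_total_quotient_inj : injective tau.
Proof.
move=> a b /fracP[w /asboolP wreg] /=; rewrite !mulr1 => e.
by apply/eqP; rewrite -subr_eq0; apply/eqP/wreg; rewrite mulrBr e subrr.
Qed.

Lemma regular_denom : x \in @nonzerodiv R.
Proof. exact/asboolP. Qed.

Definition inv_regular : Q := frac 1 (exist _ x regular_denom : denom (@nonzerodiv R)).

Lemma mul_inv_regular : tau x * inv_regular = 1.
Proof. by rewrite [LHS]loc_mulE; apply: frac_eq => /=; rewrite !mulr1 !mul1r. Qed.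

(* The inverse sends f to f(x)/x. *)
Lemma multipliers_iso : lmod_iso (submod (multipliers I)) (dual (submod I)).
Proof.
pose P (q : submod (multipliers I)) (f : dual (submod I)) := forall i,
  (sincl _ q : Q) * tau (sincl I i) = tau ((f : {linear submod I -> R^o}) i).
have Pl a q q' f f' : P q f -> P q' f' -> P (a *: q + q') (a *: f + f').
  move=> qf qf' i; rewrite linD linZ rmorphD rmorphM -qf -qf' mulrA.
  exact: mulrDl (tau a * (sincl _ q : Q)) _ _.
have P0 f : P 0 f -> f = 0.
  move=> f0; apply: Hom_ext => i; apply: to_total_quotient_inj; rewrite -f0 linear0 [RHS]rmorph0.
  exact: mul0r.
have [q|F FP] := lin_rel _ Pl P0.
  have /asboolP qI := sincl_in q.
  pose P' (i : submod I) (r : R^o) := (sincl _ q : Q) * tau (sincl I i) = tau r.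
  have [i||r|f fP] := @lin_rel _ _ _ P'.
  - exact/qI/sincl_in.
  - move=> a i i' r r' ir ir'; rewrite /P' linD linZ !rmorphD !rmorphM -ir -ir'.
    by rewrite mulrDr mulrCA.
  - rewrite /P' linear0 rmorph0 mulr0 => r0; apply: to_total_quotient_inj; by rewrite rmorph0.
  by exists f.
exists F; apply: inj_surj_bij => [|f].
  apply: lin_inj => q Fq; apply: (@sincl_inj _ _ (multipliers I)).
  have qx : (sincl _ q : Q) * tau x = 0.
    by rewrite [LHS](FP q (Submod xI)) Fq; apply: (rmorph0 tau).
  by rewrite linear0 -[LHS](mulr1 (_ : Q)) -mul_inv_regular mulrA [X in X * _]qx mul0r.
pose q : restr tau Q^o := tau ((f : {linear submod I -> R^o}) (Submod xI)) * inv_regular : Q.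
have qf i : (q : Q) * tau (sincl I i) = tau ((f : {linear submod I -> R^o}) i).
  have e : (f : {linear submod I -> R^o}) (Submod xI) * sincl I i =
      x * (f : {linear submod I -> R^o}) i.
    by rewrite mulrC; apply: (dual_comm (f : {linear submod I -> R^o}) i (Submod xI)).
  by rewrite /q mulrAC -rmorphM e rmorphM mulrAC mul_inv_regular mul1r.
have qI : q \in multipliers I.
  by apply/asboolP => i iI; exists ((f : {linear submod I -> R^o}) (Submod iI)); apply: qf (Submod iI).
exists (Submod qI); apply/eqP; rewrite -subr_eq0; apply/eqP/P0.
have := Pl (-1) _ _ _ _ (qf : P (Submod qI) f) (FP (Submod qI)).
by rewrite !scaleN1r addNr addrC.
Qed.

End Multipliers.

(** * Transport along ring isomorphisms *)

Section Transport.
Variables (B A : comPzRingType) (psi : {rmorphism B -> A}).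

Definition semilinear (U : lmodType B) (V : lmodType A) (F : U -> V) :=
  forall b x y, F (b *: x + y) = psi b *: F x + F y.

Lemma semilinear0 (U : lmodType B) (V : lmodType A) (F : U -> V) : semilinear F -> F 0 = 0.
Proof.
move=> FP; apply: (addIr (F 0)); rewrite add0r -[X in X + _]scale1r -(rmorph1 psi) -FP.
by rewrite scaler0 addr0.
Qed.

Lemma semilinear_restr (V : lmodType A) : semilinear (fun x : restr psi V => x : V).
Proof. by []. Qed.

Hypothesis psi_surj : surj psi.

Section Conjugate.
Variables (U U' : lmodType B) (V V' : lmodType A) (F : U -> V) (F' : U' -> V').
Hypotheses (Fl : semilinear F) (Fl' : semilinear F').

Lemma conj_up (f : {linear U -> U'}) : bijective F ->
  exists g : {linear V -> V'}, forall x, g (F x) = F' (f x).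
Proof.
case=> G FK GK; have gl : linear (fun y => F' (f (G y))).
  move=> a y y'; have [b <-] := psi_surj a.
  by rewrite -[y in LHS]GK -[y' in LHS]GK -Fl FK linearP Fl'.
by exists (Lin gl) => x /=; rewrite FK.
Qed.

Lemma conj_down (g : {linear V -> V'}) : bijective F' ->
  exists f : {linear U -> U'}, forall x, F' (f x) = g (F x).
Proof.
case=> G' FK GK; have fl : linear (fun x => G' (g (F x))).
  by move=> b x y; apply: (can_inj FK); rewrite GK Fl' !GK Fl linearP.
by exists (Lin fl) => x /=; rewrite GK.
Qed.

End Conjugate.

Variable psi' : {rmorphism A -> B}.
Hypotheses (psiK : cancel psi psi') (psiK' : cancel psi' psi).

(** A lifting problem over B becomes one over A by restriction along the inverse [psi']. *)
Lemma projective_restr (P : lmodType A) : projective P -> projective (restr psi P).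
Proof.
move=> Pp M N p f pS.
have fl : linear (f : P -> restr psi' N).
  move=> a x y; rewrite -{1}[a]psiK'.
  exact: (linearP f (psi' a) (x : restr psi P) y).
have pl : linear (p : restr psi' M -> restr psi' N).
  by move=> a x y; apply: (linearP p).
have [g gP] := Pp _ _ (Lin pl) (Lin fl) pS.
have gl : linear (g : restr psi P -> M).
  move=> b x y; rewrite -[b in RHS]psiK.
  exact: (linearP g (psi b) (x : P) y).
by exists (Lin gl).
Qed.

Lemma Ext_transport n (U U' : lmodType B) (V V' : lmodType A) (F : U -> V) (F' : U' -> V') :
  semilinear F -> bijective F -> semilinear F' -> bijective F' ->
  Ext_succ_eq0 n V V' -> Ext_succ_eq0 n U U'.
Proof.
move=> Fl Fb Fl' Fb' [P [d [e [[Pp eS eE dE] h]]]].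
have FI := bij_inj Fb; have FI' := bij_inj Fb'.
pose P' n : lmodType B := restr psi (P n).
have dl k : linear (d k : P' k.+1 -> P' k) by move=> b x y; apply: (linearP (d k)).
have [e' e'P] : exists e' : {linear P' 0%N -> U}, forall x, F (e' x) = e x.
  exact: (conj_down (@semilinear_restr (P 0%N)) Fl e Fb).
exists P', (fun k => Lin (dl k)), e'; split.
  split=> [k|y||k]; first exact/projective_restr.
  - by have [x xy] := eS (F y); exists x; apply: FI; rewrite e'P.
  - move=> y; rewrite -[exists x, _]/(exists x, d 0%N x = y) -eE -e'P.
    by split=> [->|]; [exact: semilinear0|rewrite -(semilinear0 Fl) => /FI].
  - exact: dE.
move=> f f0.
have [g gP] : exists g : {linear P n.+1 -> V'}, forall x, g x = F' (f x).
  by apply: (conj_up (@semilinear_restr (P n.+1)) Fl' f); exists id.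
have [|k kP] := h g; first by move=> x; rewrite gP [f _]f0 semilinear0.
have [k' k'P] : exists k' : {linear P' n -> U'}, forall x, F' (k' x) = k x.
  exact: (conj_down (@semilinear_restr (P n)) Fl' k Fb').
by exists k' => x; apply: FI'; rewrite -gP k'P kP.
Qed.

Lemma semilinear_psi : semilinear (psi : B^o -> A^o).
Proof. by move=> b x y; rewrite rmorphD rmorphM. Qed.

Lemma psi_bij : bijective psi. Proof. by exists psi'. Qed.

Lemma dual_transport (U : lmodType B) (V : lmodType A) (F : U -> V) :
  semilinear F -> bijective F ->
  exists D : dual U -> dual V, [/\ semilinear D, bijective D
    & forall f x, (D f : {linear V -> A^o}) (F x) = psi ((f : {linear U -> B^o}) x)].
Proof.
move=> Fl Fb.
have /choice[D DP] : forall f : dual U, exists g : dual V, forall x,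
    (g : {linear V -> A^o}) (F x) = psi ((f : {linear U -> B^o}) x).
  by move=> f; have [g gP] := conj_up Fl semilinear_psi (f : {linear _ -> _}) Fb; exists g.
have [G FK GK] := Fb.
exists D; split=> // [b f f'|].
  apply: Hom_ext => y; rewrite -[y]GK DP.
  rewrite -[RHS]/(psi b * (D f : {linear V -> A^o}) (F (G y)) + (D f' : {linear V -> A^o}) (F (G y))).
  by rewrite !DP -rmorphM -rmorphD.
apply: inj_surj_bij => [f f' e|g].
  by apply: Hom_ext => x; apply: (can_inj psiK); rewrite -!DP e.
have [f fP] := conj_down Fl semilinear_psi (g : {linear _ -> _}) psi_bij.
exists (f : dual U); apply: Hom_ext => y; rewrite -[y]GK DP; exact: fP.
Qed.

(** The central fibre uses S/mS and the other fibres a localised residue field, so the rings are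
    only isomorphic. The induced map on double duals intertwines the evaluation maps. *)
Lemma stably_reflexive_transport (U : lmodType B) (V : lmodType A) (F : U -> V) :
  semilinear F -> bijective F -> stably_reflexive V -> stably_reflexive U.
Proof.
move=> Fl Fb [[ev evK evK'] E].
have [D [Dl Db DP]] := dual_transport Fl Fb.
have [DD [DDl DDb DDP]] := dual_transport Dl Db.
split; last first.
  move=> n; have [E1 E2] := E n.
  by split; [apply: (Ext_transport Fl Fb semilinear_psi psi_bij E1)
            |apply: (Ext_transport Dl Db semilinear_psi psi_bij E2)].
have DDI := bij_inj DDb.
have evD x : DD (bidual_eval x) = bidual_eval (F x).
  have [D' DK DK'] := Db.
  apply: Hom_ext => g; rewrite -[g]DK' DDP; exact/esym/DP.
apply: inj_surj_bij => [x y e|xi].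
  by apply: (bij_inj Fb); apply: (can_inj evK); rewrite -!evD e.
have [G FK GK] := Fb.
by exists (G (ev (DD xi))); apply: DDI; rewrite evD GK evK'.
Qed.

End Transport.

Lemma ring_iso_of_kernels (R B A : comPzRingType) (rB : {rmorphism R -> B}) (rA : {rmorphism R -> A}) :
  surj rB -> surj rA -> (forall r, rB r = 0 <-> rA r = 0) ->
  exists psi : {rmorphism B -> A}, forall r, psi (rB r) = rA r.
Proof.
move=> sB sA k; have [s sP] := choice sB.
pose f b := rA (s b).
have fE r : f (rB r) = rA r.
  apply/eqP; rewrite -subr_eq0 -rmorphB; apply/eqP/k.
  by rewrite rmorphB sP subrr.
have fz : zmod_morphism f.
  by move=> b b'; rewrite -[b]sP -[b']sP -rmorphB !fE rmorphB.
have fm : monoid_morphism f.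
  split=> [|b b']; first by rewrite -(rmorph1 rB) fE rmorph1.
  by rewrite -[b]sP -[b']sP -rmorphM !fE rmorphM.
pose F : {rmorphism B -> A} := HB.pack f (GRing.isZmodMorphism.Build B A f fz)
  (GRing.isMonoidMorphism.Build B A f fm).
by exists F.
Qed.

(** * Retracts of flat modules *)

Section FlatRetract.
Variable S : comPzRingType.
Implicit Types (M N : lmodType S).

Lemma tmap_balanced M M' N N' (u : {linear M -> M'}) (v : {linear N -> N'}) :
  balanced (fun x y => tens (u x) (v y)).
Proof.
split=> [x x' y|x y y'|a x y].
- by rewrite linearD tensDl.
- by rewrite linearD tensDr.
- by rewrite !linZ tensZ.
Qed.

Lemma tmap_tens M M' N N' (u : {linear M -> M'}) (v : {linear N -> N'}) x y :
  tmap u v (tens x y) = tens (u x) (v y).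
Proof. exact: (tlift_tens _ _ (tmap_balanced u v)). Qed.

Lemma tmapD M M' N N' (u : {linear M -> M'}) (v : {linear N -> N'}) t t' :
  tmap u v (t + t') = tmap u v t + tmap u v t'.
Proof. exact: (tliftD _ _ (tmap_balanced u v)). Qed.

Lemma tmap0 M M' N N' (u : {linear M -> M'}) (v : {linear N -> N'}) : tmap u v 0 = 0.
Proof. exact: (tlift0 (tmap_balanced u v)). Qed.

Lemma tmap_comp M M' M'' N N' N'' (u : {linear M -> M'}) (v : {linear N -> N'})
    (u' : {linear M' -> M''}) (v' : {linear N' -> N''}) (w : {linear M -> M''}) (w' : {linear N -> N''}) t :
  (forall x, w x = u' (u x)) -> (forall y, w' y = v' (v y)) ->
  tmap u' v' (tmap u v t) = tmap w w' t.
Proof.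
move=> wE wE'; move: t; apply: tlift_ext => [t t'|t t'|x y]; rewrite ?tmapD //.
by rewrite !tmap_tens wE wE'.
Qed.

Lemma tmap_id M N (u : {linear M -> M}) (v : {linear N -> N}) t :
  (forall x, u x = x) -> (forall y, v y = y) -> tmap u v t = t.
Proof.
move=> uE vE; move: t; apply: tlift_ext => [t t'|t t'|x y]; rewrite ?tmapD //.
by rewrite tmap_tens uE vE.
Qed.

Lemma tens0l M N (y : N) : tens (0 : M) y = 0.
Proof. by apply: (addIr (tens (0 : M) y)); rewrite -tensDl !add0r. Qed.

Lemma flat_retract M M' (i : {linear M -> M'}) (p : {linear M' -> M}) :
  cancel i p -> flat M' -> flat M.
Proof.
move=> ip fM N1 N2 N3 f g fgE t; split=> [gt|[u <-]]; last first.
  rewrite (tmap_comp (w := \0%R) (w' := idfun)) //; last by move=> x; rewrite (exact0 _ fgE).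
  move: u; apply: tlift_ext => [u u'|u u'|x y]; rewrite ?tmapD ?addr0 //.
  by rewrite tmap_tens tens0l.
have /(fM _ _ _ _ _ fgE)[u uP] : tmap g (idfun : {linear M' -> M'}) (tmap (idfun : {linear N2 -> N2}) i t) = 0.
  rewrite (tmap_comp (w := g) (w' := i)) //.
  rewrite -(tmap_comp (u := g) (v := idfun : {linear M -> M}) (u' := idfun) (v' := i)) //.
  by rewrite gt tmap0.
exists (tmap (idfun : {linear N1 -> N1}) p u).
rewrite (tmap_comp (w := f) (w' := p)) //.
rewrite -(tmap_comp (u := f) (v := idfun : {linear M' -> M'}) (u' := idfun) (v' := p)) // uP.
by rewrite (tmap_comp (w := idfun) (w' := idfun)) // tmap_id.
Qed.

End FlatRetract.

(** * The fibres *)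

Section Fibre.
Variables (S R K : comPzRingType) (h : {rmorphism S -> R}) (g : {rmorphism S -> K}).
Variables (mS : ideal S) (pi : {rmorphism R -> S}).
Hypotheses (gS : surj g) (gK : forall s, g s = 0 <-> s \in mS) (hK : cancel h pi).

Notation F := (talg h g).

Definition to_fibre_fun (r : R) : F := tens (r : restr h R^o) (1 : restr g K^o).

Lemma to_fibre_zmod : zmod_morphism to_fibre_fun.
Proof.
move=> r r'; apply: (addIr (to_fibre_fun r')); rewrite subrK.
by rewrite -[LHS]tensDl; congr tens; apply: subrK.
Qed.

Lemma to_fibre_monoid : monoid_morphism to_fibre_fun.
Proof.
split=> // r r'; rewrite [RHS]tact_tens; congr tens; exact/esym/mulr1.
Qed.

Definition to_fibre : {rmorphism R -> F} := HB.pack to_fibre_fun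
  (GRing.isZmodMorphism.Build R F to_fibre_fun to_fibre_zmod)
  (GRing.isMonoidMorphism.Build R F to_fibre_fun to_fibre_monoid).

Lemma fibre_pure (r : R) (s : S) :
  tens (r : restr h R^o) (g s : restr g K^o) = to_fibre (h s * r).
Proof.
rewrite -[g s]mulr1 -[g s * 1]/(s *: (1 : restr g K^o)) -tensZ; congr tens.
Qed.

Lemma to_fibre_surj : surj to_fibre.
Proof.
move=> a; move: a; apply: tensor_ind => [|r k t [r' r't]]; first by exists 0; rewrite rmorph0.
have [s sk] := gS k; exists (h s * r + r').
by rewrite rmorphD r't -sk -fibre_pure.
Qed.

(** The maps lam and mu identify N with K by matching s v with g s; each then induces a map that
    swaps the tensor factors. *)
Lemma to_fibreP (N : lmodType S) (v : N) : surj (mulvec v) -> ann v =i mS ->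
  forall r, pure h v r = 0 <-> to_fibre r = 0.
Proof.
move=> vS vm r.
have gl : linear (g : S^o -> restr g K^o) by move=> a s s'; rewrite rmorphD rmorphM.
have [lam lamP] : exists lam : {linear N -> restr g K^o}, forall s, lam (s *: v) = g s.
  apply: (@lin_factor_surj _ _ _ _ (mulvec v) (Lin gl)) => // s /annP.
  by rewrite vm => /gK.
have [mu muP] : exists mu : {linear restr g K^o -> N}, forall s, mu (g s) = s *: v.
  apply: (@lin_factor_surj _ _ _ _ (Lin gl) (mulvec v)) => // s /gK.
  by rewrite -vm => /annP.
have g1 : (g 1 : restr g K^o) = (1 : K) by apply: rmorph1.
split=> e.
  have b : balanced (fun (n : N) (c : restr h R^o) => tens c (lam n)).
    split=> [n n' c|n c c'|a n c]; first by rewrite linearD tensDr.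
      exact: tensDl.
    by rewrite linZ -tensZ.
  have := tlift_tens v (r : restr h R^o) b; rewrite -[tens v _]/(pure h v r) e tlift0 //.
  by rewrite -[v in lam v](scale1r v) lamP g1.
have b : balanced (fun (c : restr h R^o) (k : restr g K^o) => pure h (mu k) c).
  split=> [c c' k|c k k'|a c k]; first exact: pureDr.
    by rewrite linearD pureDl.
  by rewrite linZ pureZ.
have := tlift_tens (r : restr h R^o) (1 : restr g K^o) b.
rewrite -[tens _ _]/(to_fibre r) e tlift0 // -g1 muP scale1r; exact: esym.
Qed.

Lemma fibre_compat s : (g \o pi) (h s) = idfun (g s).
Proof. by rewrite /= hK. Qed.

Definition fibre_aug : {rmorphism F -> K} := talg_lift fibre_compat.

Lemma fibre_aug_to_fibre r : fibre_aug (to_fibre r) = g (pi r).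
Proof. by rewrite [LHS]talg_liftE /= mulr1. Qed.

Notation I := (kernel pi : ideal R).

Lemma ker_split_linear : linear (fun r : restr h R^o => Submod (sub_pi_ker hK r) : restr h (submod I)).
Proof.
move=> a r r'; apply: (@sincl_inj _ _ I).
rewrite -[LHS]/(h a * r + r' - h (pi (h a * r + r'))).
rewrite -[RHS]/(h a * (r - h (pi r)) + (r' - h (pi r'))).
by rewrite !rmorphD !rmorphM hK; ring.
Qed.

Lemma ker_incl_linear : linear (fun i : restr h (submod I) => sincl I i : restr h R^o).
Proof. by []. Qed.

Lemma ker_inclK : cancel (Lin ker_incl_linear) (Lin ker_split_linear).
Proof.
move=> i; apply: (@sincl_inj _ _ I); rewrite -[LHS]/(sincl I i - h (pi (sincl I i))).
by rewrite (kernelP _ _ (sincl_in i)) rmorph0 subr0.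
Qed.

Lemma flat_kernel : flat_hom h -> flat (restr h (submod I)).
Proof. exact: (flat_retract ker_inclK). Qed.

Definition ker_to_fibre : tmod h g (submod I) K^o -> F :=
  tmap (Lin ker_incl_linear) (idfun : {linear restr g K^o -> restr g K^o}).

(** The S-linear splitting R = h(S) + I survives the tensor product. *)
Lemma ker_to_fibre_inj : injective ker_to_fibre.
Proof.
apply: (can_inj (g := tmap (Lin ker_split_linear) (idfun : {linear restr g K^o -> restr g K^o}))).
by move=> t; rewrite /ker_to_fibre (tmap_comp (w := idfun) (w' := idfun)) ?tmap_id // => i; rewrite ker_inclK.
Qed.

Lemma ker_to_fibre_linear (a : F) t u : ker_to_fibre (a *: t + u) = a * ker_to_fibre t + ker_to_fibre u.
Proof.
rewrite /ker_to_fibre tmapD; congr (_ + _).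
move: a; apply: tlift_ext => [a b|a b|r k].
- by rewrite scalerDl tmapD.
- by rewrite mulrDl.
move: t; apply: tlift_ext => [t t'|t t'|i l].
- by rewrite scalerDr tmapD.
- by rewrite tmapD mulrDr.
by rewrite [_ *: _]tact_tens !tmap_tens [RHS]tact_tens.
Qed.

Lemma fibre_aug_ker t : fibre_aug (ker_to_fibre t) = 0.
Proof.
move: t; apply: tlift_ext => [t t'|t t'|i l].
- by rewrite /ker_to_fibre tmapD rmorphD.
- by rewrite addr0.
rewrite /ker_to_fibre tmap_tens [LHS]talg_liftE /= -[X in pi X]/(sincl I i).
by rewrite (kernelP _ _ (sincl_in i)) rmorph0 mul0r.
Qed.

Lemma to_fibre_max s : s \in mS -> to_fibre (h s) = 0.
Proof.
move=> /gK gs; rewrite -[h s]mulr1 -fibre_pure gs.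
apply: (addIr (tens (1 : restr h R^o) (0 : restr g K^o))); rewrite add0r.
by rewrite -[LHS]tensDr addr0.
Qed.

Lemma ker_to_fibre_onto a : fibre_aug a = 0 -> exists t, ker_to_fibre t = a.
Proof.
have [r <-] := to_fibre_surj a; rewrite fibre_aug_to_fibre => /gK rm.
exists (tens (Submod (sub_pi_ker hK r) : restr h (submod I)) (1 : restr g K^o)).
rewrite /ker_to_fibre tmap_tens -[LHS]/(to_fibre (r - h (pi r))).
by rewrite rmorphB [X in _ - X]to_fibre_max // subr0.
Qed.

End Fibre.

(** * The residue field at the closed point *)

Section ResidueFieldOfLocal.
Variables (S : comPzRingType) (mS p : ideal S) (pP : prime_ideal p).
Hypotheses (nS : noetherian S) (lS : local_ring mS) (pm : p =i mS).

Lemma residue_surj : surj (to_residue_field pP).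
Proof.
move=> t; have [y <-] := qmod_pi_surj t; move: y; apply: frac_ind => a [s sp].
have [|u us] := local_unit nS lS (x := s); first by rewrite -pm.
exists (u * a); rewrite -[LHS]/(qmod_pi _ _); congr qmod_pi.
by apply: frac_eq => /=; rewrite mulr1 mulrAC us mul1r.
Qed.

Lemma residue_ker s : to_residue_field pP s = 0 <-> s \in mS.
Proof.
rewrite -pm; have E : to_residue_field pP s = 0 <->
    (loc_map (prime_compl pP) s : (loc_at pP)^o) \in @loc_at_max S p pP by exact: qmod_pi0.
rewrite E; split=> [|sp]; last by apply/sub_span/asboolP; exists s.
have unitp (t : S) : t \notin p -> exists u, u * t = 1.
  by rewrite pm; apply: (local_unit nS lS).
(* Denominators are already units of S, so the image of p is an ideal and the span adds nothing to
   it. *)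
pose Y : {pred (loc_at pP)^o} := fun t => `[< exists2 a, a \in p & loc_map (prime_compl pP) a = t >].
have Yc : submod_closed Y.
  split; first by apply/asboolP; exists 0; [exact: (rpred0 p)|exact: rmorph0].
  move=> c t t' /asboolP[a ap <-] /asboolP[a' ap' <-]; apply/asboolP.
  move: c; apply: frac_ind => b [w wp]; have [u uw] := unitp w wp.
  exists (u * b * a + a'); first by apply: idealD => //; apply: idealMl.
  rewrite rmorphD rmorphM; congr (_ * _ + _).
  by apply: frac_eq => /=; rewrite mulr1 mulrAC uw mul1r.
pose Ys : ideal (loc_at pP) := HB.pack Y
  (GRing.isSubmodClosed.Build (loc_at pP) (loc_at pP)^o Y Yc).
move=> /(span_min (N := Ys)) h.
have /asboolP[a ap /fracP[w wp /=]] := h (fun t tY => tY).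
rewrite !mulr1 => e.
have : w * s \in p by rewrite -e; apply: idealMl.
by move=> /(proj2 pP)[wp'|//]; rewrite -[w \in _]/(w \notin p) wp' in wp.
Qed.

End ResidueFieldOfLocal.

(** An inverse of s maps under h to an inverse of h s, and the retraction pi carries inverses
    back. *)
Lemma local_hom (S R : comPzRingType) (mS : ideal S) (mR : ideal R)
    (h : {rmorphism S -> R}) (pi : {rmorphism R -> S}) :
  noetherian S -> noetherian R -> local_ring mS -> local_ring mR -> cancel h pi ->
  forall s, (h s \in mR) = (s \in mS).
Proof.
move=> nS nR lS lR hK s; apply/idP/idP => [hs|sm].
  apply: contrapT => /negP /(local_unit nS lS)[u us].
  move/negP: (max1 lR); apply; rewrite -(rmorph1 h) -us rmorphM.
  exact: idealMl.
apply: contrapT => /negP /(local_unit nR lR)[u us].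
move/negP: (max1 lS); apply; rewrite -(rmorph1 pi) -us rmorphM hK.
exact: idealMl.
Qed.

Lemma qring_pi0 (R : comPzRingType) (J : ideal R) (r : R) : qring_pi J r = 0 <-> r \in J.
Proof. exact: qmod_pi0. Qed.

Lemma qring_pi_surj (R : comPzRingType) (J : ideal R) : surj (qring_pi J).
Proof. exact: (qmod_pi_surj (N := J)). Qed.

(** * The central fibre and its maximal ideal *)

Section CentralFibreOfFamily.
Variables (S R : comPzRingType) (mS : ideal S) (h : {rmorphism S -> R}) (pi : {rmorphism R -> S}).
Hypotheses (nS : noetherian S) (lS : local_ring mS) (hK : cancel h pi).
Variable mA : ideal (central_fibre h mS).
Hypothesis lA : local_ring mA.

Local Notation to_central := (to_fibre h (qring_pi mS) : {rmorphism R -> central_fibre h mS}).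

Lemma augmentation_to_fibre r : augmentation mS hK (to_central r) = qring_pi mS (pi r).
Proof. by rewrite [LHS]talg_liftE /= mulr1. Qed.

Lemma augmentation_surj : surj (augmentation mS hK).
Proof.
move=> k; have [s <-] := qring_pi_surj k; exists (to_central (h s)).
by rewrite augmentation_to_fibre hK.
Qed.

(** Nonzero elements of S/mS are invertible, so the kernel of the augmentation is maximal, and mA is
    the only maximal ideal. *)
Lemma max_augmentation a : (a \in mA) = (augmentation mS hK a == 0).
Proof.
have kmax : maximal_ideal (kernel (augmentation mS hK) : ideal (central_fibre h mS)).
  split; first by apply/negP => /eqP; rewrite rmorph1 => /qring_pi0; apply/negP/max1.
  move=> J J1 kJ b bJ; apply: contrapT => /negP bk; move/negP: J1; apply.
  have [s sb] := qring_pi_surj (augmentation mS hK b).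
  have [|u us] := local_unit nS lS (x := s).
    by apply: contra bk => /qring_pi0 s0; apply/eqP; rewrite -sb.
  rewrite -[1](subrK (to_central (h u) * b)); apply: idealD; last exact: idealMl.
  apply: kJ; apply/eqP; rewrite rmorphB rmorph1 rmorphM augmentation_to_fibre hK -sb.
  by rewrite -rmorphM us rmorph1 subrr.
by rewrite -(proj2 lA _ kmax a).
Qed.

Lemma max_to_fibre r : (to_central r \in mA) = (pi r \in mS).
Proof.
rewrite max_augmentation augmentation_to_fibre.
by apply/eqP/idP => /qring_pi0.
Qed.

Lemma kernel_stably_reflexive (p : ideal S) (pP : prime_ideal p) :
  p =i mS -> stably_reflexive (submod mA) ->
  @stably_reflexive (talg h (to_residue_field pP))
      (tmod h (to_residue_field pP) (submod (kernel pi)) (residue_field pP)^o).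
Proof.
move=> pm srA.
have gS := @qring_pi_surj _ mS; have gK := @qring_pi0 _ mS.
have gS' := @residue_surj S mS p pP nS lS pm; have gK' := @residue_ker S mS p pP nS lS pm.
(* Both conditions say that r vanishes in (S/mS) (x) R, so the two fibres are quotients of R by the
   same ideal. *)
have kE r : to_fibre h (to_residue_field pP) r = 0 <-> to_central r = 0.
  rewrite -(to_fibreP h gS' gK' (@residue_gen_surj S mS) (@residue_gen_ann S mS)).
  exact: (to_fibreP h gS gK (@residue_gen_surj S mS) (@residue_gen_ann S mS)).
have rS := @to_fibre_surj S R _ h _ gS; have rS' := @to_fibre_surj S R _ h _ gS'.
have [psi psiP] := ring_iso_of_kernels rS' rS kE.
have [psi' psiP'] := ring_iso_of_kernels rS rS' (fun r => iff_sym (kE r)).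
have psiK : cancel psi psi' by move=> b; have [r <-] := rS' b; rewrite psiP psiP'.
have psiK' : cancel psi' psi by move=> a; have [r <-] := rS a; rewrite psiP' psiP.
have psiS : surj psi by move=> a; exists (psi' a).
have mem b : (psi b \in mA) <-> fibre_aug (to_residue_field pP) hK b = 0.
  have [r <-] := rS' b; rewrite psiP max_to_fibre fibre_aug_to_fibre; exact: iff_sym.
pose F t : submod mA := Submod ((mem _).2 (fibre_aug_ker hK t)).
apply: (stably_reflexive_transport psiS psiK psiK' (F := F)) srA.
- move=> b t u; apply: (@sincl_inj _ _ mA); rewrite linD linZ.
  by rewrite -[LHS]/(psi _) ker_to_fibre_linear rmorphD rmorphM.
- apply: inj_surj_bij => [t u /(congr1 (sincl mA))|a].
    by move=> /(can_inj psiK) /(ker_to_fibre_inj hK).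
  have /mem : psi (psi' (sincl mA a)) \in mA by rewrite psiK'; apply: sincl_in.
  move=> /(ker_to_fibre_onto gS' gK')[t tP].
  by exists t; apply: (@sincl_inj _ _ mA); rewrite -[LHS]/(psi _) tP psiK'.
Qed.

End CentralFibreOfFamily.

Theorem theorem6p1
  (S R : comPzRingType) (mS : ideal S) (mR : ideal R)
  (hS : local_ring mS) (hR : local_ring mR)
  (nS : noetherian S) (nR : noetherian R)
  (h : {rmorphism S -> R}) (hflat : flat_hom h)
  (pi : {rmorphism R -> S}) (hK : cancel h pi)
  (mA : ideal (central_fibre h mS))
  (gorA : gorenstein_local mA) (dimA : krull_dim (central_fibre h mS) 1) :
  let I := kernel pi : ideal R in
  let dual_mA := dual (submod mA) in
  let dual_mA_k := base_change (augmentation mS hK) dual_mA in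
  [/\ stably_reflexive_wrt h (submod I), lmod_iso (qmod (limage (mul_on I))) (restr pi S^o),
      lmod_iso (submod (multipliers I)) (dual (submod I))
    & [/\ regular_local mA ->
            forall a : central_fibre h mS, exists t : tensor (submod mA) dual_mA, tpairing t = a,
          ~ regular_local mA ->
            forall a : central_fibre h mS, (exists t : tensor (submod mA) dual_mA, tpairing t = a)
                      <-> a \in mA,
          regular_local mA -> lmod_iso dual_mA_k 'rV[qring mS]_1
        & ~ regular_local mA -> lmod_iso dual_mA_k 'rV[qring mS]_2]].
Proof.
move=> I dual_mA dual_mA_k.
have [lA nA _] := gorA.
have [x' [z' [xz' Ext_tf ext_tf]]] := gorenstein_dim1 gorA dimA.
have gS := @qring_pi_surj _ mS; have gK := @qring_pi0 _ mS.
have rS := @to_fibre_surj S R _ h _ gS.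
have mAP := max_to_fibre nS hS hK lA.
have hloc := local_hom nS nR hS hR hK.
have [r r_x'] := rS x'; have [z zz'] := rS z'.
(* As x' lies in mA, pi r lies in mS and h(pi r) dies in the central fibre; the correction moves the
   lift into I without changing its image. *)
pose x := r - h (pi r).
have xI : x \in I := sub_pi_ker hK r.
have rx : to_fibre h (qring_pi mS) x = x'.
  rewrite rmorphB r_x' [X in _ - X](to_fibre_max _ gK) ?subr0 // -mAP r_x'.
  by case: xz'.
have xz : good_pair mA (to_fibre h (qring_pi mS) x) (to_fibre h (qring_pi mS) z) by rewrite rx zz'.
rewrite -rx in Ext_tf ext_tf.
have hmR s : s \in mS -> h s \in mR by rewrite hloc.
have rP := @to_fibreP S R _ h _ mS gS gK.
have qinj := @quo_injective _ _ _ _ nA xz ext_tf mA.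
have soc := @socle_gen _ _ _ _ lA nA xz ext_tf.
have [zeta [Izeta pzeta]] := ex_zeta hS hR nS nR hflat hK hmR rS rP mAP xI xz qinj.
split.
- split; first exact: flat_kernel.
  (* The only closed point of Spec R is mR, and its preimage under h is mS. *)
  move=> p pP [m mmax pm]; apply: (kernel_stably_reflexive nS hS hK lA).
    by move=> s; rewrite pm (proj2 hR m mmax) hloc.
  exact: (max_stably_reflexive lA nA xz Ext_tf).
- exact: (dual_quotient_iso hS hR nS nR hflat hK hmR rS rP mAP xI xz soc Izeta pzeta).
- apply: (multipliers_iso xI).
  exact: (x_regular hS hR nS nR hflat hmR rP xz).
- have aS := augmentation_surj (mS := mS) hK.
  have am a : a \in mA -> augmentation mS hK a = 0.
    by rewrite (max_augmentation nS hS hK lA) => /eqP.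
  split.
  + exact: (pairing_regular xz dimA).
  + exact: (pairing_nonregular lA nA dimA).
  + exact: (dual_max_regular xz dimA aS).
  + exact: (dual_max_nonregular lA nA xz ext_tf dimA aS am).
Qed.
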